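(* Let $d\ge 2$, and let $\mathbb{P}$ be the law of a family of non-negative conductances $\omega=(\omega_b)_b$ on the nearest-neighbour edges of $\mathbb{Z}^d$ which is stationary and ergodic with respect to the shifts $(\theta_x)_{x\in\mathbb{Z}^d}$ and satisfies Condition UE: there is $\kappa>0$ such that, $\mathbb{P}$-a.s., $\kappa<\omega_{0,x}<\kappa^{-1}$ for all $x\sim 0$. Let $W_\Sigma$ be the $d$-dimensional Brownian motion with covariance matrix $\Sigma$ (see context). For suprema and infima below, $x$ ranges over the points of $\mathbb{Z}^d$ in the indicated cube. Then the following statements hold and are equivalent: (i) $\mathbb{P}$-a.s., for all $H>0$ and every bounded continuous $F:C([0,1])\to\mathbb{R}$, $\displaystyle\lim_{n\to\infty}\sup_{x\in[-H\sqrt n,H\sqrt n]^d}\big|\mathtt{E}_{\theta_x\omega}[F(Z^n)]-E[F(W_\Sigma)]\big|=0$; (ii) $\mathbb{P}$-a.s., for all $H>0$ and every bounded uniformly continuous $F:C([0,1])\to\mathbb{R}$, $\displaystyle\lim_{n\to\infty}\sup_{x\in[-H\sqrt n,H\sqrt n]^d}\big|\mathtt{E}_{\theta_x\omega}[F(Z^n)]-E[F(W_\Sigma)]\big|=0$; (iii) $\mathbb{P}$-a.s., for all $H>0$ and every closed set $B\subset C([0,1])$, $\displaystyle\limsup_{n\to\infty}\sup_{x\in[-H\sqrt n,H\sqrt n]^d}\mathtt{P}_{\theta_x\omega}[Z^n\in B]\le P[W_\Sigma\in B]$; (iv) $\mathbb{P}$-a.s., for all $H>0$ and every open set $G\subset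 C([0,1])$, $\displaystyle\liminf_{n\to\infty}\inf_{x\in[-H\sqrt n,H\sqrt n]^d}\mathtt{P}_{\theta_x\omega}[Z^n\in G]\ge P[W_\Sigma\in G]$; (v) $\mathbb{P}$-a.s., for all $H>0$ and every Borel set $A\subset C([0,1])$ with $P[W_\Sigma\in\partial A]=0$, $\displaystyle\lim_{n\to\infty}\sup_{x\in[-H\sqrt n,H\sqrt n]^d}\big|\mathtt{P}_{\theta_x\omega}[Z^n\in A]-P[W_\Sigma\in A]\big|=0$.
   Context: Random walk: write $x\sim y$ if $x,y$ are nearest neighbours in $\mathbb{Z}^d$. For an environment $\omega$ let $\pi_x=\sum_{y\sim x}\omega_{x,y}$. The random walk $X=(X(k))_{k\ge0}$ in environment $\omega$ is the Markov chain on $\mathbb{Z}^d$ with transition probabilities $p_\omega(x,y)=\omega_{x,y}/\pi_x$ if $y\sim x$ and $0$ otherwise. $\mathtt{P}_\omega,\mathtt{E}_\omega$ denote its (quenched) law and expectation when started from $0$. $\theta_x\omega$ is the environment $\omega$ shifted by $x$, $(\theta_x\omega)_{y,z}=\omega_{x+y,x+z}$, so that $X$ under $\mathtt{P}_{\theta_x\omega}$ has the law of $X-x$ for the walk in environment $\omega$ started from $x$. $C([0,1])$ is the space of continuous functions $[0,1]\to\mathbb{R}^d$ with the uniform topology. $Z^n=(Z^n(t))_{t\in[0,1]}$ is the polygonal interpolation of $k/n\mapsto n^{-1/2}X(k)$, i.e. $\sqrt n\,Z^n(t)=X(\lfloor nt\rfloor)+(nt-\lfloor nt\rfloor)\big(X(\lfloor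 nt\rfloor+1)-X(\lfloor nt\rfloor)\big)$. It is known that under these assumptions, $\mathbb{P}$-a.s., under $\mathtt{P}_\omega$ the processes $Z^n$ converge weakly to a $d$-dimensional Brownian motion with a deterministic positive definite covariance matrix; $\Sigma$ denotes this matrix. *)

(* Defs.v *)
From HB Require Import structures.
From mathcomp Require Import all_boot all_order all_algebra.
From mathcomp Require Import all_classical all_reals all_analysis.

Set Implicit Arguments.
Unset Strict Implicit.
Unset Printing Implicit Defensive.

Import Order.TTheory GRing.Theory Num.Theory.
Import numFieldNormedType.Exports.

Local Open Scope classical_set_scope.
Local Open Scope ring_scope.

Notation I01 R := (set_type `[0%R : R, 1%R]%classic).

(* [arrow_uniform_type] carries the uniformity of uniform convergence. 'rV[R]_d
   is normed by the max norm, which induces the usual uniformity of R^d. *)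
Definition C01 (R : realType) (d : nat) : Type :=
  continuousType (I01 R) 'rV[R]_d.

Section C01_instances.
Variables (R : realType) (d : nat).

Local Notation uniform_topology := (initial_topology
  (fun f : continuousType (I01 R) 'rV[R]_d =>
     (f : I01 R -> 'rV[R]_d) : arrow_uniform_type (I01 R) 'rV[R]_d)).

HB.instance Definition _ := PseudoMetric.copy (C01 R d) uniform_topology.
HB.instance Definition _ := isPointed.Build (C01 R d) (cst 0).
HB.instance Definition _ :=
  Measurable.copy (C01 R d) (g_sigma_algebraType (@open (C01 R d))).

End C01_instances.

Section lattice.
Variable d : nat.
Implicit Types x y : 'rV[int]_d.

Definition nbr x y : bool := \sum_(i < d) `|x 0 i - y 0 i| == 1.

Definition unitv (i : 'I_d) : 'rV[int]_d := delta_mx 0 i.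

(* The pair (x, i) encodes the unoriented edge {x, x + e_i}; every
   nearest-neighbour edge of Z^d has exactly one such code. *)
Definition edge : Type := ('rV[int]_d * 'I_d)%type.

End lattice.

Section environment.
Variables (R : realType) (d : nat).

Definition cylinders : set (set (edge d -> R)) :=
  [set A | exists (b : edge d) (B : set R),
     measurable B /\ A = [set w | B (w b)]].

Definition env : Type := edge d -> R.
HB.instance Definition _ :=
  Measurable.copy env (@g_sigma_algebraType (edge d -> R) cylinders).

Implicit Types (w : env) (x y z : 'rV[int]_d).

(* omega_{x,y}, set to 0 when x and y are not neighbours *)
Definition cond w x y : R :=
  if [pick i | y == x + unitv i] is Some i then w (x, i)
  else if [pick i | x == y + unitv i] is Some i then w (y, i)
  else 0.

Definition shift x w : env := fun b => w (x + b.1, b.2).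

Lemma cond_shift x w y z : cond (shift x w) y z = cond w (x + y) (x + z).
Proof.
have h a b : [pick i | x + b == x + a + unitv i] = [pick i | b == a + unitv i].
  by apply: eq_pick => i /=; rewrite -addrA (inj_eq (addrI x)).
by rewrite /cond /shift !h.
Qed.

(* pi_x; the sum ranges over a finite set *)
Definition total_cond w x : R := \sum_(y \in [set y | nbr x y]) cond w x y.

Definition transition w x y : R :=
  if nbr x y then cond w x y / total_cond w x else 0.

Definition stationary (P : probability env R) : Prop :=
  forall x (A : set env), measurable A -> P (shift x @^-1` A) = P A.

Definition ergodic (P : probability env R) : Prop :=
  forall A : set env, measurable A -> (forall x, shift x @^-1` A = A) ->
    P A = 0%E \/ P A = 1%E.

Definition nonnegative_law (P : probability env R) : Prop :=
  {ae P, forall w, forall b, 0 <= w b}.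

Definition condition_UE (P : probability env R) : Prop :=
  exists2 kappa : R, 0 < kappa &
    {ae P, forall w, forall x, nbr 0 x -> kappa < cond w 0 x < kappa^-1}.

(* X is, under Q, the Markov chain with transition probabilities
   [transition w] started from 0 *)
Definition is_walk w d' (T : measurableType d') (Q : probability T R)
    (X : nat -> T -> 'rV[int]_d) : Prop :=
  [/\ forall k x, measurable [set t | X k t = x],
      Q [set t | X 0%N t = 0] = 1%E &
      forall (k : nat) (x : nat -> 'rV[int]_d),
        Q [set t | forall j, (j <= k.+1)%N -> X j t = x j] =
        (Q [set t | forall j, (j <= k)%N -> X j t = x j]
           * (transition w (x k) (x k.+1))%:E)%E].

(* The transition probabilities define a Markov chain only for non-negative w
   with all pi_x > 0; this is the case almost surely under condition UE. *)
Definition is_quenched_walk d' (T : measurableType d')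
    (X : nat -> T -> 'rV[int]_d) (Pq : env -> probability T R) : Prop :=
  forall w, (forall b, 0 <= w b) -> (forall x, 0 < total_cond w x) ->
    is_walk w (Pq w) X.

End environment.

Section polygonal.
Variables (R : realType) (d : nat).

Definition polygonal (y : nat -> 'rV[R]_d) (s : R) : 'rV[R]_d :=
  y (Num.truncn s) + (s - (Num.truncn s)%:R) *:
    (y (Num.truncn s).+1 - y (Num.truncn s)).

Let clamp (u : R) : R := Num.min 1 (Num.max 0 u).

Lemma polygonal_sum (y : nat -> 'rV[R]_d) (N : nat) (s : R) :
  0 <= s <= N%:R ->
  polygonal y s =
  y 0%N + \sum_(0 <= k < N.+1) clamp (s - k%:R) *: (y k.+1 - y k).
Proof.
move=> /andP[s0 sN]; rewrite /polygonal; set m := Num.truncn s.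
have /andP[ms sm] : m%:R <= s < m.+1%:R by exact: truncn_itv.
have mN : (m < N.+1)%N.
  by rewrite ltnS -(ler_nat R); exact: le_trans sN.
rewrite (big_cat_nat (n := m)) //=; last exact: ltnW.
rewrite [X in _ + (_ + X)]big_ltn // [X in _ + (_ + (_ + X))]big_nat_cond.
rewrite [X in _ + (_ + (_ + X))]big1 ?addr0; last first.
  move=> k /andP[/andP[mk _] _].
  rewrite /clamp max_l ?min_r ?scale0r //.
  by rewrite subr_le0 (le_trans (ltW sm)) // ler_nat.
rewrite big_nat_cond (eq_bigr (fun k => y k.+1 - y k)); last first.
  move=> k /andP[/andP[_ km] _].
  have h : 1 <= s - k%:R.
    by rewrite lerBrDr nat1r (le_trans _ ms) // ler_nat.
  by rewrite /clamp max_r ?min_l ?scale1r // (le_trans ler01).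
rewrite -big_nat_cond telescope_sumr // addrA addrCA subrr addr0.
congr (_ + _ *: _); rewrite /clamp max_r ?subr_ge0 // min_r //.
by rewrite lerBlDr addrC natr1 ltW.
Qed.

Let clamp_sum_continuous (T : topologicalType) (g : T -> R)
    (y : nat -> 'rV[R]_d) (n : nat) (c : R) :
  continuous g ->
  continuous (fun t => c *: (y 0%N + \sum_(0 <= k < n.+1)
    clamp (g t - k%:R) *: (y k.+1 - y k))).
Proof.
move=> gc t; apply: cvgZl_tmp; apply: cvgD; first exact: cvg_cst.
apply: cvg_big => [|k _]; first exact: add_continuous.
apply: cvgZr_tmp.
apply: (@continuous_comp _ _ _ (fun t => g t - k%:R) clamp).
  by apply: cvgB; [exact: gc|exact: cvg_cst].
apply: continuous_min; first exact: cvg_cst.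
by apply: continuous_max; [exact: cvg_cst|exact: cvg_id].
Qed.

Lemma polygonal_continuous (y : nat -> 'rV[R]_d) (n : nat) (c : R) :
  continuous (fun t : I01 R => c *: polygonal y (n%:R * \val t)).
Proof.
have -> : (fun t : I01 R => c *: polygonal y (n%:R * \val t)) =
    (fun t : I01 R => c *: (y 0%N + \sum_(0 <= k < n.+1)
      clamp (n%:R * \val t - k%:R) *: (y k.+1 - y k))).
  apply/funext => t; rewrite (@polygonal_sum _ n) //.
  have : (\val t : R) \in `[0, 1] by have := set_valP t.
  rewrite in_itv /= => /andP[t0 t1].
  by rewrite mulr_ge0 //= ler_piMr.
apply: clamp_sum_continuous => t.
apply: (@continuous_comp _ _ _ set_val (fun u : R => n%:R * u)).
  exact: initial_continuous.
exact: mulrl_continuous.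
Qed.

End polygonal.

(* Z^n for the trajectory x; the coordinate embedding Z^d -> R^d is
   [map_mx intr]. *)
Definition rescaled (R : realType) (d n : nat) (x : nat -> 'rV[int]_d) :
    C01 R d :=
  mkcts (@polygonal_continuous R d (fun k => map_mx intr (x k)) n
    (Num.sqrt n%:R)^-1).

Section brownian_motion.
Variables (R : realType) (d : nat).

Definition posdef (S : 'M[R]_d) : Prop :=
  S^T = S /\ forall u : 'rV[R]_d, u != 0 -> 0 < (u *m S *m u^T) 0 0.

Variables (dW : measure_display) (T : measurableType dW).
Variables (PW : probability T R) (W : T -> C01 R d).

Definition increment (s t : I01 R) (a : T) : 'rV[R]_d := W a t - W a s.

(* W_t - W_s is a centred Gaussian vector with covariance matrix (t - s) S: its
   scalar product with any nonzero u is N(0, (t - s) u S u^T). The second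
   parameter of [normal_prob] is the standard deviation. *)
Definition gaussian_increments (S : 'M[R]_d) : Prop :=
  forall (s t : I01 R) (u : 'rV[R]_d) (B : set R),
    \val s < \val t -> u != 0 -> measurable B ->
    PW [set a | B ((increment s t a *m u^T) 0 0)] =
    normal_prob 0 (Num.sqrt ((\val t - \val s) * (u *m S *m u^T) 0 0)) B.

Definition independent_increments : Prop :=
  forall (m : nat) (t : nat -> I01 R) (B : nat -> set 'rV[R]_d),
    (forall i, \val (t i) <= \val (t i.+1)) ->
    (forall i, <<s (@open 'rV[R]_d) >> (B i)) ->
    PW [set a | forall i, (i < m)%N -> B i (increment (t i) (t i.+1) a)] =
    (\prod_(i < m) fine (PW [set a | B i (increment (t i) (t i.+1) a)]))%:E.

Definition brownian_motion (S : 'M[R]_d) : Prop :=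
  [/\ measurable_fun setT W,
      {ae PW, forall a, forall t : I01 R, \val t = 0 -> W a t = 0},
      gaussian_increments S &
      independent_increments].

End brownian_motion.

Section invariance_principles.
Variables (R : realType) (d : nat) (P : probability (env R d) R).
Variables (dX : measure_display) (TX : measurableType dX).
Variables (X : nat -> TX -> 'rV[int]_d) (Pq : env R d -> probability TX R).
Variables (dW : measure_display) (TW : measurableType dW).
Variables (PW : probability TW R) (W : TW -> C01 R d).

Definition Z (n : nat) (a : TX) : C01 R d := rescaled R n (X ^~ a).

Definition cube (H : R) (n : nat) : set 'rV[int]_d :=
  [set x | forall i, `|(x 0 i)%:~R| <= H * Num.sqrt n%:R].

Local Open Scope ereal_scope.

Definition quenched_CLT : Prop :=
  {ae P, forall w, forall F : C01 R d -> R, bounded_fun F -> continuous F ->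
    'E_(Pq w)[F \o Z n] @[n --> \oo] --> 'E_PW[F \o W]}.

Definition uniform_CLT_continuous : Prop :=
  {ae P, forall w, forall (H : R) (F : C01 R d -> R), (0 < H)%R ->
    bounded_fun F -> continuous F ->
    ereal_sup [set `|'E_(Pq (shift x w))[F \o Z n] - 'E_PW[F \o W]|
              | x in cube H n] @[n --> \oo] --> 0}.

Definition uniform_CLT_unif_continuous : Prop :=
  {ae P, forall w, forall (H : R) (F : C01 R d -> R), (0 < H)%R ->
    bounded_fun F -> unif_continuous F ->
    ereal_sup [set `|'E_(Pq (shift x w))[F \o Z n] - 'E_PW[F \o W]|
              | x in cube H n] @[n --> \oo] --> 0}.

Definition uniform_CLT_closed : Prop :=
  {ae P, forall w, forall (H : R) (B : set (C01 R d)), (0 < H)%R -> closed B ->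
    limn_esup (fun n =>
      ereal_sup [set Pq (shift x w) (Z n @^-1` B) | x in cube H n])
    <= PW (W @^-1` B)}.

Definition uniform_CLT_open : Prop :=
  {ae P, forall w, forall (H : R) (G : set (C01 R d)), (0 < H)%R -> open G ->
    PW (W @^-1` G) <=
    limn_einf (fun n =>
      ereal_inf [set Pq (shift x w) (Z n @^-1` G) | x in cube H n])}.

Definition uniform_CLT_continuity_set : Prop :=
  {ae P, forall w, forall (H : R) (A : set (C01 R d)), (0 < H)%R ->
    measurable A -> PW (W @^-1` (closure A `\` A°)) = 0 ->
    ereal_sup [set `|Pq (shift x w) (Z n @^-1` A) - PW (W @^-1` A)|
              | x in cube H n] @[n --> \oo] --> 0}.

End invariance_principles.

(* Main.v *)
(** Restart the walk after a short time at a good site. Call a site good from time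
    N on if, for all n >= N, the walk started there has E[F(Z^n)] close to
    E[F(W)] and a small expected modulus of continuity. By the quenched CLT a given
    site is bad from N on with probability tending to 0 as N grows, so by the
    maximal inequality for the stationary action of Z^d (a Vitali covering
    argument) the bad sites have, almost surely, arbitrarily small density in
    all cubes centred at the origin, once N is large. It remains to see that
    from any starting point in a cube of radius H sqrt n the walk meets a good
    site within time n / (q + 1) and distance rho sqrt n with probability close
    to 1. The probability v of failing to do so is almost a subharmonic function,
    vanishing at the good sites, and the De Giorgi - Stampacchia iteration over
    the superlevel sets of v(x) - |x - x0| / l, with the Faber-Krahn inequality on
    Z^d, shows that v is small when the bad sites are sparse.

    The exceptional null set is made independent of F by approximating F with
    combinations of countably many Lipschitz functions, built on a countable
    dense set of paths; closed, open and continuity sets and continuous functions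
    follow as in the portmanteau theorem, uniformly in the starting point. *)

Require Import Defs.
From HB Require Import structures.
From mathcomp Require Import all_boot all_order all_algebra.
From mathcomp Require Import finmap.
From mathcomp Require Import all_classical all_reals all_analysis measurable_realfun.
From mathcomp Require Import zify ring lra.

Set Implicit Arguments.
Unset Strict Implicit.
Unset Printing Implicit Defensive.

Import Order.TTheory GRing.Theory Num.Theory.
Import numFieldNormedType.Exports.

Local Open Scope classical_set_scope.
Local Open Scope ring_scope.

(** * Finitely supported sums and the Faber-Krahn inequality *)

(** The quenched CLT carries no rate, and a cube of radius [H * sqrt n] contains of order n^(d/2)
    starting points, so a union bound over them is out of reach: the information has to travel from
    typical sites to exceptional ones through the walk itself. A restart costs a displacement and a
    time shift, and the time shift is the reason why the modulus of continuity enters the notion of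
    a good site. The scales fit because everything is diffusive. A time horizon and a squared radius
    of order n give the failure probability an excess of order 1/n over subharmonicity, cutoff
    included; Faber-Krahn for a set of at most (c sqrt n)^d points loses a factor of order c^2 n;
    the product is of order c^2, and c is governed by the permitted density of bad sites. Hence the
    order of the choices: the tolerance, the modulus scale q, the radius rho, then c and the
    density, and only then N and n. All five statements are proved outright, and their equivalence
    follows from that. *)

Section zsum.
Variables (R : realType) (V : zmodType).
Implicit Types f g h : V -> R.

Definition fsupp g := finite_set [set x | g x != 0].

(** On a function of infinite support this sum takes the default value 0. Scaling, translation and
    nonnegativity survive that convention; additivity and monotonicity do not, and there [fsupp] is
    assumed. *)
Definition zsum g : R := \sum_(x \in [set: V]) g x.

Lemma zsumE (S : {fset V}) g :
  (forall x, x \notin S -> g x = 0) -> zsum g = \sum_(x <- S) g x.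
Proof.
move=> gS; rewrite /zsum (fsbigE S) //=; last by move=> x _ /gS.
by apply: eq_bigl => x; rewrite in_setT.
Qed.

Lemma fsuppP g : fsupp g -> exists S : {fset V}, forall x, x \notin S -> g x = 0.
Proof.
move=> fg; exists (fset_set [set x | g x != 0]) => x.
by rewrite in_fset_set // notin_setE /= => /negP; rewrite negbK => /eqP.
Qed.

Lemma fsupp_fset (S : {fset V}) g : (forall x, x \notin S -> g x = 0) -> fsupp g.
Proof.
move=> gS; apply: (sub_finite_set _ (finite_fset S)) => x /= /eqP gx.
by apply: contrapT => /negP /gS.
Qed.

Lemma fsupp_sub g h : fsupp g -> (forall x, g x = 0 -> h x = 0) -> fsupp h.
Proof.
move=> fg gh; apply: (sub_finite_set _ fg) => x /=.
by apply: contra_neq; exact: gh.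
Qed.

Lemma fsupp_shift g z : fsupp g -> fsupp (fun x => g (x + z)).
Proof.
case/fsuppP => S gS; apply: (@fsupp_fset [fset y - z | y in S]%fset) => x.
move=> xS; apply: gS; apply: contra xS => xzS.
by apply/imfsetP; exists (x + z); rewrite ?addrK.
Qed.

Lemma fsuppD g h : fsupp g -> fsupp h -> fsupp (fun x => g x + h x).
Proof.
case/fsuppP => S gS /fsuppP[T hT]; apply: (@fsupp_fset (S `|` T)%fset) => x.
by rewrite in_fsetE negb_or => /andP[/gS -> /hT ->]; rewrite addr0.
Qed.

Lemma zsumD g h : fsupp g -> fsupp h ->
  zsum (fun x => g x + h x) = zsum g + zsum h.
Proof.
case/fsuppP => S gS /fsuppP[T hT].
rewrite (@zsumE (S `|` T)%fset) ?(@zsumE (S `|` T)%fset g)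
  ?(@zsumE (S `|` T)%fset h) ?big_split //;
  move=> x; rewrite in_fsetE negb_or => /andP[xS xT]; rewrite ?gS ?hT ?addr0 //.
Qed.

Lemma zsumZ a g : zsum (fun x => a * g x) = a * zsum g.
Proof. by rewrite /zsum mulr_fsumr. Qed.

Lemma zsum_shift g z : zsum (fun x => g (x + z)) = zsum g.
Proof.
apply/esym/(@reindex_fsbigT _ _ _ _ _ (fun x => x + z)).
by exists (fun x => x - z) => x; rewrite ?addrK ?subrK.
Qed.

Lemma zsum_ge0 g : (forall x, 0 <= g x) -> 0 <= zsum g.
Proof. by move=> g0; apply: fsumr_ge0. Qed.

Lemma le_zsum g h : fsupp g -> fsupp h -> (forall x, g x <= h x) ->
  zsum g <= zsum h.
Proof.
case/fsuppP => S gS /fsuppP[T hT] gh.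
rewrite (@zsumE (S `|` T)%fset g) ?(@zsumE (S `|` T)%fset h) ?ler_sum //;
  move=> x; rewrite in_fsetE negb_or => /andP[xS xT]; rewrite ?gS ?hT //.
Qed.


Lemma fsupp_sum (I : Type) (s : seq I) (F : I -> V -> R) :
  (forall i, fsupp (F i)) -> fsupp (fun x => \sum_(i <- s) F i x).
Proof.
move=> FF; elim: s => [|i s IH].
  by apply: (@fsupp_fset fset0) => x _; rewrite big_nil.
apply: (@fsupp_sub (fun x => F i x ^+ 2 + (\sum_(i <- s) F i x) ^+ 2)).
  by apply: fsuppD; [apply: (fsupp_sub (FF i))|apply: (fsupp_sub IH)];
    move=> x ->; rewrite expr0n.
move=> x /eqP; rewrite paddr_eq0 ?sqr_ge0 // !sqrf_eq0 big_cons.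
by move=> /andP[/eqP -> /eqP ->]; rewrite addr0.
Qed.

Lemma zsum_sum (I : Type) (s : seq I) (F : I -> V -> R) :
  (forall i, fsupp (F i)) ->
  zsum (fun x => \sum_(i <- s) F i x) = \sum_(i <- s) zsum (F i).
Proof.
move=> FF; elim: s => [|i s IH].
  rewrite big_nil (@zsumE fset0) ?big_seq_fset0 // => x _.
  by rewrite big_nil.
under eq_fun do rewrite big_cons.
by rewrite zsumD ?IH ?big_cons //; exact: fsupp_sum.
Qed.

Lemma zsum_indic (S : {fset V}) : zsum (fun x => (x \in S)%:R) = #|` S|%:R.
Proof.
rewrite (@zsumE S) => [|x /negbTE -> //].
by rewrite big_seq (eq_bigr (fun=> 1)) => [|x -> //]; rewrite -big_seq big_const_seq
  count_predT iter_addr_0.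
Qed.

End zsum.
Section faber_krahn.
Variables (R : realType) (d : nat).
Local Notation V := 'rV[int]_d.
Implicit Types f : V -> R.

(** The Dirichlet form with unit conductances: each edge, coded by its lower endpoint and its
    direction, is counted once. *)
Definition energy f : R :=
  \sum_(i < d) zsum (fun x => (f x - f (x + unitv i)) ^+ 2).

Lemma fsupp_diff f z : fsupp f -> fsupp (fun x => (f x - f (x + z)) ^+ 2).
Proof.
move=> ff; apply: (@fsupp_sub _ _ (fun x => f x ^+ 2 + f (x + z) ^+ 2)).
  apply: fsuppD; first by apply: (fsupp_sub ff) => x ->; rewrite expr0n.
  by apply: (fsupp_sub (fsupp_shift z ff)) => x ->; rewrite expr0n.
move=> x /eqP; rewrite paddr_eq0 ?sqr_ge0 // !sqrf_eq0 => /andP[/eqP-> /eqP->].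
by rewrite subr0 expr0n.
Qed.

Lemma energy_ge0 f : 0 <= energy f.
Proof. by apply: sumr_ge0 => i _; apply: zsum_ge0 => x; exact: sqr_ge0. Qed.

(** Young's inequality with weights [1 + M^-1] and [1 + M], where [M] is m + 1: the bounds add up to
    (1 + 1/M) M^2 + (1 + M) = (M + 1)^2, so the constant stays a perfect square. The index is
    shifted by one to keep [M] positive. *)
Lemma shift_energy_step f z m i : fsupp f ->
  zsum (fun x => (f x - f (x + z)) ^+ 2) <= m.+1%:R ^+ 2 * energy f ->
  zsum (fun x => (f x - f (x + (z + unitv i))) ^+ 2) <= m.+2%:R ^+ 2 * energy f.
Proof.
move=> ff Hz; set M := m.+1%:R : R.
have M0 : 0 < M by rewrite ltr0n.
pose g x := f x - f (x + unitv i).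
have fg : fsupp (fun x => g (x + z) ^+ 2).
  by apply: (@fsupp_shift _ _ (fun x => g x ^+ 2)); exact: fsupp_diff.
have fz := fsupp_diff z ff.
have Hi : zsum (fun x => g (x + z) ^+ 2) <= energy f.
  rewrite (zsum_shift (fun x => g x ^+ 2)) /energy (bigD1 i) //= lerDl.
  by apply: sumr_ge0 => j _; apply: zsum_ge0 => x; exact: sqr_ge0.
have fZ a h : fsupp h -> fsupp (fun x : V => (a : R) * h x).
  by move=> fh; apply: (fsupp_sub fh) => x ->; rewrite mulr0.
apply: (@le_trans _ _ (zsum (fun x => (1 + M^-1) * (f x - f (x + z)) ^+ 2 +
    (1 + M) * g (x + z) ^+ 2))).
  apply: le_zsum; [exact: fsupp_diff|by apply: fsuppD; exact: fZ|].
  move=> x; rewrite addrA.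
  set a := f x - f (x + z).
  have -> : f x - f (x + z + unitv i) = a + g (x + z) by rewrite /a /g; ring.
  set b := g (x + z); rewrite -subr_ge0.
  have -> : (1 + M^-1) * a ^+ 2 + (1 + M) * b ^+ 2 - (a + b) ^+ 2 =
      M^-1 * (a - M * b) ^+ 2 by field; rewrite lt0r_neq0.
  by rewrite mulr_ge0 ?sqr_ge0 // invr_ge0 ltW.
rewrite zsumD ?zsumZ; [|exact: fZ|exact: fZ].
apply: (@le_trans _ _ ((1 + M^-1) * (M ^+ 2 * energy f) + (1 + M) * energy f)).
  by apply: lerD; apply: ler_wpM2l => //; rewrite addr_ge0 ?invr_ge0 // ltW.
have -> : m.+2%:R = M + 1 :> R by rewrite /M natr1.
rewrite le_eqVlt; apply/orP; left; apply/eqP; field; exact: lt0r_neq0.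
Qed.

Lemma shift_energy f (s : seq 'I_d) (n : 'I_d -> nat) : fsupp f ->
  zsum (fun x => (f x - f (x + \sum_(i <- s) unitv i *+ n i)) ^+ 2) <=
  (\sum_(i <- s) n i).+1%:R ^+ 2 * energy f.
Proof.
move=> ff; elim: s => [|i s IH].
  rewrite !big_nil expr1n mul1r.
  under eq_fun do rewrite addr0 subrr expr0n /=.
  by rewrite (@zsumE _ _ fset0) ?big_seq_fset0 ?energy_ge0.
rewrite !big_cons; elim: (n i) => [|k IHk].
  by rewrite add0n; under eq_fun do rewrite mulr0n add0r.
rewrite addSn; have := shift_energy_step i ff IHk.
by under eq_fun do rewrite addrAC -mulrSr.
Qed.

Definition box_pt r (n : {ffun 'I_d -> 'I_r}) : V :=
  \sum_i unitv i *+ n i.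

Lemma box_ptE r n i : @box_pt r n 0 i = (n i)%:Z.
Proof.
rewrite /box_pt summxE (bigD1 i) //= big1 ?addr0.
  by rewrite mulmxnE mxE !eqxx mulr1n natz.
move=> j ji; rewrite mulmxnE /unitv mxE eqxx /= eq_sym (negbTE ji) mul0rn //.
Qed.

Lemma box_pt_inj r : injective (@box_pt r).
Proof.
move=> n m nm; apply/ffunP => i; apply/val_inj.
by have := congr1 (fun x : V => x 0 i) nm; rewrite !box_ptE => -[].
Qed.

(* Averaging over the shifts z in [0,r)^d: at least half of the points x + z
   fall outside the support of f, where f x = f x - f (x + z). *)
Lemma faber_krahn f (S : {fset V}) r : (forall x, x \notin S -> f x = 0) ->
  (2 * #|` S| <= r ^ d)%N -> (0 < r)%N ->
  zsum (fun x => f x ^+ 2) <= 2 * (d.+1 * r)%:R ^+ 2 * energy f.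
Proof.
move=> fS Sr r0.
have ff : fsupp f by exact: fsupp_fset fS.
have ff2 : fsupp (fun x => f x ^+ 2).
  by apply: (fsupp_sub ff) => x ->; rewrite expr0n.
set E := energy f; set Q := zsum _.
pose N := {ffun 'I_d -> 'I_r}.
have cN : (#|{: N}| = r ^ d)%N by rewrite card_ffun !card_ord.
have H1 : (r ^ d - #|` S|)%:R * Q <=
    \sum_(n : N) zsum (fun x => (f x - f (x + box_pt n)) ^+ 2).
  rewrite -zsum_sum; last by move=> n; exact: fsupp_diff.
  rewrite -zsumZ; apply: le_zsum.
  - by apply: (fsupp_sub ff2) => x ->; rewrite mulr0.
  - by apply: fsupp_sum => n; exact: fsupp_diff.
  move=> x; rewrite (bigID (fun n : N => x + box_pt n \in S)) /=.
  rewrite -[leLHS]add0r; apply: lerD; first by apply: sumr_ge0 => n _; exact: sqr_ge0.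
  rewrite (eq_bigr (fun=> f x ^+ 2)); last by move=> n nS; rewrite (fS _ nS) subr0.
  rewrite sumr_const -[leRHS]mulr_natl; apply: ler_wpM2r; first exact: sqr_ge0.
  (* Distinct shifts lead to distinct points, so no more than [#|S|] of them can land in [S]. *)
  rewrite ler_nat leq_subLR -cN -(cardC (fun n : N => x + box_pt n \in S)).
  rewrite leq_add2r cardE -(size_map (fun n => x + box_pt n)).
  apply: uniq_leq_size.
    by rewrite map_inj_uniq ?enum_uniq // => a b /addrI; exact: box_pt_inj.
  by move=> y /mapP[n]; rewrite mem_enum => nS ->.
have H2 : \sum_(n : N) zsum (fun x => (f x - f (x + box_pt n)) ^+ 2) <=
    (r ^ d)%:R * ((d.+1 * r)%:R ^+ 2 * E).
  apply: (@le_trans _ _ (\sum_(n : N) (d.+1 * r)%:R ^+ 2 * E)).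
    apply: ler_sum => n _.
    apply: (le_trans (shift_energy (index_enum 'I_d) (fun i => n i : nat) ff)).
    apply: ler_wpM2r; first exact: energy_ge0.
    rewrite ler_pXn2r ?nnegrE ?ler0n // ler_nat mulSn -addn1 addnC leq_add //.
    apply: (@leq_trans (\sum_(i < d) r)).
      by apply: leq_sum => i _; exact: ltnW.
    by rewrite sum_nat_const card_ord.
  by rewrite sumr_const cN mulr_natl.
have rd0 : 0 < (r ^ d)%:R :> R by rewrite ltr0n expn_gt0 r0.
have H3 : (r ^ d)%:R <= 2 * (r ^ d - #|` S|)%:R :> R.
  rewrite -natrM ler_nat; lia.
have Q0 : 0 <= Q by apply: zsum_ge0 => x; exact: sqr_ge0.
rewrite -(ler_pM2l rd0); apply: (@le_trans _ _ (2 * ((r ^ d - #|` S|)%:R * Q))).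
  by rewrite mulrA; apply: ler_wpM2r.
rewrite [X in _ <= X](_ : _ = 2 * ((r ^ d)%:R * ((d.+1 * r)%:R ^+ 2 * E))); last by ring.
by apply: ler_wpM2l => //; exact: le_trans H2.
Qed.

End faber_krahn.
(** * Sparse sets are left quickly *)

Section sup_norm.
Variable d : nat.
Local Notation V := 'rV[int]_d.
Implicit Types x y z : V.

Lemma rvD x y i : (x + y) 0 i = (x 0 i : int) + y 0 i.
Proof. by rewrite mxE. Qed.

Lemma rvB x y i : (x - y) 0 i = (x 0 i : int) - y 0 i.
Proof. by rewrite !mxE. Qed.

Definition nrm x : nat := \max_(i < d) absz (x 0%R i).

Lemma nrmP x n : reflect (forall i, absz (x 0%R i) <= n)%N (nrm x <= n)%N.
Proof.
apply: (iffP (bigmax_leqP _ _ _)) => H i; first exact: H.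
by move=> _; exact: H.
Qed.

Lemma nrm_ge x i : (absz (x 0%R i) <= nrm x)%N.
Proof. exact: (elimT (nrmP _ _) (leqnn _)). Qed.

Lemma nrm0 : nrm 0 = 0%N.
Proof. by apply/eqP; rewrite -leqn0; apply/nrmP => i; rewrite mxE. Qed.

Lemma nrmN x : nrm (- x) = nrm x.
Proof. by apply: eq_bigr => i _; rewrite mxE abszN. Qed.

Lemma nrmD x y : (nrm (x + y)%R <= nrm x + nrm y)%N.
Proof.
apply/nrmP => i; rewrite rvD.
have := nrm_ge x i; have := nrm_ge y i; lia.
Qed.

Lemma nrm_unitv (i : 'I_d) : (nrm (unitv i) <= 1)%N.
Proof. by apply/nrmP => j; rewrite mxE; case: andP. Qed.

Lemma nrm_step x z i : (nrm (x + unitv i - z)%R <= (nrm (x - z)%R).+1)%N /\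
  (nrm (x - z)%R <= (nrm (x + unitv i - z)%R).+1)%N.
Proof.
have H := nrm_unitv i; split.
  have -> : x + unitv i - z = (x - z) + unitv i by rewrite addrAC.
  by have := nrmD (x - z) (unitv i); lia.
have {1}-> : x - z = (x + unitv i - z) + - unitv i by rewrite addrAC addrK.
by have := nrmD (x + unitv i - z) (- unitv i); rewrite nrmN; lia.
Qed.

Definition box (L : nat) : {fset V} :=
  [fset (box_pt n - const_mx L%:Z)%R | n in {: {ffun 'I_d -> 'I_(L.*2.+1)}}]%fset.

Lemma in_box L x : (x \in box L) = (nrm x <= L)%N.
Proof.
apply/imfsetP/nrmP => [[n _ ->] i|H].
  by rewrite rvB box_ptE mxE; case: (n i : 'I_(L.*2.+1)) => k /= hk; lia.
have Hi i : (absz ((x 0%R i : int) + L%:Z)%R < L.*2.+1)%N by have := H i; lia.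
exists [ffun i => Ordinal (Hi i)] => //; apply/rowP => i.
by rewrite rvB box_ptE mxE ffunE /=; have := H i; lia.
Qed.

Lemma card_box L : #|` box L| = (L.*2.+1 ^ d)%N.
Proof.
rewrite card_imfset /=; last by move=> a b /addIr; exact: box_pt_inj.
by rewrite -cardE card_ffun !card_ord.
Qed.

End sup_norm.

(** Along an edge, [s] stands for the difference of [g], [p] for that of the cutoff and [D] for that
    of the truncation; the cross term [p * D] is absorbed by half of [D ^+ 2]. *)
Lemma young_edge (R : realFieldType) (s p D m : R) :
  D ^+ 2 <= s * D -> `|p| <= m -> D ^+ 2 / 2 - m ^+ 2 / 2 <= (s + p) * D.
Proof.
rewrite ler_norml => hs /andP[h1 h2].
have h3 : p ^+ 2 <= m ^+ 2 by rewrite -subr_ge0 subr_sqr mulr_ge0 //; lra.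
have h4 : 0 <= (p + D) ^+ 2 by exact: sqr_ge0.
rewrite sqrrD in h4; rewrite mulrDl; lra.
Qed.

(** * De Giorgi iteration for almost subharmonic functions *)

Section hitting.
Variables (R : realType) (d : nat).
Local Notation V := 'rV[int]_d.
Variables (kappa : R) (kappa_gt0 : 0 < kappa).
Variables (a : V -> 'I_d -> R).
Hypothesis a_bnd : forall x i, kappa <= a x i <= kappa^-1.

(** The negative of the generator of the variable speed walk, with one term for each of the two
    edges in direction [i]; dividing by [wsum] gives v minus its mean after one step. *)
Definition outflow (v : V -> R) x : R :=
  \sum_(i < d) (a x i * (v x - v (x + unitv i)) +
                a (x - unitv i) i * (v x - v (x - unitv i))).

Definition wsum x : R := \sum_(i < d) (a x i + a (x - unitv i) i).

Lemma wsum_bnd x : 0 <= wsum x <= d%:R * (2 * kappa^-1).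
Proof.
apply/andP; split.
  apply: sumr_ge0 => i _.
  have /andP[h1 _] := a_bnd x i; have /andP[h2 _] := a_bnd (x - unitv i) i.
  by apply: addr_ge0; apply: ltW; exact: lt_le_trans kappa_gt0 _.
apply: (@le_trans _ _ (\sum_(i < d) 2 * kappa^-1)).
  apply: ler_sum => i _; rewrite mulr_natl mulr2n.
  have /andP[_ h1] := a_bnd x i; have /andP[_ h2] := a_bnd (x - unitv i) i.
  exact: lerD.
by rewrite sumr_const card_ord -[leLHS]mulr_natl.
Qed.

(** Each edge occurs twice on the left, once from each endpoint; translating the backward terms by
    [unitv i] collects both at the lower endpoint. The support of [q] alone makes all sums finite,
    so [v] may be arbitrary. *)
Lemma summation_by_parts (v q : V -> R) : fsupp q ->
  zsum (fun x => outflow v x * q x) = \sum_(i < d) zsum (fun x =>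
    a x i * ((v x - v (x + unitv i)) * (q x - q (x + unitv i)))).
Proof.
move=> fq; pose F i x := a x i * (v x - v (x + unitv i)).
have f1 i : fsupp (fun x => F i x * q x).
  by apply: (fsupp_sub fq) => x ->; rewrite mulr0.
have f2 i : fsupp (fun x => - F i (x - unitv i) * q x).
  by apply: (fsupp_sub fq) => x ->; rewrite mulr0.
have -> : (fun x => outflow v x * q x) = (fun x => \sum_(i < d)
    (F i x * q x + - F i (x - unitv i) * q x)).
  apply/funext => x; rewrite /outflow mulr_suml; apply: eq_bigr => i _.
  rewrite /F subrK; ring.
rewrite zsum_sum; last by move=> i; exact: fsuppD.
apply: eq_bigr => i _; rewrite zsumD //.
rewrite -(zsum_shift (fun x => - F i (x - unitv i) * q x) (unitv i)) -zsumD //;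
  last exact: (@fsupp_shift _ _ (fun x => - F i (x - unitv i) * q x)).
by congr zsum; apply/funext => x; rewrite addrK /F; ring.
Qed.

Variables (x0 : V) (l : nat) (l_gt0 : (0 < l)%N) (v : V -> R) (lam : R).
Variable (S : {fset V}).
Hypothesis lam_ge0 : 0 <= lam.
Hypothesis v_bnd : forall x, 0 <= v x <= 1.
Hypothesis v_sub : forall x, (nrm (x - x0)%R < l)%N -> 0 < v x ->
  x \in S /\ outflow v x <= lam * wsum x.

(* Subtracting psi plays the role of a cutoff: since v <= 1, the positive part of
   g is supported in the box of radius l, and psi is l^-1-Lipschitz. *)
Let psi x : R := (nrm (x - x0))%:R / l%:R.
Let g x : R := v x - psi x.
Let A (k : R) : {fset V} := [fset x in S | k < g x]%fset.
Let q (k : R) x : R := Num.max 0 (g x - k).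

Let l0 : 0 < l%:R :> R. Proof. by rewrite ltr0n. Qed.

Let g_pos k x : 0 <= k -> k < g x ->
  [/\ (nrm (x - x0)%R < l)%N, 0 < v x & x \in A k].
Proof.
move=> k0 kg; have /andP[v0 v1] := v_bnd x.
have psi0 : 0 <= psi x by rewrite divr_ge0.
have gx : 0 < v x - psi x by exact: le_lt_trans kg.
have vx : 0 < v x by rewrite (le_lt_trans psi0) // -subr_gt0.
have nl : (nrm (x - x0)%R < l)%N.
  rewrite -(ltr_nat R) -(@ltr_pM2r _ (l%:R^-1)) ?invr_gt0 // mulfV ?lt0r_neq0 //.
  by rewrite (lt_le_trans _ v1) // -subr_gt0.
by split => //; rewrite !inE /= kg (v_sub nl vx).1.
Qed.

Let q_out k x : 0 <= k -> x \notin A k -> q k x = 0.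
Proof.
move=> k0 xA; apply/max_idPl; rewrite subr_le0 leNgt; apply: contra xA.
by move=> /(g_pos k0)[].
Qed.

Let psi_lip x i : `|psi x - psi (x + unitv i)| <= l%:R^-1.
Proof.
rewrite /psi -mulrBl normrM (@gtr0_norm _ l%:R^-1) ?invr_gt0 //.
rewrite ler_piMl ?invr_ge0 ?(ltW l0) // ler_norml.
have [h1 h2] := nrm_step x x0 i.
rewrite lerBlDr lerBrDr -2!(ler_nat R) -!natr1 in h1 h2 *; lra.
Qed.

(** A Caccioppoli inequality, obtained by testing [outflow v] with [q k], whose values lie in
    [0, 1]. From above the pairing is bounded through [lam]; from below it dominates half of the
    energy, weighted by [kappa], minus the cost of the cutoff. *)
Let energy_trunc k : 0 <= k ->
  energy (q k) <= 4 * d%:R * kappa^-2 * (lam + l%:R^-2) * #|` A k|%:R.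
Proof.
move=> k0; pose ind x : R := (x \in A k)%:R.
have find : fsupp ind by apply: (@fsupp_fset _ _ (A k)) => x /negbTE; rewrite /ind => ->.
have fq : fsupp (q k) by apply: (@fsupp_fset _ _ (A k)) => x; exact: q_out.
have k1 : 0 < kappa^-1 by rewrite invr_gt0.
have q01 x : 0 <= q k x <= 1.
  rewrite /q le_max lexx /= ge_max ler01 /=.
  have /andP[_ v1] := v_bnd x.
  have : 0 <= psi x by rewrite divr_ge0.
  by rewrite /g => ?; lra.
have fZ c h : fsupp h -> fsupp (fun x : V => (c : R) * h x).
  by move=> fh; apply: (fsupp_sub fh) => x ->; rewrite mulr0.
have H1 : zsum (fun x => outflow v x * q k x) <=
    zsum (fun x => lam * (d%:R * (2 * kappa^-1)) * ind x).
  apply: le_zsum; [by apply: (fsupp_sub fq) => x ->; rewrite mulr0|exact: fZ|].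
  move=> x; have [xA|xA] := boolP (x \in A k); last first.
    by rewrite q_out // mulr0 /ind (negbTE xA) mulr0.
  have [_ kg] : x \in S /\ k < g x by move: xA; rewrite !inE /= => /andP[].
  have [nl vx _] := g_pos k0 kg; have [_ H] := v_sub nl vx.
  have /andP[w0 w1] := wsum_bnd x; have /andP[q0 q1] := q01 x.
  rewrite /ind xA mulr1; apply: (@le_trans _ _ (lam * wsum x * q k x)).
    exact: ler_wpM2r.
  apply: (@le_trans _ _ (lam * wsum x)); last exact: ler_wpM2l.
  by rewrite ler_piMr // mulr_ge0.
rewrite zsumZ zsum_indic summation_by_parts // in H1.
have H2 : \sum_(i < d) (kappa / 2 * zsum (fun x => (q k x - q k (x + unitv i)) ^+ 2)
    - kappa^-1 * l%:R^-2 * #|` A k|%:R) <= \sum_(i < d) zsum (fun x =>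
    a x i * ((v x - v (x + unitv i)) * (q k x - q k (x + unitv i)))).
  apply: ler_sum => i _.
  set c := kappa^-1 * l%:R^-2.
  (* The cutoff cost is spread over the edges: an edge receives [c / 2] for each endpoint in [A k],
     so edges that miss [A k] receive nothing, in agreement with [q k] vanishing at both ends. *)
  have -> : c * #|` A k|%:R = zsum (fun x => c / 2 * (ind x + ind (x + unitv i))).
    rewrite zsumZ zsumD //; last exact: fsupp_shift.
    by rewrite zsum_shift zsum_indic; field.
  rewrite lerBlDr -zsumZ -zsumD; first last.
  - by apply: fZ; apply: fsuppD => //; exact: fsupp_shift.
  - apply: (fsupp_sub (fsupp_diff (unitv i) fq)) => x /eqP.
    by rewrite sqrf_eq0 => /eqP ->; rewrite !mulr0.
  apply: le_zsum; first by apply: fZ; exact: fsupp_diff.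
    apply: fsuppD; last by apply: fZ; apply: fsuppD => //; exact: fsupp_shift.
    apply: (fsupp_sub (fsupp_diff (unitv i) fq)) => x /eqP.
    by rewrite sqrf_eq0 => /eqP ->; rewrite !mulr0.
  move=> x; set y := x + unitv i.
  have [ka ak] := andP (a_bnd x i).
  have [/norP[xA yA]|xyA] := boolP (~~ ((x \in A k) || (y \in A k))).
    rewrite !q_out // subrr expr0n /= !mulr0 add0r mulr_ge0 //.
      by rewrite /c divr_ge0 // mulr_ge0 // ?invr_ge0 ?exprn_ge0 // ltW.
    by rewrite addr_ge0 /ind.
  have hi : 1 <= ind x + ind y.
    move: xyA; rewrite negbK /ind.
    by case/orP => ->; rewrite ?lerDl ?lerDr.
  pose m : R := l%:R^-1.
  have -> : c / 2 = kappa^-1 * (m ^+ 2 / 2) by rewrite /c /m exprVn mulrA.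
  have m0 : 0 < m by rewrite invr_gt0.
  pose D : R := q k x - q k y; rewrite -/D.
  have hD : D ^+ 2 / 2 - m ^+ 2 / 2 <= (v x - v y) * D.
    have hg : D ^+ 2 <= (g x - g y) * D.
      rewrite /D /q; case: (leP 0 (g x - k)) => h1;
        case: (leP 0 (g y - k)) => h2; nra.
    have hp := psi_lip x i; rewrite -/y -/m in hp.
    have -> : v x - v y = (g x - g y) + (psi x - psi y) by rewrite /g; ring.
    by apply: young_edge.
  have hA : a x i * (D ^+ 2 / 2 - m ^+ 2 / 2) <= a x i * ((v x - v y) * D).
    by apply: ler_wpM2l => //; exact: ltW (lt_le_trans kappa_gt0 ka).
  have h1 : kappa / 2 * D ^+ 2 <= a x i * (D ^+ 2 / 2).
    rewrite -mulrA [2^-1 * _]mulrC; apply: ler_wpM2r => //.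
    by rewrite divr_ge0 ?sqr_ge0.
  have h2 : a x i * (m ^+ 2 / 2) <= kappa^-1 * (m ^+ 2 / 2).
    by apply: ler_wpM2r => //; rewrite divr_ge0 ?sqr_ge0.
  have h3 : kappa^-1 * (m ^+ 2 / 2) <= kappa^-1 * (m ^+ 2 / 2) * (ind x + ind y).
    by rewrite ler_peMr // mulr_ge0 ?divr_ge0 ?sqr_ge0 // ltW.
  rewrite mulrBr in hA; lra.
have := le_trans H2 H1.
rewrite big_split /= -mulr_sumr -/(energy (q k)) sumr_const card_ord -mulr_natl.
set E := energy _; set N : R := #|` A k|%:R; set m : R := l%:R^-2 => H3.
have N0 : 0 <= N by rewrite /N.
have m0 : 0 <= m by rewrite /m invr_ge0 exprn_ge0 // ltW.
have H4 : kappa / 2 * E <= 2 * d%:R * kappa^-1 * (lam + m) * N.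
  have : 0 <= d%:R * kappa^-1 * m * N by rewrite !mulr_ge0 // ltW.
  lra.
have k2 : 0 <= 2 / kappa by rewrite divr_ge0 // ltW.
have := ler_wpM2l k2 H4.
have -> : 2 / kappa * (kappa / 2 * E) = E by field; exact: lt0r_neq0.
by move=> /le_trans; apply; rewrite -exprVn le_eqVlt; apply/orP; left; apply/eqP; ring.
Qed.

(* The j-th superlevel set, at level eps (1 - 2^-j), has at most 2^((J - j) d) / 2
   points, hence none for j = J. *)
Lemma hitting_bound (J : nat) (eps : R) : 0 < eps -> (2 * #|` S| <= 2 ^ (J * d))%N ->
  (0 < d)%N ->
  2 ^+ J ^+ 2 * (32 * d%:R * d.+1%:R ^+ 2 * 2 ^+ d * kappa^-2 *
    (lam + l%:R^-2)) <= eps ^+ 2 ->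
  v x0 <= eps.
Proof.
move=> eps0 SJ d0 HJ.
pose k j := eps * (1 - 2^-1 ^+ j).
have k0 j : 0 <= k j.
  by rewrite mulr_ge0 ?(ltW eps0) // subr_ge0 exprn_ile1 // ?invf_le1 ?invr_ge0 ?ler1n.
have mono j i : k i <= k j -> (#|` A (k j)| <= #|` A (k i)|)%N.
  move=> ij; apply: fsubset_leq_card; apply/fsubsetP => x.
  by rewrite !inE /= => /andP[-> /(le_lt_trans ij)].
have H j : (j <= J)%N -> (2 * #|` A (k j)| <= 2 ^ ((J - j) * d))%N.
  elim: j => [_|j IH jJ].
    rewrite subn0; apply: leq_trans SJ; rewrite leq_mul2l /=.
    by apply: fsubset_leq_card; apply/fsubsetP => x; rewrite !inE /= => /andP[].
  have {}IH := IH (ltnW jJ).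
  set r := (2 ^ (J - j))%N.
  have r0 : (0 < r)%N by rewrite expn_gt0.
  have rd : (2 * #|` A (k j)| <= r ^ d)%N by rewrite -expnM.
  have FK := faber_krahn (fun x => @q_out _ x (k0 j)) rd r0.
  have En := energy_trunc (k0 j).
  set a0 := #|` A (k j)|%:R in En *; set a1 : R := #|` A (k j.+1)|%:R.
  set h := 2^-1 ^+ j.+1 : R.
  have h0 : 0 < h by rewrite exprn_gt0 // invr_gt0.
  (* Chebyshev: on the next superlevel set the truncation at level [k j] exceeds the gap [eps * h]
     between the levels. *)
  have low : (eps * h) ^+ 2 * a1 <= zsum (fun x => q (k j) x ^+ 2).
    rewrite /a1 -zsum_indic -zsumZ; apply: le_zsum.
    - by apply: (@fsupp_fset _ _ (A (k j.+1))) => x /negbTE ->; rewrite mulr0.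
    - apply: (@fsupp_fset _ _ (A (k j))) => x /(q_out (k0 j)) ->.
      by rewrite expr0n.
    move=> x; case: (boolP (x \in A (k j.+1))) => [|_]; last first.
      by rewrite mulr0 sqr_ge0.
    rewrite !inE /= => /andP[_ hx]; rewrite mulr1.
    have eh : 0 <= eps * h by rewrite mulr_ge0 ?(ltW eps0) ?(ltW h0).
    rewrite ler_pXn2r ?nnegrE ?le_max ?lexx //.
    apply/orP; right; apply: le_trans (lerB (ltW hx) (lexx _)).
    rewrite /k /h exprS -mulrBr; apply: ler_wpM2l; first exact: ltW.
    lra.
  have big : (eps * h) ^+ 2 * a1 <= 2 * (d.+1 * r)%:R ^+ 2 *
      (4 * d%:R * kappa^-2 * (lam + l%:R^-2) * a0).
    by apply: (le_trans low); apply: (le_trans FK); apply: ler_wpM2l.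
  (* The radius and the gap are both proportional to 2^-j, so the factors h^2 cancel and one
     smallness condition serves every [j]. The constant 32 is the product of 2 from Faber-Krahn, 4
     from the energy bound and 2^2 from [2 * h]. *)
  have hr : r%:R = 2 ^+ J * (2 * h) :> R.
    have n2 : 2 != 0 :> R by [].
    rewrite /r natrX -{2}(subnK (ltnW jJ)) exprD /h exprS [2 * _]mulrA mulfV //.
    by rewrite mul1r -mulrA -exprMn mulfV // expr1n mulr1.
  have : 2 ^+ d * a1 <= a0.
    rewrite -(@ler_pM2l _ ((eps * h) ^+ 2)); last by rewrite exprn_gt0 ?mulr_gt0.
    rewrite mulrCA; apply: (le_trans (ler_wpM2l _ big)); first by rewrite exprn_ge0.
    rewrite natrM hr exprMn.
    have a00 : 0 <= a0 by rewrite /a0.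
    have := ler_wpM2l (mulr_ge0 (sqr_ge0 h) a00) HJ.
    set T := lam + _; set D := d.+1%:R; set X := 2 ^+ J; set Y := 2 ^+ d.
    move=> hh; rewrite [leLHS](_ : _ = h ^+ 2 * a0 *
      (X ^+ 2 * (32 * d%:R * D ^+ 2 * Y * kappa^-2 * T))); last by ring.
    by rewrite [leRHS](_ : _ = h ^+ 2 * a0 * eps ^+ 2) //; ring.
  rewrite /a0 /a1 -natrX -natrM ler_nat => H2.
  rewrite -(@leq_pmul2l (2 ^ d)) ?expn_gt0 // -expnD -mulSn -subSn // subSS.
  by apply: leq_trans IH; rewrite mulnCA leq_mul2l.
have := H J (leqnn _); rewrite subnn mul0n expn0 => HA.
have AJ : A (k J) = fset0 by apply: cardfs0_eq; lia.
have gk : g x0 <= k J.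
  by rewrite leNgt; apply/negP => /(g_pos (k0 J))[_ _]; rewrite AJ inE.
have -> : v x0 = g x0 by rewrite /g /psi subrr nrm0 mul0r subr0.
apply: (le_trans gk); rewrite /k ler_piMr ?(ltW eps0) // gerBl exprn_ge0 // invr_ge0.
Qed.

End hitting.
(** * The walk in a fixed environment *)

Section walk_kernel.
Variables (R : realType) (d : nat).
Local Notation V := 'rV[int]_d.
Local Notation dir := ('I_d * bool)%type.

Definition step (s : dir) : V := if s.2 then unitv s.1 else - unitv s.1.

Definition weight (w : edge d -> R) (x : V) (s : dir) : R :=
  w (if s.2 then x else x - unitv s.1, s.1).

Definition kern w x s : R := weight w x s / \sum_t weight w x t.

Lemma sum_dir (f : dir -> R) :
  \sum_s f s = \sum_(i < d) (f (i, true) + f (i, false)).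
Proof.
transitivity (\sum_(i < d) \sum_b f (i, b)).
  by rewrite pair_big; apply: eq_bigr => -[].
by apply: eq_bigr => i _; rewrite big_bool.
Qed.

Definition pcons (x : V) (u : nat -> V) (k : nat) : V :=
  if k is k'.+1 then u k' else x.

Definition catp (h : seq V) (u : nat -> V) (k : nat) : V :=
  if (k < size h)%N then nth 0 h k else u (k - size h)%N.

Lemma catp_rcons h z u : catp (rcons h z) u = catp h (pcons z u).
Proof.
apply/funext => k; rewrite /catp size_rcons nth_rcons ltnS.
case: ltngtP => [kh|hk|->]; rewrite ?subnn //.
by rewrite -(subnKC hk) subDnCA // subnn addn0 addSn -addnS addKn.
Qed.

Definition depends (m : nat) (T : Type) (f : (nat -> V) -> T) :=
  forall u u', (forall k, (k <= m)%N -> u k = u' k) -> f u = f u'.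

Lemma depends_pcons m T (f : (nat -> V) -> T) x : depends m.+1 f ->
  depends m (fun u => f (pcons x u)).
Proof. by move=> df u u' uu'; apply: df => -[//|k] /uu'. Qed.

Variable w : edge d -> R.
Implicit Types (f g : (nat -> V) -> R) (x z : V).

(** After [n] steps the path stays at its endpoint for ever. Thus [f] lives on infinite paths, while
    the value is a finite sum and asks for no measurability. *)
Fixpoint pexp (n : nat) x f : R :=
  if n is n'.+1 then
    \sum_s kern w x s * pexp n' (x + step s) (fun u => f (pcons x u))
  else f (fun=> x).

Lemma pexpS n x f : pexp n.+1 x f =
  \sum_s kern w x s * pexp n (x + step s) (fun u => f (pcons x u)).
Proof. by []. Qed.

Lemma pexpD n x f g : pexp n x (fun u => f u + g u) = pexp n x f + pexp n x g.
Proof.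
elim: n x f g => [//|n IH] x f g /=; rewrite -big_split /=.
by apply: eq_bigr => s _; rewrite IH mulrDr.
Qed.

Lemma pexpZ n x c f : pexp n x (fun u => c * f u) = c * pexp n x f.
Proof.
elim: n x f => [//|n IH] x f /=; rewrite mulr_sumr.
by apply: eq_bigr => s _; rewrite IH mulrCA.
Qed.

Hypothesis w_gt0 : forall b, 0 < w b.
Hypothesis d_gt0 : (0 < d)%N.

Lemma weight_gt0 x s : 0 < weight w x s.
Proof. exact: w_gt0. Qed.

Lemma weight_sum_gt0 x : 0 < \sum_t weight w x t.
Proof.
rewrite (bigD1 (Ordinal d_gt0, true)) //=.
apply: ltr_pwDl; first exact: weight_gt0.
by apply: sumr_ge0 => s _; exact/ltW/weight_gt0.
Qed.

Lemma kern_ge0 x s : 0 <= kern w x s.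
Proof. by rewrite divr_ge0 // ltW ?weight_gt0 ?weight_sum_gt0. Qed.

Lemma sum_kern x : \sum_s kern w x s = 1.
Proof. by rewrite -mulr_suml mulfV // lt0r_neq0 // weight_sum_gt0. Qed.

Lemma pexp_cst n x c : pexp n x (fun=> c) = c.
Proof.
elim: n x => [//|n IH] x /=.
by under eq_bigr do rewrite IH; rewrite -mulr_suml sum_kern mul1r.
Qed.

Lemma pexpB n x f g : pexp n x (fun u => f u - g u) = pexp n x f - pexp n x g.
Proof.
under eq_fun do rewrite -(mulN1r (g _)).
by rewrite pexpD pexpZ mulN1r.
Qed.

Lemma le_pexp n x f g : (forall u, u 0%N = x -> f u <= g u) ->
  pexp n x f <= pexp n x g.
Proof.
elim: n x f g => [|n IH] x f g fg /=; first exact: fg.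
apply: ler_sum => s _; apply: ler_wpM2l; first exact: kern_ge0.
by apply: IH => u _; apply: fg.
Qed.

Lemma eq_pexp n x f g : (forall u, u 0%N = x -> f u = g u) ->
  pexp n x f = pexp n x g.
Proof.
by move=> fg; apply/eqP; rewrite eq_le !le_pexp // => u /fg ->.
Qed.

Lemma pexp_dist n x f g h : (forall u, u 0%N = x -> `|f u - g u| <= h u) ->
  `|pexp n x f - pexp n x g| <= pexp n x h.
Proof.
move=> fgh; rewrite ler_norml -pexpB -mulN1r -pexpZ; apply/andP; split.
  by apply: le_pexp => u /fgh; rewrite ler_norml mulN1r => /andP[].
by apply: le_pexp => u /fgh; rewrite ler_norml => /andP[].
Qed.

Lemma pexp_dep n m x f : depends m f -> (m <= n)%N -> pexp n x f = pexp m x f.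
Proof.
move=> df mn; rewrite -(subnKC mn); elim: (n - m)%N => [|k IH].
  by rewrite addn0.
rewrite -IH addnS; have {df}df : depends (m + k) f.
  by move=> u u' uu'; apply: df => j jm; apply: uu'; rewrite (leq_trans jm) ?leq_addr.
move: (m + k)%N df => {IH mn n k}n; elim: n x f => [|n IH] x f df.
  rewrite /= -[RHS]mul1r -(sum_kern x) mulr_suml; apply: eq_bigr => s _.
  by congr (_ * _); apply: df => k; rewrite leqn0 => /eqP ->.
rewrite pexpS [RHS]pexpS.
by apply: eq_bigr => s _; rewrite IH //; exact: depends_pcons.
Qed.

Section miss.
Variables inB bad : pred V.

(* The probability that the walk from z leaves B without having met a good
   site or meets no good site within r steps. *)
Fixpoint miss (r : nat) z : R :=
  if ~~ inB z then 1 else if ~~ bad z then 0 else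
  if r is r'.+1 then \sum_s kern w z s * miss r' (z + step s) else 1.

Lemma miss_bnd r z : 0 <= miss r z <= 1.
Proof.
elim: r z => [|r IH] z /=; case: ifP => _; rewrite ?ler01 ?lexx //;
  case: ifP => _; rewrite ?ler01 ?lexx //.
apply/andP; split.
  by apply: sumr_ge0 => s _; rewrite mulr_ge0 ?kern_ge0; have /andP[] := IH (z + step s).
rewrite -(sum_kern z); apply: ler_sum => s _.
by rewrite ler_piMr ?kern_ge0 //; have /andP[] := IH (z + step s).
Qed.

Lemma miss_anti r z : miss r.+1 z <= miss r z.
Proof.
elim: r z => [|r IH] z.
  have /andP[_] := miss_bnd 1 z; rewrite /=.
  by case: ifP => // _; case: ifP.
have missS k : miss k.+1 z = if ~~ inB z then 1 else if ~~ bad z then 0 else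
  \sum_s kern w z s * miss k (z + step s) by [].
rewrite !missS; case: ifP => // _; case: ifP => // _.
by apply: ler_sum => s _; apply: ler_wpM2l; [exact: kern_ge0|exact: IH].
Qed.

Lemma miss_le r r' z : (r <= r')%N -> miss r' z <= miss r z.
Proof.
move=> rr'; rewrite -(subnKC rr'); elim: (_ - _)%N => [|k IH].
  by rewrite addn0.
by rewrite addnS; exact: le_trans (miss_anti _ _) IH.
Qed.

(* Averaging over the time horizon turns the recursion of [miss] into the
   inequality v <= P v + 1 / r. *)
Definition miss_mean (r : nat) z : R := r%:R^-1 * \sum_(k < r) miss k z.

Variable T : nat.
Hypothesis T_gt0 : (0 < T)%N.

Let T0 : 0 < T%:R :> R. Proof. by rewrite ltr0n. Qed.

Lemma miss_mean_bnd z : 0 <= miss_mean T z <= 1.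
Proof.
apply/andP; split.
  rewrite mulr_ge0 ?invr_ge0 //; apply: sumr_ge0 => k _.
  by have /andP[] := miss_bnd k z.
rewrite /miss_mean mulrC ler_pdivrMr // mul1r.
rewrite -[leRHS]mulr1 mulr_natl -[X in _ *+ X]card_ord -sumr_const.
by apply: ler_sum => k _; have /andP[] := miss_bnd k z.
Qed.

Lemma miss_le_mean z : miss T z <= miss_mean T z.
Proof.
rewrite /miss_mean mulrC ler_pdivlMr // mulr_natr -[X in _ *+ X]card_ord.
by rewrite -sumr_const; apply: ler_sum => k _; apply: miss_le; exact: ltnW.
Qed.

Lemma miss_mean_good z : inB z -> 0 < miss_mean T z -> bad z.
Proof.
move=> Bz; apply: contraTT => gz; rewrite -leNgt /miss_mean big1 ?mulr0 //.
by move=> k _; case: (k : nat) => [|r] /=; rewrite Bz gz.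
Qed.

(** At a bad site of B the term of horizon 0 equals 1, which produces [T%:R^-1]; every later term is
    the one-step mean of its predecessor, and the term that is left over is nonnegative. *)
Lemma miss_mean_sub z : inB z -> bad z ->
  miss_mean T z <= \sum_s kern w z s * miss_mean T (z + step s) + T%:R^-1.
Proof.
move=> Bz badz; rewrite -(ler_pM2l T0) mulrDr mulfV ?lt0r_neq0 //.
rewrite /miss_mean mulrA mulfV ?lt0r_neq0 // mul1r addrC.
case: T T_gt0 T0 => // n _ n0; rewrite big_ord_recl /= Bz badz /= lerD2l.
rewrite exchange_big /= mulr_sumr; apply: ler_sum => s _.
rewrite -mulr_sumr [leRHS]mulrCA mulVKf ?lt0r_neq0 //.
apply: ler_wpM2l; first exact: kern_ge0.
rewrite big_ord_recr /= lerDl; by have /andP[] := miss_bnd n (z + step s).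
Qed.

(* By induction on the remaining time r, for the continuation of the walk after
   the path h that has not met a good site. *)
Lemma strong_markov (N : nat) f (M mu e : R) :
  (T <= N)%N -> 0 <= e -> (forall u, `|f u| <= M) -> `|mu| <= M ->
  (forall h z, all inB h -> (size h <= T)%N -> inB z -> ~~ bad z ->
    `|pexp (N - size h) z (fun u => f (catp h u)) - mu| <= e) ->
  forall r h z, all inB h -> (size h + r <= T)%N ->
    `|pexp (N - size h) z (fun u => f (catp h u)) - mu| <=
      e + 2 * M * miss r z.
Proof.
move=> TN e0 fM muM Hgood.
have M0 : 0 <= M by exact: le_trans muM.
(* The trivial bound, for a walk that has left B or run out of time: there [miss] equals 1. *)
have Hall n z g : (forall u, `|g u| <= M) -> `|pexp n z g - mu| <= e + 2 * M.
  move=> gM; have : `|pexp n z g| <= M.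
    rewrite ler_norml; apply/andP; split.
      rewrite -(pexp_cst n z (- M)); apply: le_pexp => u _.
      by have := gM u; rewrite ler_norml => /andP[].
    rewrite -[leRHS](pexp_cst n z M); apply: le_pexp => u _.
    by have := gM u; rewrite ler_norml => /andP[].
  by have := ler_normB (pexp n z g) mu; lra.
elim=> [|r IH] h z hB hr.
  rewrite /=; case: ifP => [_|/negbFE Bz]; first by rewrite mulr1; exact: Hall.
  case: ifP => [gz|_]; last by rewrite mulr1; exact: Hall.
  by rewrite mulr0 addr0; apply: Hgood => //; rewrite -(addn0 (size h)).
rewrite [X in _ <= X]/=; case: ifP => [_|/negbFE Bz]; first by rewrite mulr1; exact: Hall.
case: ifP => [gz|_].
  by rewrite mulr0 addr0; apply: Hgood => //; apply: leq_trans hr; rewrite leq_addr.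
have -> : (N - size h = (N - (size h).+1).+1)%N.
  by rewrite -subSn ?subSS //; apply: leq_trans TN; apply: leq_trans hr; rewrite addnS ltnS leq_addr.
have He c : c = \sum_s kern w z s * c by rewrite -mulr_suml sum_kern mul1r.
rewrite pexpS {1}(He mu) -sumrB.
apply: (le_trans (ler_norm_sum _ _ _)).
rewrite {1}(He e) mulr_sumr -big_split /=.
apply: ler_sum => s _; rewrite -mulrBr normrM ger0_norm ?kern_ge0 //.
rewrite [2 * M * _]mulrCA -mulrDr; apply: ler_wpM2l; first exact: kern_ge0.
have := IH (rcons h z) (z + step s).
rewrite size_rcons all_rcons hB Bz addSnnS => /(_ isT hr).
by under eq_fun do rewrite catp_rcons.
Qed.

End miss.
End walk_kernel.

(** * The step kernel of an environment of conductances *)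

Section kernel_of_conductances.
Variables (R : realType) (d : nat).
Local Notation V := 'rV[int]_d.
Local Notation dir := ('I_d * bool)%type.
Implicit Types (w : edge d -> R) (x y z : V).

Lemma stepE (s : dir) i :
  (step s 0 i : int) = if i == s.1 then (-1) ^+ (~~ s.2) else 0.
Proof.
case: s => j [] /=; rewrite /step /unitv !mxE eqxx /= eq_sym; by case: eqP.
Qed.

Lemma step_inj : injective (@step d).
Proof.
move=> [i b] [j c] /rowP H; have := H i; have := H j; rewrite !stepE /= !eqxx.
by case: (eqVneq i j) => [->|_]; case: b {H}; case: c.
Qed.

(** Absolute values of integers that sum to 1 consist of a single 1 and zeros; the order of the two
    coordinates at that place decides between a forward and a backward step. *)
Lemma nbrP x y : reflect (exists s : dir, y = x + step s) (nbr x y).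
Proof.
apply: (iffP idP) => [/eqP H|[s ->]]; last first.
  rewrite /nbr (bigD1 s.1) //= big1 => [|i /negbTE is1]; rewrite rvD stepE.
    by rewrite eqxx opprD addNKr normrN normrX normrN1 expr1n addr0.
  by rewrite is1 addr0 subrr normr0.
have /existsP[i Hi] : [exists i, x 0 i != y 0 i].
  apply: contra_eqT H => /existsPn H; rewrite big1 // => i _.
  by have := H i; rewrite negbK => /eqP ->; rewrite subrr normr0.
move: H; rewrite (bigD1 i) //= => H.
have hi : 1 <= `|x 0 i - y 0 i|.
  by rewrite -gtz0_ge1 normr_gt0 subr_eq0.
have hr : 0 <= \sum_(j < d | j != i) `|x 0 j - y 0 j| by apply: sumr_ge0.
have hr0 : \sum_(j < d | j != i) `|x 0 j - y 0 j| = 0.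
  by apply/eqP; rewrite eq_le hr andbT -(lerD2l `|x 0 i - y 0 i|) addr0 H.
have hj j : j != i -> x 0 j = y 0 j.
  move=> ji; have /eqP := @psumr_eq0P _ _ _ _ (fun j _ => normr_ge0 _) hr0 j ji.
  by rewrite normr_eq0 subr_eq0 => /eqP.
exists (i, x 0 i < y 0 i); apply/rowP => j; rewrite rvD stepE /=.
case: eqP => [->|/eqP /hj ->]; last by rewrite addr0.
rewrite hr0 addr0 in H; move: H hi; case: ltP => /= h.
  by rewrite ltr0_norm ?subr_lt0 // opprB expr0 => <- _; rewrite addrC subrK.
by rewrite ger0_norm ?subr_ge0 // expr1 => <- _; rewrite opprB addrC subrK.
Qed.

Lemma cond_step w x (s : dir) : cond w x (x + step s) = weight w x s.
Proof.
have E (b c : bool) (i j : 'I_d) : step (i, b) == step (j, c) = (i == j) && (b == c).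
  by apply/eqP/andP => [/step_inj[-> ->]|[/eqP -> /eqP ->]].
have P (i : 'I_d) : [pick j | i == j] = Some i.
  by case: pickP => [j /eqP ->//|/(_ i)]; rewrite eqxx.
rewrite /cond; case: s => i [].
  rewrite (_ : [pick j | _] = Some i) // -[RHS]P; apply: eq_pick => j.
  by rewrite (inj_eq (addrI x)) (E true true) andbT.
rewrite (_ : [pick j | x + step (i, false) == x + unitv j] = None); last first.
  case: pickP => // j; rewrite (inj_eq (addrI x)) (E false true) andbF //.
rewrite (_ : [pick j | _] = Some i) // -[RHS]P; apply: eq_pick => j.
rewrite -[RHS]andbT /= -addrA -subr_eq0 opprD addrA subrr sub0r oppr_eq0 addrC subr_eq0 eq_sym.
exact: (E true true).
Qed.

Lemma set_nbr x : [set y | nbr x y] = [set x + step s | s in [set: dir]].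
Proof.
apply/seteqP; split => [y /nbrP[s ->]|y [s _ <-]]; first by exists s.
by apply/nbrP; exists s.
Qed.

Lemma total_cond_sum w x : total_cond w x = \sum_s weight w x s.
Proof.
rewrite /total_cond set_nbr fsbig_image; last first.
  by move=> s t _ _ /addrI /step_inj.
rewrite (fsbig_fwiden (index_enum dir)) ?index_enum_uniq //; last first.
- by move=> s [_ []].
- by move=> s _ /=; rewrite mem_index_enum.
by apply: eq_bigr => s _; exact: cond_step.
Qed.

Lemma transition_step w x (s : dir) : transition w x (x + step s) = kern w x s.
Proof.
rewrite /transition ifT ?cond_step ?total_cond_sum //.
by apply/nbrP; exists s.
Qed.

Lemma outflow_kern w (v : V -> R) x : 0 < \sum_s weight w x s ->
  outflow (fun y i => w (y, i)) v x = wsum (fun y i => w (y, i)) x *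
    (v x - \sum_s kern w x s * v (x + step s)).
Proof.
have -> : wsum (fun y i => w (y, i)) x = \sum_s weight w x s.
  by rewrite sum_dir.
move=> W0; rewrite mulrBr mulr_sumr.
under [X in _ - X]eq_bigr do rewrite mulrA mulrCA mulfV ?lt0r_neq0 // mulr1.
rewrite mulr_suml -sumrB sum_dir; apply: eq_bigr => i _.
by rewrite /step /weight /= -!mulrBr.
Qed.

(** This is [hitting_bound] for [miss_mean], with [lam] the inverse of [T]: inside the ball a site
    of positive mean is bad, hence in [S], and there [miss_mean_sub] is the required inequality. *)
Lemma miss_small w (kappa : R) (x0 : V) (l T J : nat) (bad : pred V)
    (S : {fset V}) (eps : R) :
  0 < kappa -> (forall b, kappa <= w b <= kappa^-1) -> (0 < d)%N ->
  (0 < l)%N -> (0 < T)%N -> 0 < eps ->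
  (forall z, (nrm (z - x0)%R < l)%N -> bad z -> z \in S) ->
  (2 * #|` S| <= 2 ^ (J * d))%N ->
  2 ^+ J ^+ 2 * (32 * d%:R * d.+1%:R ^+ 2 * 2 ^+ d * kappa^-2 *
    (T%:R^-1 + l%:R^-2)) <= eps ^+ 2 ->
  miss w (fun z => (nrm (z - x0)%R < l)%N) bad T x0 <= eps.
Proof.
move=> k0 wb d0 l0 T0 e0 HS SJ HJ.
have w0 b : 0 < w b by have /andP[/(lt_le_trans k0)] := wb b.
set inB := fun z => _.
have W x := weight_sum_gt0 w0 d0 x.
apply: (le_trans (miss_le_mean w0 d0 inB bad T0 x0)).
have ti : 0 <= T%:R^-1 :> R by rewrite invr_ge0.
apply: (hitting_bound k0 (a := fun y i => w (y, i)) _ l0 ti _ _ e0 SJ d0 HJ).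
- by move=> x i; exact: wb.
- by move=> x; exact: miss_mean_bnd.
move=> x Bx vx; have badx := miss_mean_good Bx vx.
split; first exact: HS.
rewrite outflow_kern // mulrC; apply: ler_wpM2r.
  by have /andP[] := wsum_bnd k0 (fun y i => wb (y, i)) x.
by rewrite lerBlDl; exact: miss_mean_sub.
Qed.

End kernel_of_conductances.

(** * Real-valued expectations of bounded functions *)

Section bounded_expectation.
Context d (T : measurableType d) (R : realType) (P : probability T R).
Implicit Types f g : T -> R.

Definition bmeas f := measurable_fun setT f /\ exists M, forall t, `|f t| <= M.

Definition Er f : R := fine ('E_P[f])%E.

Lemma bmeas_integrable f : bmeas f -> P.-integrable setT (EFin \o f).
Proof.
move=> [mf [M fM]]; apply: measurable_bounded_integrable => //.
  by rewrite (le_lt_trans (probability_le1 P measurableT)) // ltry.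
exists M; split; first by rewrite num_real.
by move=> M' MM' t _; exact: le_trans (fM t) (ltW MM').
Qed.

Lemma bmeas_Lfun f : bmeas f -> f \in Lfun P 1.
Proof. by move=> bf; apply/Lfun1_integrable; exact: bmeas_integrable. Qed.

Lemma ErE f : bmeas f -> ('E_P[f] = (Er f)%:E)%E.
Proof. by move=> bf; rewrite /Er fineK // expectation_fin_num // bmeas_Lfun. Qed.

Lemma bmeas_cst c : bmeas (fun=> c).
Proof. by split; [exact: measurable_cst|exists `|c|]. Qed.

Lemma bmeas_indic (A : set T) : measurable A -> bmeas (\1_A).
Proof.
move=> mA; split; first exact: measurable_indic.
exists 1 => t; rewrite indicE; case: (_ \in _) => /=; rewrite ?normr1 ?normr0 //.
Qed.

Lemma bmeasD f g : bmeas f -> bmeas g -> bmeas (fun t => f t + g t).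
Proof.
move=> [mf [M fM]] [mg [M' gM]]; split; first exact: measurable_funD.
by exists (M + M') => t; rewrite (le_trans (ler_normD _ _)) // lerD.
Qed.

Lemma bmeasM f g : bmeas f -> bmeas g -> bmeas (fun t => f t * g t).
Proof.
move=> [mf [M fM]] [mg [M' gM]]; split; first exact: measurable_funM.
by exists (M * M') => t; rewrite normrM ler_pM.
Qed.

Lemma bmeasZ c f : bmeas f -> bmeas (fun t => c * f t).
Proof. by apply: bmeasM; exact: bmeas_cst. Qed.

Lemma bmeasB f g : bmeas f -> bmeas g -> bmeas (fun t => f t - g t).
Proof.
move=> bf bg; under eq_fun do rewrite -mulN1r.
by apply: bmeasD => //; exact: bmeasZ.
Qed.

Lemma bmeas_sum (I : Type) (s : seq I) (F : I -> T -> R) :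
  (forall i, bmeas (F i)) -> bmeas (fun t => \sum_(i <- s) F i t).
Proof.
move=> bF; elim: s => [|i s IH].
  by under eq_fun do rewrite big_nil; exact: bmeas_cst.
by under eq_fun do rewrite big_cons; exact: bmeasD.
Qed.

Lemma ErD f g : bmeas f -> bmeas g -> Er (fun t => f t + g t) = Er f + Er g.
Proof.
move=> bf bg; rewrite /Er expectationD ?bmeas_Lfun //.
by rewrite fineD // expectation_fin_num // bmeas_Lfun.
Qed.

Lemma ErZ c f : bmeas f -> Er (fun t => c * f t) = c * Er f.
Proof.
move=> bf; have -> : (fun t => c * f t) = (c \o* f).
  by apply/funext => t /=; rewrite mulrC.
by rewrite /Er expectationZl ?bmeas_Lfun // fineM // expectation_fin_num // bmeas_Lfun.
Qed.

Lemma ErB f g : bmeas f -> bmeas g -> Er (fun t => f t - g t) = Er f - Er g.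
Proof.
move=> bf bg; under eq_fun do rewrite -mulN1r.
by rewrite ErD ?ErZ ?mulN1r //; exact: bmeasZ.
Qed.

Lemma Er_cst c : Er (fun=> c) = c.
Proof. by rewrite /Er expectation_cst. Qed.

Lemma Er_sum (I : Type) (s : seq I) (F : I -> T -> R) :
  (forall i, bmeas (F i)) ->
  Er (fun t => \sum_(i <- s) F i t) = \sum_(i <- s) Er (F i).
Proof.
move=> bF; elim: s => [|i s IH].
  by under eq_fun do rewrite big_nil; rewrite Er_cst big_nil.
under eq_fun do rewrite big_cons.
by rewrite ErD ?IH ?big_cons //; exact: bmeas_sum.
Qed.

Lemma Er_indic (A : set T) : measurable A -> Er (\1_A) = fine (P A).
Proof. by move=> mA; rewrite /Er expectation_indic. Qed.

Lemma le_Er f g : bmeas f -> bmeas g -> (forall t, f t <= g t) -> Er f <= Er g.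
Proof.
move=> bf bg fg; rewrite -lee_fin -!ErE // unlock.
by apply: le_integral; [by []|exact: (bmeas_integrable bf)|exact: (bmeas_integrable bg)|
  move=> t _; rewrite lee_fin].
Qed.

(** In the applications [g] is the indicator of a null event, on which the bounded [f] may then be
    ignored. *)
Lemma Er_mul0 g f : bmeas g -> bmeas f -> (forall t, 0 <= g t) -> Er g = 0 ->
  Er (fun t => g t * f t) = 0.
Proof.
move=> bg bf g0 Eg; have [_ [M fM]] := bf.
have h t : `|g t * f t| <= M * g t by rewrite normrM ger0_norm // mulrC ler_wpM2r.
apply/eqP; rewrite eq_le; apply/andP; split.
  rewrite -[leRHS](mulr0 M) -Eg -ErZ //; apply: le_Er; [exact: bmeasM|exact: bmeasZ|].
  by move=> t; exact: le_trans (ler_norm _) (h t).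
rewrite -[leLHS](mulr0 (- M)) -{1}Eg -ErZ //.
apply: le_Er; [exact: bmeasZ|exact: bmeasM|].
by move=> t; have := h t; rewrite ler_norml mulNr => /andP[].
Qed.

Lemma cvg_Er (f_ : nat -> T -> R) f (M : R) :
  (forall n, measurable_fun setT (f_ n)) -> (forall n t, `|f_ n t| <= M) ->
  (forall t, f_ n t @[n --> \oo] --> f t) ->
  Er (f_ n) @[n --> \oo] --> Er f.
Proof.
move=> mf fM cf.
have mlim : measurable_fun setT f.
  by apply: (measurable_fun_cvg mf) => t _; exact: cf.
have limM t : `|f t| <= M.
  by apply: (cvgr_to_le (cvg_norm (cf t))); exact: nearW.
have bf n : bmeas (f_ n) by split => //; exists M.
have bl : bmeas f by split => //; exists M.
have cE t : (EFin \o f_ ^~ t) n @[n --> \oo] --> (f t)%:E.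
  by apply: cvg_EFin; [exact: nearW|exact: cf].
have [|||||_ _ dc] := @dominated_convergence _ _ _ P setT measurableT
  (fun n => EFin \o f_ n) (EFin \o f) (cst M%:E).
- by move=> n; exact/measurable_EFinP.
- exact/measurable_EFinP.
- by apply: aeW => t _; exact: cE.
- exact: (bmeas_integrable (bmeas_cst M)).
- by apply: aeW => t n _; rewrite lee_fin.
have -> : (fun n => Er (f_ n)) = fine \o (fun n => \int[P]_x (f_ n x)%:E)%E.
  by apply/funext => n; rewrite /Er unlock.
apply: fine_cvg; rewrite -ErE // unlock; exact: dc.
Qed.

End bounded_expectation.

(** * Agreement of the abstract walk with the path recursion *)

Section walk_law.
Variables (R : realType) (d : nat).
Local Notation V := 'rV[int]_d.
Context dX (T : measurableType dX) (Q : probability T R).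
Variables (X : nat -> T -> V).
Hypothesis mX : forall k x, measurable [set t | X k t = x].

Definition cylinder (k : nat) (x : nat -> V) : set T :=
  [set t | forall j, (j <= k)%N -> X j t = x j].

Lemma measurable_cylinder k x : measurable (cylinder k x).
Proof.
have -> : cylinder k x = \bigcap_(j in `I_k.+1) [set t | X j t = x j].
  by apply/seteqP; split => t H j /H.
by apply: fin_bigcap_measurable => // j _; exact: mX.
Qed.

(** The lattice is countable, so an event determined by finitely many positions is a countable union
    of cylinders, whatever the set [D]. *)
Lemma measurable_path_event k (D : set (nat -> V)) : depends k D ->
  measurable [set t | D (X ^~ t)].
Proof.
move=> dD; pose F (l : k.+1.-tuple V) : set T :=
  if `[< D (nth 0 l) >] then cylinder k (nth 0 l) else set0.
have -> : [set t | D (X ^~ t)] = \bigcup_l F l.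
  apply/seteqP; split => [t Dt|t [l _]].
    pose l := [tuple X i t | i < k.+1].
    have E j : (j <= k)%N -> X j t = nth 0 l j.
      rewrite -ltnS => jk; rewrite -[j]/(nat_of_ord (Ordinal jk)) -tnth_nth.
      by rewrite tnth_mktuple.
    exists l => //; rewrite /F asboolT; first by [].
    by rewrite -(dD _ _ E).
  rewrite /F; case: ifPn => [/asboolP Dl H|//] /=.
  by rewrite (dD _ _ H).
apply: countable_bigcupT_measurable => [|l]; first exact: countableP.
by rewrite /F; case: ifP => _ //; exact: measurable_cylinder.
Qed.

Lemma bmeas_path k (f : (nat -> V) -> R) (M : R) : depends k f ->
  (forall u, `|f u| <= M) -> bmeas (fun t => f (X ^~ t)).
Proof.
move=> df fM; split; last by exists M.
move=> _ Y mY; rewrite setTI; apply: (@measurable_path_event k (fun u => Y (f u))).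
by move=> u u' /df ->.
Qed.

Variable w : edge d -> R.
Hypothesis w_gt0 : forall b, 0 < w b.
Hypothesis d_gt0 : (0 < d)%N.
Hypothesis walk : is_walk w Q X.

Let Qr A : R := fine (Q A).

Definition upd (k : nat) (x : nat -> V) (y : V) (j : nat) : V :=
  if j == k then y else x j.

Let Qr_step k x s :
  Qr (cylinder k.+1 (upd k.+1 x (x k + step s))) =
  Qr (cylinder k x) * kern w (x k) s.
Proof.
have [_ _ H] := walk; rewrite /Qr /cylinder H.
have -> : [set t | forall j, (j <= k)%N -> X j t = upd k.+1 x (x k + step s) j] =
    cylinder k x.
  apply/seteqP; split => t Ht j jk; have := Ht j jk;
    by rewrite /upd; case: eqP => // jk1; rewrite jk1 ltnn in jk.
rewrite fineM ?fin_num_measure //; last exact: measurable_cylinder.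
by rewrite /= /upd eqxx eqn_leq ltnn andbF transition_step.
Qed.

(** Induction on the remaining time [m], for all cylinders at once: up to a null event a cylinder is
    the disjoint union of its extensions by one step, since the step weights sum to 1. The list
    [mkseq x k] stops before [x k] because the continuation starts there. *)
Lemma Er_cylinder m k x f (M : R) : depends (k + m) f -> (forall u, `|f u| <= M) ->
  Er Q (fun t => \1_(cylinder k x) t * f (X ^~ t)) =
  Qr (cylinder k x) * pexp w m (x k) (fun u => f (catp (mkseq x k) u)).
Proof.
move=> df fM; elim: m k x df => [|m IH] k x df.
  have -> : (fun t => \1_(cylinder k x) t * f (X ^~ t)) =
      (fun t => f (catp (mkseq x k) (fun=> x k)) * \1_(cylinder k x) t).
    apply/funext => t; rewrite indicE; case: (boolP (t \in cylinder k x)) => [/set_mem Ht|_];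
      last by rewrite !(mul0r, mulr0).
    rewrite mulr1 mul1r; apply: df => j; rewrite addn0 /catp size_mkseq => jk.
    rewrite Ht //; case: ltnP => [jk1|kj]; first by rewrite nth_mkseq.
    by congr x; apply/eqP; rewrite eqn_leq jk kj.
  have mc : measurable (cylinder k x) by exact: measurable_cylinder.
  by rewrite ErZ ?Er_indic //; [rewrite mulrC|exact: bmeas_indic].
rewrite addnS in df; pose C s := cylinder k.+1 (upd k.+1 x (x k + step s)).
have mC s : measurable (C s) by exact: measurable_cylinder.
have mc : measurable (cylinder k x) by exact: measurable_cylinder.
pose g t : R := \1_(cylinder k x) t - \sum_s \1_(C s) t.
have bg : bmeas g.
  apply: bmeasB; first exact: bmeas_indic.
  by apply: bmeas_sum => s; exact: bmeas_indic.
have sub s t : C s t -> cylinder k x t.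
  move=> Ct j jk; rewrite Ct ?(leqW jk) // /upd; case: eqP => // jk1.
  by rewrite jk1 ltnn in jk.
have g0 t : 0 <= g t.
  rewrite /g subr_ge0; have [[s Cs]|nC] := pselect (exists s, C s t).
    rewrite (bigD1 s) //= big1 ?addr0 => [|s' s's].
      by rewrite !indicE !mem_set //; exact: sub Cs.
    rewrite indicE memNset // => Cs'; move/eqP: s's; apply; apply: step_inj.
    have := Cs k.+1 (leqnn _); rewrite (Cs' k.+1 (leqnn _)) /upd eqxx.
    by move/addrI.
  rewrite big1 => [|s _]; last by rewrite indicE memNset // => Cs; apply: nC; exists s.
  by rewrite indicE.
have Eg : Er Q g = 0.
  rewrite ErB ?Er_sum; [|by move=> s; exact: bmeas_indic|exact: bmeas_indic|
    by apply: bmeas_sum => s; exact: bmeas_indic].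
  rewrite Er_indic //; under eq_bigr do rewrite Er_indic // -/(Qr _) Qr_step.
  by rewrite -mulr_sumr sum_kern // mulr1 subrr.
have bf : bmeas (fun t => f (X ^~ t)) by exact: bmeas_path df fM.
have -> : (fun t => \1_(cylinder k x) t * f (X ^~ t)) =
    (fun t => g t * f (X ^~ t) + \sum_s (\1_(C s) t * f (X ^~ t))).
  by apply/funext => t; rewrite -mulr_suml -mulrDl subrK.
have bCf s : bmeas (fun t => \1_(C s) t * f (X ^~ t)).
  by apply: bmeasM => //; exact: bmeas_indic.
rewrite ErD ?Er_sum //; [|exact: bmeasM|exact: bmeas_sum].
rewrite (Er_mul0 bg bf g0 Eg).
rewrite add0r pexpS mulr_sumr; apply: eq_bigr => s _.
rewrite IH ?addSn // -/(C s) /C Qr_step -mulrA; congr (_ * (_ * _)).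
rewrite {1}/upd eqxx; congr pexp; apply/funext => u; congr f.
rewrite -catp_rcons; congr catp; rewrite -mkseqS; apply/eq_in_map => j.
rewrite mem_iota add0n => /andP[_ jk]; rewrite /upd; case: eqP => // jk1.
by rewrite jk1 ltnn in jk.
Qed.

Lemma expectation_walk n f (M : R) : depends n f -> (forall u, `|f u| <= M) ->
  ('E_Q[fun t => f (X ^~ t)] = (pexp w n 0%R f)%:E)%E.
Proof.
move=> df fM; rewrite ErE; last exact: bmeas_path df fM.
have [_ H0 _] := walk.
have m0 : measurable (cylinder 0 (fun=> 0)) by exact: measurable_cylinder.
have E0 : Q (cylinder 0 (fun=> 0)) = 1%E.
  rewrite -H0; congr (Q _); apply/seteqP; split => t /= H; first exact: H.
  by move=> j; rewrite leqn0 => /eqP ->.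
have bf : bmeas (fun t => f (X ^~ t)) by exact: bmeas_path df fM.
pose g t : R := 1 - \1_(cylinder 0 (fun=> 0)) t.
have bi := @bmeas_indic _ T R _ m0; have b1 := @bmeas_cst _ T R 1.
have bg : bmeas g by exact: bmeasB.
have g0 t : 0 <= g t by rewrite /g indicE subr_ge0; case: (_ \in _).
have Eg : Er Q g = 0 by rewrite ErB // Er_cst Er_indic // E0 subrr.
have -> : (fun t => f (X ^~ t)) = (fun t => g t * f (X ^~ t) +
    \1_(cylinder 0 (fun=> 0)) t * f (X ^~ t)).
  by apply/funext => t; rewrite -mulrDl subrK mul1r.
rewrite ErD ?(Er_mul0 bg bf g0 Eg) ?add0r; [|exact: bmeasM|exact: bmeasM].
rewrite (@Er_cylinder n 0 (fun=> 0) f M) // /Qr E0 /= mul1r; congr (_%:E).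
by congr pexp; apply/funext => u; congr f; apply/funext => k; rewrite /catp /= subn0.
Qed.

End walk_law.
(** * The path space *)

Section path_space.
Variables (R : realType) (d : nat).
Local Notation C := (C01 R d).
Implicit Types (f g h : C) (s t : I01 R).

Lemma I01_itv t : 0 <= \val t <= 1.
Proof. by have := set_valP t; rewrite /= in_itv. Qed.

Lemma exI01 (u : R) : 0 <= u <= 1 -> exists t : I01 R, \val t = u.
Proof.
move=> u01; have h : u \in `[0%R : R, 1%R]%classic by rewrite inE /= in_itv.
by exists (SigSub h).
Qed.

Let I0 : exists t : I01 R, \val t = 0.
Proof. by apply: exI01; rewrite lexx ler01. Qed.

Let dists f g := [set Num.min 1 `|f t - g t| | t in [set: I01 R]].

(* Truncating at 1 makes the supremum finite without any compactness argument. *)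
Definition cdist f g : R := sup (dists f g).

Let dists_sup f g : has_sup (dists f g).
Proof.
split; first by have [t _] := I0; exists (Num.min 1 `|f t - g t|); exists t.
by exists 1 => _ [t _ <-]; rewrite ge_min lexx.
Qed.

Lemma cdist_ge f g t : Num.min 1 `|f t - g t| <= cdist f g.
Proof. by apply: ub_le_sup; [have [] := dists_sup f g|exists t]. Qed.

Lemma cdist_le f g c : (forall t, Num.min 1 `|f t - g t| <= c) -> cdist f g <= c.
Proof. by move=> H; apply: ge_sup => [|_ [t _ <-]]; [have [] := dists_sup f g|]. Qed.

Lemma cdist_bnd f g : 0 <= cdist f g <= 1.
Proof.
apply/andP; split; last by apply: cdist_le => t; rewrite ge_min lexx.
by have [t _] := I0; apply: le_trans (cdist_ge f g t); rewrite le_min ler01 normr_ge0.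
Qed.

Lemma cdistxx f : cdist f f = 0.
Proof.
apply/eqP; rewrite eq_le; have /andP[-> _] := cdist_bnd f f; rewrite andbT.
by apply: cdist_le => t; rewrite subrr normr0 ge_min lexx orbT.
Qed.

Lemma cdistC f g : cdist f g = cdist g f.
Proof.
by rewrite /cdist; congr sup; apply/seteqP; split => _ [t _ <-]; exists t => //;
  rewrite distrC.
Qed.

Lemma min1D (a b : R) : 0 <= a -> 0 <= b ->
  Num.min 1 (a + b) <= Num.min 1 a + Num.min 1 b.
Proof.
by move=> a0 b0; case: (leP 1 a) => ?; case: (leP 1 b) => ?;
  case: (leP 1 (a + b)) => ?; lra.
Qed.

Lemma cdist_triangle g f h : cdist f h <= cdist f g + cdist g h.
Proof.
apply: cdist_le => t; apply: le_trans (lerD (cdist_ge f g t) (cdist_ge g h t)).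
apply: le_trans (min1D (normr_ge0 _) (normr_ge0 _)).
by rewrite le_min ge_min lexx /= ge_min ler_distD orbT.
Qed.

Lemma ballC01P f g (e : R) : ball f e g <-> forall t, `|f t - g t| < e.
Proof.
have -> : ball f e g = (forall t, ball (f t : 'rV[R]_d) e (g t)) by [].
by split=> H t; have := H t; rewrite -ball_normE.
Qed.

Lemma ball_cdist f g (e : R) : ball f e g -> cdist f g <= e.
Proof.
by move=> /ballC01P H; apply: cdist_le => t; rewrite ge_min (ltW (H t)) orbT.
Qed.

Lemma cdist_ball f g (e : R) : e <= 1 -> cdist f g < e -> ball f e g.
Proof.
move=> e1 H; apply/ballC01P => t; have := le_lt_trans (cdist_ge f g t) H.
by rewrite gt_min => /orP[h|//]; lra.
Qed.

Definition lipschitzC (k : R) (F : C -> R) :=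
  forall f g, `|F f - F g| <= k * cdist f g.

Lemma lipschitz_unif k F : 0 <= k -> lipschitzC k F -> unif_continuous F.
Proof.
move=> k0 lF; apply/unif_continuousP => e e0.
have ke : 0 < e / (k + 1) by rewrite divr_gt0 // ltr_wpDl.
exists (e / (k + 1)) => // -[f g] /= /ball_cdist fg.
rewrite -ball_normE /=; apply: (le_lt_trans (lF f g)).
apply: (@le_lt_trans _ _ (k * (e / (k + 1)))); first exact: ler_wpM2l.
by rewrite mulrA ltr_pdivrMr ?ltr_wpDl // mulrDr mulr1 mulrC ltrDl.
Qed.

Lemma unif_continuous_continuous (F : C -> R) : unif_continuous F -> continuous F.
Proof.
move=> /unif_continuousP uF f A /nbhs_ballP[e /= e0 HA].
have [e' e'0 H] := uF e e0; apply/nbhs_ballP; exists e' => // g fg.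
by apply: HA; exact: (H (f, g)).
Qed.

Lemma measurable_continuous (F : C -> R) : continuous F -> measurable_fun setT F.
Proof.
move=> /continuousP cF; apply: (measurability _ (RGenOpens.measurableE R)).
move=> _ [_ [a [b ->] <-]]; rewrite setTI; apply: sub_sigma_algebra.
by apply: cF; exact: interval_open.
Qed.

End path_space.

(** * Modulus of continuity and a countable dense family of paths *)

Section path_modulus.
Variables (R : realType) (d : nat).
Local Notation C := (C01 R d).
Implicit Types (f g h : C) (s t : I01 R).

Lemma continuousC f t (e : R) : 0 < e ->
  exists2 r : R, 0 < r & forall s, `|\val s - \val t| < r -> `|f s - f t| < e.
Proof.
move=> e0; have := @cts_fun _ _ f t (ball (f t) e) (nbhsx_ballx _ _ e0).
move=> /nbhs_ballP[r /= r0 H]; exists r => // s st.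
rewrite distrC; have := H s; rewrite /= -ball_normE; apply.
by rewrite distrC in st.
Qed.

Lemma heine f (e : R) : 0 < e -> exists q : nat, forall s t,
  `|\val s - \val t| <= q.+1%:R^-1 -> `|f s - f t| < e.
Proof.
move=> e0; pose Pq (q : nat) (u : R) := forall s t, \val s = u ->
  `|\val s - \val t| <= q.+1%:R^-1 -> `|f s - f t| < e.
have /compact_near_coveringP cov := @segment_compact R 0 1.
have := cov nat \oo Pq _; case.
  move=> x; rewrite /= in_itv /= => /exI01[t0 t0x].
  have e2 : 0 < e / 2 by rewrite divr_gt0.
  have [r r0 Hr] := continuousC f t0 e2.
  have r2 : 0 < r / 2 by rewrite divr_gt0.
  exists (ball x (r / 2), [set q | q.+1%:R^-1 < r / 2]) => /=.
    split; first exact: nbhsx_ballx.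
    exact: (near_infty_natSinv_lt (PosNum r2)).
  move=> [u q] /= [xu qr] s t su st; rewrite -ball_normE /= in xu.
  have h1 : `|f s - f t0| < e / 2.
    by apply: Hr; rewrite su t0x distrC; lra.
  have h2 : `|f t - f t0| < e / 2.
    apply: Hr; apply: (le_lt_trans (ler_distD (\val s) _ _)).
    have h3 : `|\val s - x| < r / 2 by rewrite su distrC.
    rewrite t0x (distrC (\val t)) (splitr r); apply: ltrD h3; exact: le_lt_trans st qr.
  by apply: (le_lt_trans (ler_distD (f t0) _ _)); rewrite (distrC (f t0)); lra.
move=> q _ /(_ q (leqnn _)) H; exists q => s t st.
apply: (H (\val s)) => //=.
by have := I01_itv s; rewrite in_itv.
Qed.

End path_modulus.
Section test_functions.
Variables (R : realType) (d : nat).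
Local Notation C := (C01 R d).
Local Notation V := 'rV[int]_d.
Implicit Types (f g h : C) (s t : I01 R).

Let incr (q : nat) f := [set Num.min 1 `|f st.1 - f st.2| |
  st in [set st : I01 R * I01 R | `|\val st.1 - \val st.2| <= q.+1%:R^-1]].

(** The truncation at 1, as in [cdist], makes this a bounded Lipschitz function of the path, so that
    the quenched CLT applies to it. *)
Definition modulus (q : nat) f : R := sup (incr q f).

Let incr_sup q f : has_sup (incr q f).
Proof.
split; last by exists 1 => _ [st _ <-]; rewrite ge_min lexx.
have [t _] : exists t : I01 R, \val t = 0 by apply: exI01; rewrite lexx ler01.
exists (Num.min 1 `|f t - f t|), (t, t) => //=.
by rewrite subrr normr0 invr_ge0.
Qed.

Lemma modulus_ge q f s t : `|\val s - \val t| <= q.+1%:R^-1 ->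
  Num.min 1 `|f s - f t| <= modulus q f.
Proof. by move=> st; apply: ub_le_sup; [have [] := incr_sup q f|exists (s, t)]. Qed.

Lemma modulus_le q f c : (forall s t, `|\val s - \val t| <= q.+1%:R^-1 ->
  Num.min 1 `|f s - f t| <= c) -> modulus q f <= c.
Proof.
move=> H; apply: ge_sup => [|_ [[s t] st <-]]; [by have [] := incr_sup q f|exact: H].
Qed.

Lemma modulus_bnd q f : 0 <= modulus q f <= 1.
Proof.
apply/andP; split; last by apply: modulus_le => s t _; rewrite ge_min lexx.
have [t _] : exists t : I01 R, \val t = 0 by apply: exI01; rewrite lexx ler01.
apply: le_trans (@modulus_ge q f t t _); first by rewrite le_min ler01 normr_ge0.
by rewrite subrr normr0 invr_ge0.
Qed.

Let modulus_lip1 q f g : modulus q f <= modulus q g + 2 * cdist f g.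
Proof.
apply: modulus_le => s t st.
have h1 := cdist_ge f g s; have h2 := cdist_ge f g t; have h3 := @modulus_ge q g s t st.
apply: (@le_trans _ _ (Num.min 1 (`|g s - g t| + (`|f s - g s| + `|f t - g t|)))).
  rewrite le_min ge_min lexx /= ge_min; apply/orP; right.
  have -> : f s - f t = (g s - g t) + ((f s - g s) - (f t - g t)).
    by apply/rowP => i; rewrite !mxE; ring.
  by apply: (le_trans (ler_normD _ _)); rewrite lerD2l ler_normB.
apply: (le_trans (min1D _ _)); rewrite ?addr_ge0 //.
have := min1D (normr_ge0 (f s - g s)) (normr_ge0 (f t - g t)); lra.
Qed.

Lemma modulus_lip q : lipschitzC 2 (@modulus q).
Proof.
move=> f g; rewrite ler_norml; apply/andP; split.
  by have := modulus_lip1 q g f; rewrite cdistC; lra.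
by have := modulus_lip1 q f g; lra.
Qed.

Lemma modulus_cvg f : modulus q f @[q --> \oo] --> (0 : R).
Proof.
apply/cvgrPdist_le => e e0; have [q Hq] := heine f e0.
exists q => // q' /= qq'; rewrite sub0r normrN ger0_norm; last first.
  by have /andP[] := modulus_bnd q' f.
apply: modulus_le => s t st; rewrite ge_min; apply/orP; right; apply/ltW/Hq.
by apply: (le_trans st); rewrite lef_pV2 ?posrE ?ltr0n // ler_nat ltnS.
Qed.

Lemma polygonal_comb (y : nat -> 'rV[R]_d) (v : 'rV[R]_d) (c r : R) :
  v - c *: polygonal y r = polygonal (fun k => v - c *: y k) r.
Proof.
rewrite /polygonal; set k := Num.truncn r; set l := r - _.
by apply/rowP => i; rewrite !mxE; ring.
Qed.

Lemma polygonal_norm (z : nat -> 'rV[R]_d) (N : nat) (r B : R) :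
  0 <= r <= N%:R ->
  (forall k, (k <= N)%N -> `|r - k%:R| <= 1 -> `|z k| <= B) ->
  `|polygonal z r| <= B.
Proof.
move=> /andP[r0 rN] H; rewrite /polygonal; set k := Num.truncn r; set l := r - _.
have /andP[kr rk] : k%:R <= r < k.+1%:R by exact: truncn_itv.
have l0 : 0 <= l by rewrite /l subr_ge0.
have l1 : l <= 1 by rewrite /l lerBlDr addrC natr1 ltW.
have kN : (k <= N)%N by rewrite -(ler_nat R) (le_trans kr).
have Hk : `|z k| <= B by apply: H => //; rewrite ger0_norm.
(* At r = N the next vertex is outside the range of the hypothesis, but its weight is then 0. *)
have [l00|l00] := eqVneq l 0; first by rewrite l00 scale0r addr0.
have kN1 : (k.+1 <= N)%N.
  rewrite ltn_neqAle kN andbT; apply: contra_neq l00 => kN'.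
  by apply/eqP; rewrite eq_le l0 andbT /l kN' subr_le0.
have Hk1 : `|z k.+1| <= B.
  apply: H => //; rewrite distrC ger0_norm ?subr_ge0 ?(ltW rk) // lerBlDr -natr1 addrC lerD2l.
  exact: kr.
have -> : z k + l *: (z k.+1 - z k) = (1 - l) *: z k + l *: z k.+1.
  by apply/rowP => i; rewrite !mxE; ring.
apply: (le_trans (ler_normD _ _)); rewrite !normrZ (ger0_norm l0) ger0_norm ?subr_ge0 //.
have : (1 - l) * `|z k| <= (1 - l) * B by rewrite ler_wpM2l ?subr_ge0.
have : l * `|z k.+1| <= l * B by rewrite ler_wpM2l.
lra.
Qed.

(** The triple holds the number of time steps, one less than the inverse mesh in space, and the list
    of vertices; such triples are countable. *)
Definition grid_path (p : nat * nat * seq V) : C :=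
  mkcts (@polygonal_continuous R d (fun k => map_mx intr (nth 0 p.2 k)) p.1.1
    p.1.2.+1%:R^-1).

Definition dense_path (j : nat) : C :=
  if choice.unpickle j is Some p then grid_path p else cst 0.

Lemma dense_pathP f (e : R) : 0 < e -> exists j, cdist f (dense_path j) <= e.
Proof.
move=> e0; have e2 : 0 < e / 2 by rewrite divr_gt0.
have [q Hq] := heine f e2; pose n := q.+1.
have n0 : 0 < n%:R :> R by rewrite ltr0n.
have [m hm] : exists m : nat, m.+1%:R^-1 <= e / 2.
  exists (Num.truncn (e / 2)^-1).
  rewrite -[leRHS]invrK lef_pV2 ?posrE ?invr_gt0 ?ltr0n //.
  by rewrite ltW // truncnS_gt.
have m0 : 0 < m.+1%:R :> R by rewrite ltr0n.
have grid k : exists v : V, (k <= n)%N -> forall t, `|n%:R * \val t - k%:R| <= 1 ->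
    `|f t - m.+1%:R^-1 *: map_mx intr v| <= e.
  have [kn|] := leqP k n; last by exists 0.
  have [tk Htk] : exists t : I01 R, \val t = k%:R / n%:R.
    by apply: exI01; rewrite divr_ge0 //= ler_pdivrMr // mul1r ler_nat.
  (* The vertex is the value of [f] at time k / n rounded down to the mesh 1 / (m + 1). Half of [e]
     pays for the rounding, half for the oscillation of [f] up to the neighbouring grid times. *)
  exists (\row_i Num.floor (m.+1%:R * f tk 0 i)) => _ t ht.
  have h1 : `|f t - f tk| < e / 2.
    apply: Hq; rewrite Htk -[X in X - _](mulKf (lt0r_neq0 n0)) [k%:R / _]mulrC.
    by rewrite -mulrBr normrM gtr0_norm ?invr_gt0 // ler_piMr // invr_ge0 ltW.
  apply: (le_trans (ler_distD (f tk) _ _)); rewrite [e]splitr; apply: lerD (ltW h1) _.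
  apply: le_trans hm; rewrite /Num.Def.normr /= mx_normrE; apply/bigmax_leP.
  split=> [|[i j] _]; first by rewrite invr_ge0 ltW.
  rewrite !mxE /= (ord1 i); set x := f tk 0 j.
  have -> : x - m.+1%:R^-1 * (Num.floor (m.+1%:R * x))%:~R =
      m.+1%:R^-1 * (m.+1%:R * x - (Num.floor (m.+1%:R * x))%:~R).
    by rewrite mulrBr mulKf // lt0r_neq0.
  rewrite normrM gtr0_norm ?invr_gt0 // ler_piMr ?invr_ge0 ?(ltW m0) //.
  have /andP[h3 h4] := mem_rg1_floor (m.+1%:R * x).
  by rewrite ger0_norm ?subr_ge0 // lerBlDl ltW.
have [v Hv] := choice grid.
exists (choice.pickle (n, m, mkseq v n.+1)); rewrite /dense_path choice.pickleK.
apply: cdist_le => t; rewrite ge_min; apply/orP; right.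
rewrite /grid_path /= polygonal_comb.
have /andP[t0 t1] := I01_itv t.
apply: (@polygonal_norm _ n) => [|k kn hk].
  by rewrite mulr_ge0 //= ler_piMr.
by rewrite nth_mkseq ?ltnS //; exact: Hv.
Qed.

End test_functions.

(** * Lipschitz test functions *)

Section lipschitz_approximation.
Variables (R : realType) (d : nat).
Local Notation C := (C01 R d).
Implicit Types (f g h : C) (s t : I01 R) (F : C -> R).

Lemma cdist_lip h : lipschitzC 1 (fun f => cdist f h).
Proof.
move=> f g; rewrite mul1r ler_norml; apply/andP; split.
  by have := cdist_triangle f g h; rewrite (cdistC g f); lra.
by have := cdist_triangle g f h; lra.
Qed.

Definition clamp01 (u : R) : R := Num.max 0 (Num.min 1 u).

Lemma clamp01_bnd u : 0 <= clamp01 u <= 1.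
Proof. by rewrite /clamp01 le_max lexx ge_max ler01 ge_min lexx. Qed.

Lemma max_lip (a b a' b' e : R) : `|a - a'| <= e -> `|b - b'| <= e ->
  `|Num.max a b - Num.max a' b'| <= e.
Proof.
rewrite !ler_norml => /andP[? ?] /andP[? ?].
by case: (leP a b) => ?; case: (leP a' b') => ?; lra.
Qed.

Lemma clamp01_lip u v : `|clamp01 u - clamp01 v| <= `|u - v|.
Proof.
apply: max_lip; first by rewrite subrr normr0.
have h1 := ler_norm (u - v).
have h2 : v - u <= `|u - v| by rewrite distrC ler_norm.
by case: (leP 1 u) => ?; case: (leP 1 v) => ?; rewrite ler_norml; apply/andP; split; lra.
Qed.

Definition tent (q j : nat) f : R :=
  clamp01 (2 - q.+1%:R * cdist f (dense_path R d j)).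

Lemma tent_lip q j : lipschitzC q.+1%:R (tent q j).
Proof.
move=> f g; apply: (le_trans (clamp01_lip _ _)).
have -> : 2 - q.+1%:R * cdist f (dense_path R d j) -
    (2 - q.+1%:R * cdist g (dense_path R d j)) =
    q.+1%:R * (cdist g (dense_path R d j) - cdist f (dense_path R d j)) by ring.
rewrite normrM ger0_norm // ler_wpM2l // distrC.
by have := cdist_lip (dense_path R d j) f g; rewrite mul1r.
Qed.

(** A running maximum of the tents, instead of their sum, keeps the values in [0, 1] and the
    Lipschitz constant independent of [J]. *)
Fixpoint hat (q J : nat) f : R :=
  if J is j.+1 then Num.max (hat q j f) (tent q j f) else 0.

Lemma hatS q J f : hat q J.+1 f = Num.max (hat q J f) (tent q J f).
Proof. by []. Qed.

Lemma hat_lip q J : lipschitzC q.+1%:R (hat q J).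
Proof.
elim: J => [|J IH] f g.
  rewrite /= subrr normr0 mulr_ge0 //.
  by have /andP[] := cdist_bnd f g.
by rewrite !hatS; apply: max_lip; [exact: IH|exact: tent_lip].
Qed.

Lemma hat_bnd q J f : 0 <= hat q J f <= 1.
Proof.
elim: J => [|J /andP[IH0 IH1]]; first by rewrite /= lexx ler01.
have /andP[t0 t1] := clamp01_bnd (2 - q.+1%:R * cdist f (dense_path R d J)).
by rewrite hatS le_max IH0 ge_max IH1 t1.
Qed.

Lemma hat_cvg q f : hat q J f @[J --> \oo] --> (1 : R).
Proof.
have q0 : 0 < q.+1%:R^-1 :> R by rewrite invr_gt0 ltr0n.
have [j hj] := dense_pathP f q0.
have tj : tent q j f = 1.
  have qd : q.+1%:R * cdist f (dense_path R d j) <= 1.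
    by rewrite mulrC -ler_pdivlMr ?ltr0n // mul1r.
  by rewrite /tent /clamp01 min_l ?max_r ?ler01 //; lra.
apply/cvgrPdist_le => e e0; exists j.+1 => // J /= jJ.
have : hat q J f = 1.
  apply/eqP; rewrite eq_le; have /andP[_ ->] /= := hat_bnd q J f.
  rewrite -tj -(subnKC jJ); elim: (J - j.+1)%N => [|k IH].
    by rewrite addn0 hatS le_max lexx orbT.
  by rewrite addnS hatS le_max IH.
by move=> ->; rewrite subrr normr0 ltW.
Qed.

(* Partition of unity: [hat q j.+1 - hat q j] is supported in the ball of
   radius 2 / (q + 1) around the j-th point of the dense sequence. *)
Lemma hat_approx F (M e : R) : unif_continuous F -> (forall f, `|F f| <= M) ->
  0 < e -> exists q, forall J f,
  `|F f - \sum_(j < J) F (dense_path R d j) * (hat q j.+1 f - hat q j f)| <=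
  e + M * (1 - hat q J f).
Proof.
move=> /unif_continuousP uF FM e0; have [r /= r0 Hr] := uF e e0.
have [q [hq1 hq2]] : exists q : nat, 2 / q.+1%:R <= r /\ 2 / q.+1%:R <= 1 :> R.
  pose m : R := Num.min r 1; have m0 : 0 < m by rewrite lt_min r0 ltr01.
  exists (Num.truncn (2 / m)); have : 2 / (Num.truncn (2 / m)).+1%:R <= m.
    by rewrite ler_pdivrMr ?ltr0n // mulrC -ler_pdivrMr // ltW // truncnS_gt.
  by rewrite /m le_min => /andP[].
exists q => J f.
have tel : \sum_(j < J) (hat q j.+1 f - hat q j f) = hat q J f.
  rewrite -(big_mkord xpredT (fun j => hat q j.+1 f - hat q j f)).
  by rewrite telescope_sumr // subr0.
have -> : F f - \sum_(j < J) F (dense_path R d j) * (hat q j.+1 f - hat q j f) =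
    \sum_(j < J) (F f - F (dense_path R d j)) * (hat q j.+1 f - hat q j f) +
    F f * (1 - hat q J f).
  under [X in _ = X + _]eq_bigr do rewrite mulrBl.
  by rewrite sumrB -mulr_sumr tel; ring.
apply: (le_trans (ler_normD _ _)); apply: lerD; last first.
  have /andP[_ h1] := hat_bnd q J f.
  by rewrite normrM [X in _ * X]ger0_norm ?subr_ge0 // ler_wpM2r ?subr_ge0.
apply: (@le_trans _ _ (\sum_(j < J) e * (hat q j.+1 f - hat q j f))); last first.
  by rewrite -mulr_sumr tel ler_piMr ?(ltW e0) //; have /andP[] := hat_bnd q J f.
apply: (le_trans (ler_norm_sum _ _ _)); apply: ler_sum => j _.
have dh : 0 <= hat q j.+1 f - hat q j f by rewrite subr_ge0 hatS le_max lexx.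
rewrite normrM [X in _ * X]ger0_norm //.
have [far|near] := leP (2 / q.+1%:R) (cdist f (dense_path R d j)).
  have -> : hat q j.+1 f = hat q j f.
    rewrite hatS max_l // /tent /clamp01 max_l; first by have /andP[] := hat_bnd q j f.
    rewrite ge_min; apply/orP; right; rewrite subr_le0 mulrC.
    by rewrite -ler_pdivrMr ?ltr0n.
  by rewrite subrr !mulr0.
apply: ler_wpM2r => //; apply: ltW.
have := Hr (f, dense_path R d j); rewrite -ball_normE; apply.
apply: le_ball hq1 _ _; exact: cdist_ball.
Qed.

(** A Lipschitz majorant of the indicator of [B]; the adjoined 0 gives the supremum its meaning when
    [B] is empty. *)
Definition near_set (B : set C) (k : nat) f : R :=
  sup (0 |` [set clamp01 (1 - k%:R * cdist f b) | b in B]).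

Let near_sup B k f : has_sup (0 |` [set clamp01 (1 - k%:R * cdist f b) | b in B]).
Proof.
split; first by exists 0; left.
exists 1 => _ [->|[b _ <-]]; first exact: ler01.
by have /andP[] := clamp01_bnd (1 - k%:R * cdist f b).
Qed.

Lemma near_set_bnd B k f : 0 <= near_set B k f <= 1.
Proof.
apply/andP; split; first by apply: ub_le_sup; [have [] := near_sup B k f|left].
apply: ge_sup; first by have [] := near_sup B k f.
move=> _ [->|[b _ <-]]; first exact: ler01.
by have /andP[] := clamp01_bnd (1 - k%:R * cdist f b).
Qed.

Lemma near_set_in (B : set C) k f : B f -> near_set B k f = 1.
Proof.
move=> Bf; apply/eqP; rewrite eq_le; have /andP[_ ->] /= := near_set_bnd B k f.
apply: ub_le_sup; first by have [] := near_sup B k f.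
right; exists f => //; rewrite cdistxx mulr0 subr0 /clamp01 minxx max_r ?ler01 //.
Qed.

Let near_set_lip1 B k f g : near_set B k f <= near_set B k g + k%:R * cdist f g.
Proof.
apply: ge_sup; first by have [] := near_sup B k f.
have kc : 0 <= k%:R * cdist f g.
  by rewrite mulr_ge0 //; have /andP[] := cdist_bnd f g.
move=> _ [->|[b Bb <-]].
  by rewrite addr_ge0 //; have /andP[] := near_set_bnd B k g.
apply: (@le_trans _ _ (clamp01 (1 - k%:R * cdist g b) + k%:R * cdist f g)); last first.
  by rewrite lerD2r; apply: ub_le_sup; [have [] := near_sup B k g|right; exists b].
rewrite -lerBlDl; apply: (le_trans (ler_norm _)); apply: (le_trans (clamp01_lip _ _)).
have -> : 1 - k%:R * cdist f b - (1 - k%:R * cdist g b) =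
    k%:R * (cdist g b - cdist f b) by ring.
rewrite normrM ger0_norm // ler_wpM2l // distrC.
by have := cdist_lip b f g; rewrite mul1r.
Qed.

Lemma near_set_lip B k : lipschitzC k%:R (near_set B k).
Proof.
move=> f g; rewrite ler_norml; apply/andP; split.
  by have := near_set_lip1 B k g f; rewrite (cdistC g f); lra.
by have := near_set_lip1 B k f g; lra.
Qed.

Lemma near_set_cvg (B : set C) f : closed B ->
  near_set B k f @[k --> \oo] --> (\1_B f : R).
Proof.
move=> cB; rewrite indicE; have [/set_mem Bf|nBf] := boolP (f \in B).
  by under eq_fun do rewrite near_set_in //; exact: cvg_cst.
have oB : nbhs f (~` B).
  by apply: open_nbhs_nbhs; split; [exact: closed_openC|rewrite notin_setE in nBf].
have /nbhs_ballP[r /= r0 Hr] := oB.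
pose m : R := Num.min r 1; have m0 : 0 < m by rewrite lt_min r0 ltr01.
have Hm b : B b -> m <= cdist f b.
  move=> Bb; rewrite leNgt; apply/negP => fb; apply: (Hr b) => //.
  have mr : m <= r by rewrite ge_min lexx.
  by apply: (le_ball mr); apply: cdist_ball => //; rewrite ge_min lexx orbT.
apply/cvgrPdist_le => e e0; exists (Num.truncn m^-1).+1 => // k /= hk.
have km : 1 <= k%:R * m.
  rewrite -ler_pdivrMr // mul1r ltW //; apply: lt_le_trans (truncnS_gt _) _.
  by rewrite ler_nat.
suff -> : near_set B k f = 0 by rewrite subrr normr0 ltW.
apply/eqP; rewrite eq_le; have /andP[-> _] := near_set_bnd B k f; rewrite andbT.
apply: ge_sup; first by have [] := near_sup B k f.
move=> _ [->//|[b Bb <-]]; rewrite /clamp01 max_l //.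
rewrite ge_min; apply/orP; right; rewrite subr_le0 (le_trans km) // ler_wpM2l //.
exact: Hm.
Qed.

End lipschitz_approximation.

(** * Effect of a short excursion on the rescaled path *)

Section restart.
Variables (R : realType) (d : nat).
Local Notation C := (C01 R d).
Local Notation V := 'rV[int]_d.
Implicit Types (x y z : V) (u : nat -> V).

Lemma norm_intr z : `|map_mx intr z : 'rV[R]_d| <= (nrm z)%:R.
Proof.
rewrite /Num.Def.normr /= mx_normrE; apply/bigmax_leP; split => // -[i j] _.
rewrite !mxE /= (ord1 i) -intr_norm -abszE -pmulrn ler_nat.
exact: nrm_ge.
Qed.

Definition centred (n : nat) u : C := rescaled R n (fun k => u k - u 0%N).

Lemma rescaledE n u t :
  rescaled R n u t = (Num.sqrt n%:R)^-1 *: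
    polygonal (fun k => map_mx intr (u k) : 'rV[R]_d) (n%:R * \val t).
Proof. by []. Qed.

(** At time 1 the interpolation formula mentions position n + 1, with weight 0; this is the origin
    of the [n.+1] that recurs in [walk_mean]. *)
Lemma rescaled_depends n : depends n.+1 (fun u => rescaled R n u).
Proof.
move=> u u' uu'; apply/continuousEP => t; rewrite !rescaledE /polygonal.
have /andP[t0 t1] := I01_itv t.
have tn : (Num.truncn (n%:R * \val t) <= n)%N.
  rewrite -(ler_nat R) (le_trans (y := n%:R * \val t)) ?ler_piMr //.
  by rewrite truncn_le mulr_ge0.
by rewrite !uu' // ltnW.
Qed.

Lemma centred_depends n : depends n.+1 (centred n).
Proof.
by move=> u u' uu'; apply: rescaled_depends => k kn; rewrite !uu'.
Qed.

Lemma centred_shift n x u : centred n (fun k => x + u k) = centred n u.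
Proof.
rewrite /centred; congr rescaled; apply/funext => k.
by rewrite opprD addrACA subrr add0r.
Qed.

Lemma rescaled_grid n u k t : \val t = k%:R / n%:R -> (0 < n)%N ->
  rescaled R n u t = (Num.sqrt n%:R)^-1 *: (map_mx intr (u k) : 'rV[R]_d).
Proof.
move=> tk n0; have nn : n%:R != 0 :> R by rewrite pnatr_eq0 -lt0n.
rewrite rescaledE tk mulrC divfK // /polygonal natrK subrr scale0r addr0 //.
Qed.

(* Up to an error controlled by the modulus of continuity of the continuation u,
   a short excursion h near x does not change the rescaled path. *)
Lemma cdist_restart n q (h : seq V) x u (l : nat) : (0 < n)%N ->
  (size h * q.+1 <= n)%N ->
  all (fun y => nrm (y - x)%R < l)%N h -> (nrm (u 0%N - x)%R < l)%N ->
  cdist (centred n (catp h u)) (centred n u) <=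
    (l.*2)%:R / Num.sqrt n%:R + modulus q (centred n u).
Proof.
move=> n0 hq hB uB; set m := modulus q _; set r := Num.sqrt n%:R.
have nR : 0 < n%:R :> R by rewrite ltr0n.
have r0 : 0 < r by rewrite sqrtr_gt0.
have L0 : 0 <= (l.*2)%:R / r by rewrite divr_ge0 // ltW.
(* A modulus that reaches 1 makes the claim trivial, because [cdist] is at most 1; below 1 the
   truncation is inactive and the modulus bounds true increments. *)
have [m1|m1] := leP 1 m.
  have /andP[_ c1] := cdist_bnd (centred n (catp h u)) (centred n u).
  by apply: (le_trans c1); apply: (le_trans m1); rewrite lerDr.
set p0 := catp h u 0%N.
have p0B : (nrm (p0 - x)%R < l)%N.
  rewrite /p0 /catp; case: (posnP (size h)) => [->|h0]; first by rewrite subn0.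
  by apply: (allP hB); exact: mem_nth.
have near y : (nrm (y - x)%R < l)%N -> (nrm (y - p0)%R <= l.*2)%N.
  move=> yB; have -> : y - p0 = (y - x) + - (p0 - x).
    by rewrite opprB addrA subrK.
  by have := nrmD (y - x) (- (p0 - x)); rewrite nrmN; lia.
pose U k := u k - u 0%N.
(* By [hq], up to [size h] steps last at most 1 / (q + 1) in rescaled time, so the modulus controls
   the increments of [u] over them. *)
have gridU i j : (i <= n)%N -> (j <= n)%N -> `|i%:R - j%:R| <= (size h)%:R :> R ->
    `|r^-1 *: (map_mx intr (U i) : 'rV[R]_d) - r^-1 *: map_mx intr (U j)| <= m.
  move=> iN jN ij.
  have ex k : (k <= n)%N -> exists t : I01 R, \val t = k%:R / n%:R.
    by move=> kn; apply: exI01; rewrite divr_ge0 //= ler_pdivrMr // mul1r ler_nat.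
  have [s Hs] := ex i iN; have [t Ht] := ex j jN.
  have st : `|\val s - \val t| <= q.+1%:R^-1.
    rewrite Hs Ht -mulrBl normrM (gtr0_norm (x := n%:R^-1)) ?invr_gt0 //.
    rewrite ler_pdivrMr // mulrC ler_pdivlMr ?ltr0n //.
    by apply: (le_trans (ler_wpM2r _ ij)) => //; rewrite -natrM ler_nat.
  have := modulus_ge (centred n u) st.
  rewrite /centred (rescaled_grid _ Hs n0) (rescaled_grid _ Ht n0) ge_min.
  by rewrite leNgt m1.
apply: cdist_le => t; rewrite ge_min; apply/orP; right.
rewrite rescaledE -/r.
have -> : rescaled R n (fun k => catp h u k - catp h u 0%N) t -
    r^-1 *: polygonal (fun k => map_mx intr (U k)) (n%:R * \val t) =
    polygonal (fun k => r^-1 *: map_mx intr (catp h u k - p0) -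
       r^-1 *: map_mx intr (U k)) (n%:R * \val t).
  rewrite rescaledE -/r /polygonal; set k := Num.truncn _; set c := _ - _.
  by apply/rowP => i; rewrite !mxE; ring.
have /andP[t0 t1] := I01_itv t.
apply: (@polygonal_norm _ _ _ n) => [|k kn _].
  by rewrite mulr_ge0 //= ler_piMr.
have scale z : (nrm z <= l.*2)%N -> `|r^-1 *: (map_mx intr z : 'rV[R]_d)| <= (l.*2)%:R / r.
  move=> zl; rewrite normrZ gtr0_norm ?invr_gt0 // mulrC ler_pM2r ?invr_gt0 //.
  by apply: (le_trans (norm_intr z)); rewrite ler_nat.
have [kh|hk] := ltnP k (size h).
  rewrite {1}/catp kh; apply: (le_trans (ler_normB _ _)); apply: lerD.
    by apply/scale/near/(allP hB)/mem_nth.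
  have := @gridU k 0%N kn (leq0n _).
  rewrite subr0 normr_nat ler_nat => /(_ (ltnW kh)).
  by rewrite {2}/U subrr map_mx0 scaler0 subr0.
have -> : catp h u k = u (k - size h)%N by rewrite /catp ltnNge hk.
(* After the excursion the two paths differ by the displacement from [p0] to [u 0] and by an
   increment of [u] over [size h] steps. *)
have -> : r^-1 *: map_mx intr (u (k - size h)%N - p0) - r^-1 *: map_mx intr (U k) =
    r^-1 *: map_mx intr (u 0%N - p0) +
    (r^-1 *: map_mx intr (U (k - size h)%N) - r^-1 *: map_mx intr (U k)) :> 'rV[R]_d.
  apply/rowP => i; rewrite /U !mxE !intrD !intrN; ring.
apply: (le_trans (ler_normD _ _)); apply: lerD; first exact/scale/near.
apply: gridU => //; first exact: leq_trans (leq_subr _ _) kn.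
by rewrite natrB // addrAC subrr add0r normrN normr_nat.
Qed.

End restart.
(** * Density of bad sites *)

Section covering.
Variables (R : realType) (d : nat).
Local Notation V := 'rV[int]_d.

Lemma card_near (E : {fset V}) x L :
  (#|` [fset y in E | (nrm (y - x)%R <= L)%N]%fset| <= L.*2.+1 ^ d)%N.
Proof.
rewrite -card_box; have <- : #|` [fset (x + y)%R | y in box d L]%fset| = #|` box d L|.
  by rewrite card_imfset //; exact: addrI.
apply: fsubset_leq_card; apply/fsubsetP => y; rewrite !inE /= => /andP[_ yL].
by apply/imfsetP; exists (y - x); rewrite /= ?in_box // addrC subrK.
Qed.

(* Vitali: keep the largest cube and discard the centres of all the cubes
   meeting it; the remaining cubes do not see the points of the kept one. *)
Lemma vitali_count (alpha : R) (E A : {fset V}) (r : V -> nat) : 0 <= alpha ->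
  (forall x, x \in E -> alpha * ((r x).*2.+1 ^ d)%:R <=
     #|` [fset y in A | (nrm (y - x)%R <= r x)%N]%fset|%:R) ->
  alpha * #|` E|%:R <= 2 ^+ d * #|` A|%:R.
Proof.
move=> a0; have [n] := ubnP #|` E|; elim: n E A => // n IH E A En H.
have [->|/fset0Pn[x0 x0E]] := eqVneq E fset0.
  by rewrite cardfs0 mulr0 mulr_ge0 // exprn_ge0.
have [x xE xmax] : exists2 x, x \in E & forall y, y \in E -> (r y <= r x)%N.
  have [x _ xm] := @arg_maxnP _ [` x0E]%fset xpredT (fun x => r (val x)) isT.
  by exists (val x); [exact: valP|move=> y yE; exact: (xm [` yE]%fset isT)].
pose L := r x.
pose E1 := [fset y in E | (nrm (y - x)%R <= L.*2)%N]%fset.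
pose E2 := [fset y in E | ~~ (nrm (y - x)%R <= L.*2)%N]%fset.
pose A1 := [fset y in A | (nrm (y - x)%R <= L)%N]%fset.
pose A2 := [fset y in A | ~~ (nrm (y - x)%R <= L)%N]%fset.
have split_card (S : {fset V}) (p : pred V) : (#|` S| =
    #|` [fset y in S | p y]%fset| + #|` [fset y in S | ~~ p y]%fset|)%N.
  rewrite -cardfsUI [X in (_ + #|` X|)%N](_ : _ = fset0) ?cardfs0 ?addn0.
    by congr #|` _|; apply/fsetP => y; rewrite !inE /=; case: (y \in S); case: (p y).
  by apply/fsetP => y; rewrite !inE /=; case: (y \in S); case: (p y).
have HE : (#|` E| = #|` E1| + #|` E2|)%N by exact: split_card.
have HA : (#|` A| = #|` A1| + #|` A2|)%N by exact: split_card.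
have xE1 : x \in E1 by rewrite !inE /= xE subrr nrm0.
have h1 : alpha * #|` E1|%:R <= 2 ^+ d * #|` A1|%:R.
  apply: (@le_trans _ _ (alpha * ((L.*2.*2.+1) ^ d)%:R)).
    by apply: ler_wpM2l => //; rewrite ler_nat; exact: card_near.
  (* The discarded centres fill at most a cube of side 4 L + 1, and 4 L + 1 is at most 2 (2 L + 1);
     this is the factor 2^d. *)
  apply: (@le_trans _ _ (2 ^+ d * (alpha * (L.*2.+1 ^ d)%:R))); last first.
    by apply: ler_wpM2l; [exact: exprn_ge0|exact: H].
  rewrite mulrCA; apply: ler_wpM2l => //; rewrite -natrX -natrM ler_nat -expnMn.
  by case: (posnP d) => [->//|d0]; rewrite leq_exp2r //; lia.
have h2 : alpha * #|` E2|%:R <= 2 ^+ d * #|` A2|%:R.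
  apply: IH => [|y]; first by have : (0 < #|` E1|)%N by [rewrite cardfs_gt0; apply/fset0Pn; exists x]; lia.
  rewrite !inE /= => /andP[yE yx]; apply: (le_trans (H y yE)).
  rewrite ler_nat; apply: fsubset_leq_card; apply/fsubsetP => z.
  rewrite !inE /= => /andP[-> zy]; rewrite zy andbT /=.
  have := xmax y yE; have := nrmD (z - x) (- (z - y)); rewrite nrmN.
  by rewrite (_ : z - x + - (z - y) = y - x) /L in yx * ; [lia|rewrite opprB addrC addrA subrK].
by rewrite HE HA !natrD !mulrDr; exact: lerD.
Qed.

Lemma card_filter_le (S : {fset V}) (p q : pred V) : (forall y, p y -> q y) ->
  (#|` [fset y in S | p y]%fset| <= #|` [fset y in S | q y]%fset|)%N.
Proof.
move=> pq; apply: fsubset_leq_card; apply/fsubsetP => y.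
by rewrite !inE /= => /andP[-> /pq].
Qed.

End covering.

(** * Maximal inequality and density of rare events along an orbit *)

Section maximal_inequality.
Variables (R : realType) (d : nat) (P : probability (env R d) R).
Local Notation V := 'rV[int]_d.
Local Notation shift := Defs.shift.

Lemma measurable_coord (b : edge d) : measurable_fun setT (fun w : env R d => w b).
Proof.
move=> _ B mB; rewrite setTI; apply: sub_sigma_algebra; exists b, B; split => //.
Qed.

Lemma measurable_shift (x : V) : measurable_fun setT (@shift R d x).
Proof.
apply: (@measurability _ _ (env R d) (env R d) setT _ (@cylinders R d)) => [//|].
move=> _ [_ [b [B [mB ->]]] <-]; rewrite setTI;
  apply: sub_sigma_algebra; exists (x + b.1, b.2), B; split => //.
Qed.

Lemma shift_shift x y (w : env R d) : shift x (shift y w) = shift (y + x) w.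
Proof. by apply/funext => b; rewrite /shift addrA. Qed.

Hypothesis P_stationary : stationary P.

Definition visits (A : set (env R d)) L w : R :=
  \sum_(x <- box d L) \1_A (shift x w).

Definition dense_upto (A : set (env R d)) (alpha : R) n : set (env R d) :=
  [set w | exists2 L, (L <= n)%N & alpha * (L.*2.+1 ^ d)%:R < visits A L w].

Lemma visitsE A L x w : visits A L (shift x w) =
  #|` [fset y in box d L | `[< A (shift (x + y)%R w) >]]%fset|%:R.
Proof.
rewrite /visits; under eq_bigr do rewrite shift_shift indicE.
rewrite -[RHS]zsum_indic (@zsumE _ _ (box d L)) => [|y].
  rewrite big_seq [RHS]big_seq; apply: eq_bigr => y yL.
  by rewrite !inE /= yL.
by rewrite !inE /= => /negbTE ->.
Qed.

Lemma measurable_shift_set (A : set (env R d)) x : measurable A ->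
  measurable (shift x @^-1` A).
Proof.
by move=> mA; rewrite -[X in measurable X]setTI; exact: measurable_shift.
Qed.

Lemma bmeas_visits A L : measurable A -> bmeas (visits A L).
Proof.
move=> mA; apply: bmeas_sum => x.
exact: (bmeas_indic R (measurable_shift_set x mA)).
Qed.

Lemma measurable_dense A alpha n : measurable A -> measurable (dense_upto A alpha n).
Proof.
move=> mA; rewrite (_ : dense_upto A alpha n = \bigcup_(L in `I_n.+1)
    [set w | alpha * (L.*2.+1 ^ d)%:R < visits A L w]); last first.
  by apply/seteqP; split => w [L Ln HL]; exists L.
apply: fin_bigcup_measurable => // L _.
rewrite -[X in measurable X]setTI; apply: measurable_fun_ltr => //.
by have [] := bmeas_visits L mA.
Qed.

(** Transference: the covering lemma is applied along the orbit of a single environment, with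
    centres in the box of radius [n], and the result is integrated using stationarity. The cubes
    reach into the box of radius 2 n, whose volume costs a second factor 2^d. *)
Lemma maximal_ineq A alpha n : measurable A -> 0 <= alpha ->
  alpha * fine (P (dense_upto A alpha n)) <= 4 ^+ d * fine (P A).
Proof.
move=> mA a0; set D := dense_upto A alpha n.
have mD : measurable D by exact: measurable_dense.
have pt w : alpha * visits D n w <= 2 ^+ d * visits A n.*2 w.
  have -> : w = shift 0 w by apply/funext => b; rewrite /shift add0r -surjective_pairing.
  rewrite !visitsE.
  set E := [fset y in _ | _]%fset; set A' := [fset y in _ | _]%fset.
  have Hr x : x \in E -> exists2 L, (L <= n)%N &
      alpha * (L.*2.+1 ^ d)%:R < visits A L (shift x w).
    by rewrite !inE /= => /andP[_ /asboolP[L Ln]]; rewrite add0r; exists L.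
  pose r x := if pselect (x \in E) is left h then sval (cid2 (Hr x h)) else 0%N.
  apply: (vitali_count (r := r)) => // x xE; rewrite /r.
  case: pselect => // h; case: cid2 => L Ln /ltW HL /=; apply: (le_trans HL).
  rewrite visitsE ler_nat; set F := [fset y in _ | _]%fset.
  have <- : #|` [fset (x + y)%R | y in F]%fset| = #|` F|.
    by rewrite card_imfset //; exact: addrI.
  apply: fsubset_leq_card; apply/fsubsetP => z /imfsetP[y /=].
  rewrite !inE /= !in_box => /andP[yL Ay] ->.
  move: xE; rewrite !inE /= !in_box => /andP[xn _].
  rewrite add0r Ay andbT (_ : x + y - x = y) ?yL ?andbT; last by rewrite addrC addKr.
  by have := nrmD x y; lia.
have Ev B L : measurable B -> Er P (visits B L) = (L.*2.+1 ^ d)%:R * fine (P B).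
  move=> mB; rewrite Er_sum => [|x]; last first.
    exact: (bmeas_indic R (measurable_shift_set x mB)).
  rewrite (eq_bigr (fun=> fine (P B))) => [|x _]; last first.
    by rewrite (Er_indic P (measurable_shift_set x mB)) P_stationary.
  by rewrite big_const_seq count_predT card_box iter_addr_0 mulr_natl.
have := le_Er P (bmeasZ alpha (bmeas_visits n mD))
  (bmeasZ (2 ^+ d) (bmeas_visits n.*2 mA)) pt.
rewrite !ErZ; [|exact: bmeas_visits|exact: bmeas_visits].
rewrite !Ev // => H.
have c0 : 0 < (n.*2.+1 ^ d)%:R :> R by rewrite ltr0n expn_gt0.
rewrite -(ler_pM2l c0) mulrCA; apply: (le_trans H).
rewrite mulrA mulrA; apply: ler_wpM2r; first exact: fine_ge0.
rewrite mulrC -!natrX -!natrM ler_nat -!expnMn.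
by case: (posnP d) => [->//|d0]; rewrite leq_exp2r //; lia.
Qed.

(** The bound of [maximal_ineq] is uniform in [n], so it passes to the event that the density is
    exceeded at some scale; for fixed [alpha] the probability of that event vanishes as [N] grows.
    The values 1 / (k + 1) of [alpha] suffice for a single null set. *)
Lemma dense_density (A : nat -> set (env R d)) :
  (forall n, measurable (A n)) -> nonincreasing_seq A ->
  P (\bigcap_n A n) = 0%E ->
  {ae P, forall w, forall alpha : R, 0 < alpha -> exists N, forall L,
    visits (A N) L w <= alpha * (L.*2.+1 ^ d)%:R}.
Proof.
move=> mA nA PA0.
have cA : fine (P (A N)) @[N --> \oo] --> (0 : R).
  apply: fine_cvg; rewrite -[0%:E]/(0%E) -PA0.
  apply: (nonincreasing_cvg_mu (mu := P)) => //; last exact: bigcapT_measurable.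
  by rewrite (le_lt_trans (probability_le1 _ _)) ?ltry.
pose D N (a : R) := \bigcup_n dense_upto (A N) a n.
have mD N a : measurable (D N a).
  by apply: bigcupT_measurable => n; exact: measurable_dense.
have HD N a : 0 < a -> fine (P (D N a)) <= a^-1 * (4 ^+ d * fine (P (A N))).
  move=> a0; have c : fine (P (dense_upto (A N) a n)) @[n --> \oo] --> fine (P (D N a)).
    apply: fine_cvg; rewrite fineK ?fin_num_measure //.
    apply: (nondecreasing_cvg_mu (mu := P)) => //.
    - by move=> n; exact: measurable_dense.
    - exact: mD.
    - move=> i j ij; apply/subsetPset => w [L Li HL].
      by exists L => //; exact: leq_trans Li ij.
  apply: (cvgr_to_le c); apply: nearW => n.
  by rewrite -(ler_pM2l a0) mulVKf ?lt0r_neq0 //; apply: maximal_ineq => //; exact: ltW.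
have Hk k : {ae P, forall w, exists N, forall L,
    visits (A N) L w <= k.+1%:R^-1 * (L.*2.+1 ^ d)%:R}.
  pose a : R := k.+1%:R^-1; have a0 : 0 < a by rewrite invr_gt0 ltr0n.
  exists (\bigcap_N D N a); split.
  - by apply: bigcapT_measurable.
  - have le N : fine (P (\bigcap_N D N a)) <= a^-1 * (4 ^+ d * fine (P (A N))).
      apply: le_trans (HD N a a0); apply: fine_le; rewrite ?fin_num_measure //.
        exact: bigcapT_measurable.
      by apply: le_measure; rewrite ?inE //; [exact: bigcapT_measurable|exact: bigcap_inf].
    have c : a^-1 * (4 ^+ d * fine (P (A N))) @[N --> \oo] --> (0 : R).
      have c1 : 4 ^+ d * fine (P (A N)) @[N --> \oo] --> (4 ^+ d * 0 : R).
        by apply: cvgM cA; exact: cvg_cst.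
      have c2 : a^-1 * (4 ^+ d * fine (P (A N))) @[N --> \oo] --> (a^-1 * (4 ^+ d * 0) : R).
        by apply: cvgM c1; exact: cvg_cst.
      by rewrite !mulr0 in c2.
    have : fine (P (\bigcap_N D N a)) <= 0.
      by apply: (cvgr_to_ge c); apply: nearW.
    move=> h; have : fine (P (\bigcap_N D N a)) = 0.
      by apply/eqP; rewrite eq_le h fine_ge0.
    by move=> h0; rewrite -[LHS]fineK ?h0 // fin_num_measure //; exact: bigcapT_measurable.
  move=> w /= Hw N _; apply: contrapT => nD; apply: Hw; exists N => L.
  rewrite leNgt; apply/negP => HL; apply: nD; exists L => //.
  by exists L.
have := ae_foralln Hk; apply: filterS => w Hw alpha a0.
have [k hk] : exists k, k.+1%:R^-1 <= alpha.
  exists (Num.truncn alpha^-1); rewrite -[leRHS]invrK lef_pV2 ?posrE ?invr_gt0 ?ltr0n //.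
  by rewrite ltW // truncnS_gt.
have [N HN] := Hw k; exists N => L; apply: (le_trans (HN L)).
by apply: ler_wpM2r.
Qed.

End maximal_inequality.
(** * Uniform convergence *)

Section uniform_from_density.
Variables (R : realType) (d : nat) (w : edge d -> R) (kappa : R).
Local Notation C := (C01 R d).
Local Notation V := 'rV[int]_d.
Hypothesis kappa_gt0 : 0 < kappa.
Hypothesis w_bnd : forall b, kappa <= w b <= kappa^-1.
Hypothesis d_gt0 : (0 < d)%N.

Definition walk_mean (v : edge d -> R) (F : C -> R) (n : nat) (x : V) : R :=
  pexp v n.+1 x (fun u => F (centred R n u)).

Let w_gt0 b : 0 < w b.
Proof. by have /andP[/(lt_le_trans kappa_gt0)] := w_bnd b. Qed.

Variables (F : C -> R) (K M mu e : R) (q : nat).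
Hypothesis F_lip : lipschitzC K F.
Hypothesis F_bnd : forall f, `|F f| <= M.
Hypothesis mu_bnd : `|mu| <= M.
Hypothesis K_ge0 : 0 <= K.
Hypothesis e_ge0 : 0 <= e.

Definition bad_site (v : edge d -> R) N (y : V) : Prop := exists2 n, (N <= n)%N &
  e < `|walk_mean v F n y - mu| \/ e < walk_mean v (modulus q) n y.

(** Restart at the first good site: the first [e] is the error there, [2 * rho] the rescaled
    displacement, the second [e] the mean modulus that pays for the time shift, and [2 * M] the
    trivial bound when no good site is met. *)
Lemma walk_mean_le_miss N n (x : V) (l : nat) (rho : R) :
  (0 < n)%N -> (N <= n)%N -> (0 < l)%N -> l%:R <= rho * Num.sqrt n%:R ->
  `|walk_mean w F n x - mu| <= e + K * (2 * rho + e) + 2 * M *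
    miss w (fun z => (nrm (z - x)%R < l)%N) (fun z => `[< bad_site w N z >])
      (n %/ q.+1) x.
Proof.
move=> n0 Nn l0 lr; set T := (n %/ q.+1)%N; set inB := fun z => _; set bad := fun z => _.
have Tq : (T * q.+1 <= n)%N by exact: leq_trunc_div.
have Tn : (T <= n)%N by apply: leq_trans Tq; exact: leq_pmulr.
pose f u := F (centred R n u).
have df : depends n.+1 f by move=> u u' uu'; rewrite /f (centred_depends R uu').
have s0 : 0 < Num.sqrt n%:R :> R by rewrite sqrtr_gt0 ltr0n.
(* The horizon 2 n + 2 leaves more than n + 1 steps after an excursion of at most [T <= n] steps,
   and [f] depends on no more than n + 1. *)
have good h z : all inB h -> (size h <= T)%N -> inB z -> ~~ bad z ->
    `|pexp w (n.*2.+2 - size h) z (fun u => f (catp h u)) - mu| <=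
      e + K * (2 * rho + e).
  move=> hB hT Bz /asboolPn gz; set m := (n.*2.+2 - size h)%N.
  have mn : (n.+1 <= m)%N by rewrite /m; lia.
  have [g1 g2] : `|walk_mean w F n z - mu| <= e /\ walk_mean w (modulus q) n z <= e.
    by split; rewrite leNgt; apply/negP => H; apply: gz; exists n => //; [left|right].
  rewrite -(subrK (pexp w m z f) (pexp w m z _)) -addrA.
  apply: (le_trans (ler_normD _ _)); rewrite [leRHS]addrC; apply: lerD; last first.
    by rewrite (pexp_dep w_gt0 d_gt0 z df mn).
  apply: (@le_trans _ _ (pexp w m z (fun u => K * (2 * rho + modulus q (centred R n u))))).
    apply: (pexp_dist w_gt0 d_gt0) => u uz.
    apply: (le_trans (F_lip _ _)); apply: ler_wpM2l => //.
    have hq : (size h * q.+1 <= n)%N.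
      by apply: leq_trans Tq; rewrite leq_mul2r hT orbT.
    have uB : (nrm (u 0%N - x)%R < l)%N by rewrite uz.
    apply: (le_trans (cdist_restart R n0 hq hB uB)); rewrite lerD2r.
    by rewrite ler_pdivrMr // -mul2n natrM -mulrA ler_wpM2l.
  rewrite pexpZ pexpD (pexp_cst w_gt0 d_gt0); apply: ler_wpM2l => //; rewrite lerD2l.
  have dm : depends n.+1 (fun u : nat -> V => modulus q (centred R n u)).
    by move=> u u' uu'; rewrite (centred_depends R uu').
  by rewrite (pexp_dep w_gt0 d_gt0 z dm mn).
have e'0 : 0 <= e + K * (2 * rho + e).
  rewrite addr_ge0 // mulr_ge0 // addr_ge0 // mulr_ge0 //.
  by rewrite -(pmulr_lge0 _ s0) (le_trans _ lr).
have TN : (T <= n.*2.+2)%N by lia.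
have := strong_markov w_gt0 d_gt0 (inB := inB) (bad := bad) TN e'0
  (fun u => F_bnd (centred R n u)) mu_bnd good (r := T) (h := [::]) x isT.
rewrite add0n subn0 => /(_ (leqnn _)).
have -> : (fun u => F (centred R n (catp [::] u))) = f.
  apply/funext => u; rewrite /f; congr (F (centred _ _ _)).
  by apply/funext => k; rewrite /catp /= subn0.
have nN : (n.+1 <= n.*2.+2)%N by lia.
by rewrite (pexp_dep w_gt0 d_gt0 x df nN).
Qed.

Lemma uniform_from_density :
  (forall alpha : R, 0 < alpha -> exists N, forall L,
    #|` [fset y in box d L | `[< bad_site w N y >]]%fset|%:R <=
      alpha * (L.*2.+1 ^ d)%:R) ->
  forall H rho delta : R, 0 < H -> 0 < rho -> 0 < delta ->
  exists N0, forall n, (N0 <= n)%N -> forall x, cube H n x ->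
    `|walk_mean w F n x - mu| <= e + K * (2 * rho + e) + 2 * M * delta.
Proof.
move=> dens H rho delta H0 rho0 delta0.
have M0 : 0 <= M by exact: le_trans mu_bnd.
pose Kc : R := 32 * d%:R * d.+1%:R ^+ 2 * 2 ^+ d * kappa^-2.
have Kc0 : 0 < Kc.
  have dR : 0 < d%:R :> R by rewrite ltr0n.
  have k2 : 0 < kappa ^- 2 by rewrite invr_gt0 exprn_gt0.
  have D2 : 0 < d.+1%:R ^+ 2 :> R by rewrite exprn_gt0 // ltr0n.
  have E2 : 0 < 2 ^+ d :> R by rewrite exprn_gt0.
  by rewrite /Kc !mulr_gt0.
(* [D / n] will bound the sum of the inverse time horizon and the inverse squared radius; the
   factors 2 and 4 absorb the rounding in [T] and [l]. *)
pose D : R := 2 * q.+1%:R + 4 / rho ^+ 2.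
have D0 : 0 < D by rewrite /D addr_gt0 // ?divr_gt0 ?mulr_gt0 ?exprn_gt0.
(* The largest c with c^2 Kc D <= delta^2: this is the smallness condition of [miss_small] once 2^J
   <= c sqrt n. *)
pose c : R := Num.sqrt (delta ^+ 2 / (Kc * D)).
have c2 : c ^+ 2 = delta ^+ 2 / (Kc * D).
  by rewrite sqr_sqrtr // divr_ge0 ?sqr_ge0 // ltW // mulr_gt0.
have c0 : 0 < c.
  by rewrite sqrtr_gt0; apply: divr_gt0; [exact: exprn_gt0|exact: mulr_gt0].
pose B : R := 2 * (H + rho) + 3.
have B0 : 0 < B by rewrite /B; lra.
(* With a box of side at most [B * s], twice the number of bad sites is then at most (c s / 2)^d,
   and c s / 2 <= 2^J. The 3 in [B] covers the rounding of the side. *)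
pose alpha : R := (c / (2 * B)) ^+ d / 2.
have alpha0 : 0 < alpha by rewrite divr_gt0 // exprn_gt0 // divr_gt0 // mulr_gt0.
have [N HN] := dens alpha alpha0.
(* Once [s] exceeds [a], both [rho * s] and [c * s] are at least 1, so their integer parts are
   positive. *)
pose a : R := rho^-1 + c^-1.
have ri : 0 < rho^-1 by rewrite invr_gt0.
have ci : 0 < c^-1 by rewrite invr_gt0.
have a0 : 0 < a by rewrite addr_gt0.
exists (maxn N (maxn q.+1 (Num.truncn (a ^+ 2)).+1)) => n.
rewrite !geq_max => /and3P[Nn qn an] x xH.
set s : R := Num.sqrt n%:R.
have n0 : (0 < n)%N by exact: leq_trans qn.
have nR : 0 < n%:R :> R by rewrite ltr0n.
have s2 : s ^+ 2 = n%:R by rewrite sqr_sqrtr // ltW.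
have s0 : 0 < s by rewrite sqrtr_gt0.
have sa : a <= s.
  rewrite -(@ler_pXn2r _ 2) ?nnegrE ?(ltW a0) ?(ltW s0) // s2.
  by apply: (le_trans (ltW (truncnS_gt _))); rewrite ler_nat.
have rs : 1 <= rho * s.
  by rewrite mulrC -ler_pdivrMr // mul1r; apply: le_trans sa; rewrite lerDl ltW.
have cs : 1 <= c * s.
  by rewrite mulrC -ler_pdivrMr // mul1r; apply: le_trans sa; rewrite lerDr ltW.
have s1 : 1 <= s.
  by rewrite -(@ler_pXn2r _ 2) ?nnegrE ?ler01 ?(ltW s0) // s2 expr1n ler1n.
pose l := Num.truncn (rho * s).
have /andP[lr rl] : l%:R <= rho * s < l.+1%:R by apply: truncn_itv; lra.
have l0 : (0 < l)%N by rewrite truncn_gt0.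
apply: (le_trans (walk_mean_le_miss x n0 Nn l0 lr)).
rewrite lerD2l; apply: ler_wpM2l; first by rewrite mulr_ge0.
pose T := (n %/ q.+1)%N.
have T0 : (0 < T)%N by rewrite divn_gt0.
pose L := (Num.truncn ((H + rho) * s)).+1.
have Hs0 : 0 <= (H + rho) * s by rewrite mulr_ge0 ?addr_ge0 // ltW.
have LH : (H + rho) * s <= L%:R by exact/ltW/truncnS_gt.
have LB : (L.*2.+1)%:R <= B * s.
  have : (Num.truncn ((H + rho) * s))%:R <= (H + rho) * s by rewrite truncn_le.
  rewrite -mul2n -natr1 natrM /L -natr1 /B; nra.
pose m := Num.truncn (c * s).
have m0 : (0 < m)%N by rewrite truncn_gt0.
have /andP[mc cm] : m%:R <= c * s < m.+1%:R by apply: truncn_itv; lra.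
pose J := trunc_log 2 m.
have /andP[Jm mJ] : (2 ^ J <= m < 2 ^ J.+1)%N by exact: trunc_log_bounds.
have J1 : 2 ^+ J <= c * s by rewrite -natrX; apply: le_trans mc; rewrite ler_nat.
have J2 : c * s <= 2 * 2 ^+ J.
  by rewrite -exprS -natrX; apply: (le_trans (ltW cm)); rewrite ler_nat.
pose S := [fset y in box d L | `[< bad_site w N y >]]%fset.
apply: (@miss_small _ _ w kappa x l T J _ S) => //.
- move=> z zl bz; rewrite !inE /= bz andbT in_box.
  rewrite -(ler_nat R) (le_trans _ LH) // (@le_trans _ _ ((nrm x + l)%:R)) //.
    have h := nrmD (z - x) x; rewrite subrK in h.
    by rewrite ler_nat (leq_trans h) // addnC leq_add2l ltnW.
  rewrite natrD mulrDl lerD //.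
  have Hs : 0 <= H * s by rewrite mulr_ge0 // ltW.
  apply: (@le_trans _ _ (Num.truncn (H * s))%:R); last by rewrite truncn_le.
  rewrite ler_nat; apply/nrmP => i; rewrite truncn_ge_nat //.
  by have := xH i; rewrite -intr_norm -abszE -pmulrn.
- rewrite -(ler_nat R) natrM natrX exprM.
  apply: (@le_trans _ _ (2 * (alpha * (L.*2.+1 ^ d)%:R))).
    by apply: ler_wpM2l => //; exact: HN.
  rewrite /alpha natrX.
  have -> : 2 * ((c / (2 * B)) ^+ d / 2 * (L.*2.+1)%:R ^+ d) =
      (c / (2 * B) * (L.*2.+1)%:R) ^+ d.
    by rewrite [RHS]exprMn mulrA [2 * _]mulrC divfK.
  have cB : 0 <= c / (2 * B) by rewrite divr_ge0 ?(ltW c0) // mulr_ge0 // ltW.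
  rewrite lerXn2r ?nnegrE ?exprn_ge0 //; first by rewrite mulr_ge0.
  apply: (@le_trans _ _ (c / (2 * B) * (B * s))); first exact: ler_wpM2l.
  have -> : c / (2 * B) * (B * s) = c * s / 2 by field; exact: lt0r_neq0.
  by rewrite ler_pdivrMr // [_ * 2]mulrC.
rewrite -/Kc.
have hT : T%:R^-1 <= 2 * q.+1%:R / n%:R :> R.
  rewrite ler_pdivlMr // mulrC ler_pdivrMr ?ltr0n // -!natrM ler_nat.
  apply: (leq_trans (ltnW (ltn_ceil n (ltn0Sn q)))).
  by rewrite -/T mulnAC leq_mul2r /= mul2n -addnn -addn1 leq_add2l T0.
have hl : l%:R^-2 <= 4 / rho ^+ 2 / n%:R.
  have lR : 0 < l%:R :> R by rewrite ltr0n.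
  have -> : 4 / rho ^+ 2 / n%:R = (rho * s / 2) ^- 2.
    by rewrite -s2; field; rewrite ?lt0r_neq0.
  rewrite lef_pV2 ?posrE ?exprn_gt0 //; last by rewrite divr_gt0 // mulr_gt0.
  rewrite lerXn2r ?nnegrE ?(ltW lR) //; first by rewrite divr_ge0 // mulr_ge0 // ltW.
  have : 1 <= l%:R :> R by rewrite ler1n.
  by rewrite -natr1 in rl; lra.
apply: (@le_trans _ _ ((c * s) ^+ 2 * (Kc * (D / n%:R)))).
  apply: ler_pM; rewrite ?exprn_ge0 //.
  - by rewrite mulr_ge0 ?(ltW Kc0) // addr_ge0 // invr_ge0 // exprn_ge0.
  - by rewrite lerXn2r ?nnegrE ?exprn_ge0 // mulr_ge0 // ltW.
  - by rewrite ler_wpM2l ?(ltW Kc0) // /D mulrDl lerD.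
rewrite exprMn c2 s2 le_eqVlt; apply/orP; left; apply/eqP; field.
by rewrite !lt0r_neq0.
Qed.

End uniform_from_density.

(** * Measurability and stationarity in the environment *)

Section environment_measurability.
Variables (R : realType) (d : nat).
Local Notation V := 'rV[int]_d.
Local Notation shift := Defs.shift.

Lemma measurable_invr : measurable_fun setT (fun x : R => x^-1).
Proof.
have -> : [set: R] = [set x | x != 0] `|` [set 0].
  by apply/seteqP; split => // x _; case: (eqVneq x 0) => [->|]; [right|left].
have oD : open [set x : R | x != 0] by exact: open_neq.
apply/measurable_funU; [exact: open_measurable|by []|].
split; last exact: measurable_fun_set1.
apply: open_continuous_measurable_fun => //; move=> x; rewrite inE /= => x0; exact: inv_continuous.
Qed.

(** For fixed [n] this is a rational expression in finitely many conductances, in which values of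
    [f] are mere coefficients; hence [f] is arbitrary. *)
Lemma measurable_pexp n (x : V) f :
  measurable_fun setT (fun w : env R d => pexp w n x f).
Proof.
have mw y s : measurable_fun setT (fun w : env R d => weight w y s).
  exact: measurable_coord.
elim: n x f => [|n IH] x f; first exact: measurable_cst.
apply: measurable_sum => s; apply: measurable_funM; last exact: IH.
apply: measurable_funM => //.
apply: (measurableT_comp measurable_invr); exact: measurable_sum.
Qed.

Lemma kern_shift (w : env R d) x y s : kern (shift x w) y s = kern w (x + y) s.
Proof.
have E t : weight (shift x w) y t = weight w (x + y) t.
  by rewrite /weight /shift; case: t => i [] /=; rewrite ?addrA.
by rewrite /kern E; congr (_ / _); apply: eq_bigr => t _; exact: E.
Qed.

Lemma pexp_shift (w : env R d) n x y f :
  pexp (shift x w) n y f = pexp w n (x + y) (fun u => f (fun k => u k - x)).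
Proof.
elim: n y f => [|n IH] y f /=.
  by congr f; apply/funext => k; rewrite addrC addKr.
apply: eq_bigr => s _; rewrite kern_shift IH addrA; congr (_ * pexp _ _ _ _).
apply/funext => u; congr f; apply/funext => -[|k] //=.
by rewrite addrC addKr.
Qed.

Lemma walk_mean_shift (w : env R d) F n x :
  walk_mean (shift x w) F n 0 = walk_mean w F n x.
Proof.
rewrite /walk_mean pexp_shift addr0; congr pexp; apply/funext => u.
rewrite -[centred R n u](centred_shift R n (- x)); congr (F (centred _ _ _)).
by apply/funext => k; rewrite addrC.
Qed.

Variable P : probability (env R d) R.
Hypothesis P_stationary : stationary P.

Lemma ae_shift (Q : env R d -> Prop) :
  {ae P, forall w, Q w} -> {ae P, forall w, forall x, Q (shift x w)}.
Proof.
move=> [N [mN PN NQ]].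
have : {ae P, forall w, forall k, if choice.unpickle k is Some x then Q (shift x w) else True}.
  apply: ae_foralln => k; case: (choice.unpickle k) => [x|]; last exact: aeW.
  exists (shift x @^-1` N); split.
  - exact: measurable_shift_set.
  - exact: etrans (P_stationary x mN) PN.
  - by move=> w /= nQ; exact: NQ.
apply: filterS => w Hw x; have := Hw (choice.pickle x).
by rewrite choice.pickleK.
Qed.

(** Every edge is a shift of an edge at the origin, and the countably many shifts cost one null
    set. *)
Lemma ae_elliptic : condition_UE P -> exists2 kappa : R, 0 < kappa &
  {ae P, forall w, forall b, kappa <= w b <= kappa^-1}.
Proof.
move=> [kappa k0 H]; exists kappa => //; have := ae_shift H.
apply: filterS => w Hw [x i].
have h : nbr 0 (0 + step (i, true)) by apply/nbrP; exists (i, true).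
have := Hw x _ h; rewrite cond_step /weight /shift /= addr0.
by move=> /andP[/ltW -> /ltW ->].
Qed.

End environment_measurability.

Section quenched_means.
Variables (R : realType) (d : nat).
Hypothesis d_gt0 : (0 < d)%N.
Local Notation C := (C01 R d).
Local Notation V := 'rV[int]_d.
Local Notation shift := Defs.shift.
Variables (dX : measure_display) (TX : measurableType dX).
Variables (X : nat -> TX -> V) (Pq : env R d -> probability TX R).
Hypothesis X_walk : is_quenched_walk X Pq.
Variables (w : env R d) (kappa : R).
Hypothesis kappa_gt0 : 0 < kappa.
Hypothesis w_bnd : forall b, kappa <= w b <= kappa^-1.

Let w_gt0 b : 0 < w b.
Proof. by have /andP[/(lt_le_trans kappa_gt0)] := w_bnd b. Qed.

Let walk x : is_walk (shift x w) (Pq (shift x w)) X.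
Proof.
have sw b : 0 < shift x w b by exact: w_gt0.
apply: X_walk => [b|y]; first exact: ltW (sw b).
by rewrite total_cond_sum; exact: weight_sum_gt0.
Qed.

(** The walk from 0 in the shifted environment is the walk from [x] in [w] after a translation,
    which [centred] does not see. *)
Lemma expectation_quenched F M n x : (forall f : C, `|F f| <= M) ->
  ('E_(Pq (shift x w))[F \o Z R X n] = (walk_mean w F n x)%:E)%E.
Proof.
move=> FM; have [mX _ _] := walk x.
have dF : depends n.+1 (fun u => F (rescaled R n u)).
  by move=> u u' uu'; rewrite (rescaled_depends R uu').
have sw b : 0 < shift x w b by exact: w_gt0.
rewrite (expectation_walk mX sw d_gt0 (walk x) dF (fun u => FM _)).
rewrite -walk_mean_shift /walk_mean; congr (_%:E).
apply: (eq_pexp sw d_gt0) => u u0; congr F; rewrite /centred u0; congr rescaled.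
by apply/funext => k; rewrite subr0.
Qed.

Lemma measurable_Z n (B : set C) : measurable (Z R X n @^-1` B).
Proof.
have [mX _ _] := walk 0.
apply: (measurable_path_event mX (k := n.+1) (D := fun u => B (rescaled R n u))).
by move=> u u' uu'; rewrite (rescaled_depends R uu').
Qed.

Lemma probability_quenched n x (B : set C) :
  (Pq (shift x w) (Z R X n @^-1` B) = (walk_mean w (\1_B) n x)%:E)%E.
Proof.
rewrite -(@expectation_quenched _ 1); last first.
  by move=> f; rewrite indicE; case: (_ \in _); rewrite ?normr1 ?normr0.
by rewrite -(expectation_indic _ (measurable_Z n B)).
Qed.

End quenched_means.

(** * Means under the limit and uniform convergence in a fixed environment *)

Section limit_law.
Variables (R : realType) (d : nat).
Hypothesis d_gt0 : (0 < d)%N.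
Local Notation C := (C01 R d).
Local Notation V := 'rV[int]_d.
Local Notation shift := Defs.shift.
Variables (dW : measure_display) (TW : measurableType dW).
Variables (PW : probability TW R) (W : TW -> C).
Hypothesis mW : measurable_fun setT W.

Lemma bmeas_limit (F : C -> R) (M : R) : continuous F -> (forall f : C, `|F f| <= M) ->
  bmeas (fun a => F (W a)).
Proof.
move=> cF FM; split; last by exists M => a; exact: FM.
exact: (measurableT_comp (measurable_continuous cF) mW).
Qed.

Definition limit_mean (F : C -> R) : R := Er PW (fun a => F (W a)).

Lemma limit_mean_bnd (F : C -> R) (M : R) : continuous F -> (forall f : C, `|F f| <= M) ->
  `|limit_mean F| <= M.
Proof.
move=> cF FM; have bF := bmeas_limit cF FM.
rewrite ler_norml; apply/andP; split.
  rewrite -[leLHS](Er_cst PW); apply: le_Er => // [|a]; first exact: bmeas_cst.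
  by have := FM (W a); rewrite ler_norml => /andP[].
rewrite -[leRHS](Er_cst PW); apply: le_Er => // [|a]; first exact: bmeas_cst.
by have := FM (W a); rewrite ler_norml => /andP[].
Qed.

Lemma lipschitz_continuous K (F : C -> R) : 0 <= K -> lipschitzC K F -> continuous F.
Proof.
by move=> K0 lF; exact/unif_continuous_continuous/(lipschitz_unif K0 lF).
Qed.

Lemma norm01 (G : C -> R) : (forall f, 0 <= G f <= 1) -> forall f, `|G f| <= 1.
Proof. by move=> H f; have /andP[g0 g1] := H f; rewrite ger0_norm. Qed.

(** The paths of [W] are continuous, so their moduli tend to 0 and bounded convergence applies; the
    resulting [q] fixes the time allowed for a restart. *)
Lemma modulus_limit (e : R) : 0 < e -> exists q, limit_mean (modulus q) < e.
Proof.
move=> e0; have bnd q f := norm01 (@modulus_bnd R d q) f.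
have cm q : continuous (@modulus R d q).
  by apply: lipschitz_continuous (modulus_lip q).
have c : limit_mean (modulus q) @[q --> \oo] --> (0 : R).
  rewrite -(Er_cst PW 0); apply: (cvg_Er (M := 1)).
  - by move=> q; have [] := bmeas_limit (cm q) (bnd q).
  - by move=> q a; exact: bnd.
  - by move=> a; exact: modulus_cvg.
have /cvgrPdist_lt /(_ e e0) [q _ Hq] := c.
exists q; have := Hq q (leqnn _); rewrite sub0r normrN.
exact: le_lt_trans (ler_norm _).
Qed.

Lemma limit_set_cvg (B : set C) (e : R) : closed B -> measurable (W @^-1` B) -> 0 < e ->
  exists k, limit_mean (near_set B k) < fine (PW (W @^-1` B)) + e.
Proof.
move=> cB mB e0; have bnd k f := norm01 (near_set_bnd B k) f.
have ck k : continuous (near_set B k).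
  by apply: lipschitz_continuous (near_set_lip B k).
have c : limit_mean (near_set B k) @[k --> \oo] --> fine (PW (W @^-1` B)).
  rewrite -Er_indic //; apply: (cvg_Er (M := 1)).
  - by move=> k; have [] := bmeas_limit (ck k) (bnd k).
  - by move=> k a; exact: bnd.
  - by move=> a; exact: near_set_cvg.
have /cvgrPdist_lt /(_ e e0) [k _ Hk] := c.
exists k; have := Hk k (leqnn _); rewrite distrC -ltrBlDl.
exact: le_lt_trans (ler_norm _).
Qed.

Section fixed_environment.
Variables (w : env R d) (kappa : R).
Hypothesis kappa_gt0 : 0 < kappa.
Hypothesis w_bnd : forall b, kappa <= w b <= kappa^-1.

Let w_gt0 b : 0 < w b.
Proof. by have /andP[/(lt_le_trans kappa_gt0)] := w_bnd b. Qed.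

Lemma walk_meanD F G n x : walk_mean w (fun f => F f + G f) n x =
  walk_mean w F n x + walk_mean w G n x.
Proof. exact: pexpD. Qed.

Lemma walk_meanZ c F n x : walk_mean w (fun f => c * F f) n x =
  c * walk_mean w F n x.
Proof. exact: pexpZ. Qed.

Lemma walk_mean_cst c n x : walk_mean w (fun=> c) n x = c.
Proof. exact: (pexp_cst w_gt0 d_gt0). Qed.

Lemma le_walk_mean F G n x : (forall f, F f <= G f) ->
  walk_mean w F n x <= walk_mean w G n x.
Proof. by move=> FG; apply: (le_pexp w_gt0 d_gt0) => u _; exact: FG. Qed.

Definition uniform_cvg (F : C -> R) : Prop := forall H e : R, 0 < H -> 0 < e ->
  exists N, forall n, (N <= n)%N -> forall x, cube H n x ->
    `|walk_mean w F n x - limit_mean F| <= e.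

Definition bcont (F : C -> R) : Prop :=
  continuous F /\ exists M, forall f, `|F f| <= M.

Lemma bcont_bmeas F : bcont F -> bmeas (fun a => F (W a)).
Proof. by case=> cF [M FM]; exact: bmeas_limit cF FM. Qed.

Lemma bcont_cst c : bcont (fun=> c).
Proof.
split; last by exists `|c|.
apply: (@lipschitz_continuous 0) => // f g.
by rewrite subrr normr0 mul0r.
Qed.

Lemma bcontD F G : bcont F -> bcont G -> bcont (fun f => F f + G f).
Proof.
move=> [cF [M FM]] [cG [M' GM]]; split; first by move=> f; exact: (@continuousD _ _ C F G f (cF f) (cG f)).
by exists (M + M') => f; rewrite (le_trans (ler_normD _ _)) // lerD.
Qed.

Lemma bcontZ c F : bcont F -> bcont (fun f => c * F f).
Proof.
move=> [cF [M FM]]; split; first by move=> f;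
  exact: (@continuousM _ C (fun=> c) F f ((bcont_cst c).1 f) (cF f)).
by exists (`|c| * M) => f; rewrite normrM ler_wpM2l.
Qed.

Lemma uniform_cvgD F G : bcont F -> bcont G -> uniform_cvg F -> uniform_cvg G ->
  uniform_cvg (fun f => F f + G f).
Proof.
move=> bF bG uF uG H e H0 e0; have e2 : 0 < e / 2 by rewrite divr_gt0.
have [N HN] := uF H _ H0 e2; have [N' HN'] := uG H _ H0 e2.
exists (maxn N N') => n; rewrite geq_max => /andP[nN nN'] x xH.
rewrite walk_meanD /limit_mean (ErD PW (bcont_bmeas bF) (bcont_bmeas bG)) opprD addrACA.
by rewrite [e]splitr (le_trans (ler_normD _ _)) // lerD ?HN ?HN'.
Qed.

Lemma uniform_cvgZ c F : bcont F -> uniform_cvg F -> uniform_cvg (fun f => c * F f).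
Proof.
move=> bF uF H e H0 e0; have c0 : 0 < `|c| + 1 by rewrite ltr_wpDl.
have [N HN] := uF H _ H0 (divr_gt0 e0 c0).
exists N => n nN x xH; rewrite walk_meanZ /limit_mean (ErZ PW c (bcont_bmeas bF)).
rewrite -mulrBr normrM.
apply: (le_trans (ler_wpM2l (normr_ge0 c) (HN n nN x xH))).
by rewrite mulrCA ler_piMr ?(ltW e0) // ler_pdivrMr // mul1r lerDl.
Qed.

Lemma uniform_cvg_sum J (c : nat -> R) (G : nat -> C -> R) :
  (forall j, bcont (G j)) -> (forall j, uniform_cvg (G j)) ->
  bcont (fun f => \sum_(j < J) c j * G j f) /\
  uniform_cvg (fun f => \sum_(j < J) c j * G j f).
Proof.
move=> bG uG; elim: J => [|J [bS uS]].
  under eq_fun do rewrite big_ord0; split; first exact: bcont_cst.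
  move=> H e H0 e0; exists 0%N => n _ x _.
  by rewrite walk_mean_cst /limit_mean Er_cst subrr normr0 ltW.
under eq_fun do rewrite big_ord_recr /=.
by split; [apply: bcontD => //; exact: bcontZ|
  apply: uniform_cvgD => //; [exact: bcontZ|exact: uniform_cvgZ]].
Qed.

(** The error term of [hat_approx] is itself built from a test function: for large [J] the mean of 1
    - [hat q J] is small under the limit, and convergence for [hat q J] transfers this to the walk
    uniformly in the starting point. This takes the place of tightness. *)
Lemma uniform_cvg_unif (F : C -> R) (M : R) : (forall q J, uniform_cvg (hat q J)) ->
  unif_continuous F -> (forall f, `|F f| <= M) -> uniform_cvg F.
Proof.
move=> uhat uF FM H e H0 e0.
have M0 : 0 <= M by exact: le_trans (FM (cst 0)).
have e8 : 0 < e / 8 by rewrite divr_gt0.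
have [q Hq] := hat_approx uF FM e8.
have bh J : bcont (hat q J).
  split; first by apply: lipschitz_continuous (@hat_lip R d q J).
  by exists 1; exact: norm01 (hat_bnd q J).
have M1 : 0 < M + 1 by rewrite ltr_wpDl.
have eM : 0 < e / 8 / (M + 1) by rewrite divr_gt0.
have EM : (M + 1) * (e / 8 / (M + 1)) = e / 8 by rewrite mulrC divfK ?lt0r_neq0.
have [J HJ] : exists J, 1 - limit_mean (hat q J) < e / 8 / (M + 1).
  have c : limit_mean (hat q J) @[J --> \oo] --> (1 : R).
    rewrite -(Er_cst PW 1); apply: (cvg_Er (M := 1)).
    - by move=> J; have [] := bcont_bmeas (bh J).
    - by move=> J a; exact: norm01 (hat_bnd q J) _.
    - by move=> a; exact: hat_cvg.
  have /cvgrPdist_lt /(_ _ eM) [J _ HJ] := c; exists J.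
  by have := HJ J (leqnn _); exact: le_lt_trans (ler_norm _).
pose G (f : C) : R := \sum_(j < J) F (dense_path R d j) * (hat q j.+1 f - hat q j f).
have bdiff j : bcont (fun f => hat q j.+1 f - hat q j f).
  by under eq_fun do rewrite -mulN1r; apply: bcontD => //; exact: bcontZ.
have udiff j : uniform_cvg (fun f => hat q j.+1 f - hat q j f).
  under eq_fun do rewrite -mulN1r; apply: uniform_cvgD => //; first exact: bcontZ.
  exact: uniform_cvgZ.
have [bG uG] := uniform_cvg_sum J (fun j => F (dense_path R d j)) bdiff udiff.
have bF : bcont F by split; [exact: unif_continuous_continuous|exists M].
have bE : bcont (fun f => e / 8 + M * (1 - hat q J f)).
  under eq_fun do rewrite -mulN1r.
  apply: bcontD; first exact: bcont_cst.
  by apply: bcontZ; apply: bcontD; [exact: bcont_cst|exact: bcontZ].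
have up f : F f <= G f + (e / 8 + M * (1 - hat q J f)).
  by have := Hq J f; rewrite ler_norml -/(G f) => /andP[_]; rewrite lerBlDl.
have dn f : G f <= F f + (e / 8 + M * (1 - hat q J f)).
  by have := Hq J f; rewrite ler_norml -/(G f) => /andP[+ _]; lra.
have limE : limit_mean (fun f => e / 8 + M * (1 - hat q J f)) <= e / 4.
  have bc c := @bmeas_cst _ TW R c; have bhW := bcont_bmeas (bh J).
  have b1 := bmeasB (bc 1) bhW.
  rewrite /limit_mean (ErD PW (bc _) (bmeasZ M b1)) (ErZ PW M b1) (ErB PW (bc 1) bhW).
  rewrite !Er_cst -/(limit_mean _).
  have : M * (1 - limit_mean (hat q J)) <= (M + 1) * (e / 8 / (M + 1)).
    apply: (@le_trans _ _ (M * (e / 8 / (M + 1)))); first by rewrite ler_wpM2l // ltW.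
    by rewrite ler_wpM2r ?(ltW eM) // lerDl.
  by rewrite EM; lra.
have [N1 HN1] := uG H _ H0 e8; have [N2 HN2] := uhat q J H _ H0 eM.
exists (maxn N1 N2) => n; rewrite geq_max => /andP[n1 n2] x xH.
have {HN1} := HN1 n n1 x xH; have {HN2} := HN2 n n2 x xH.
rewrite -[fun f => \sum_(j < J) _]/G.
set wh := walk_mean w (hat q J) n x; set wG := walk_mean w G n x.
move=> hwh hwG.
have wE : walk_mean w (fun f => e / 8 + M * (1 - hat q J f)) n x <= 3 * (e / 8).
  rewrite walk_meanD walk_mean_cst walk_meanZ.
  rewrite (_ : walk_mean w (fun f => 1 - hat q J f) n x = 1 - wh); last first.
    rewrite -(mulN1r wh) -walk_meanZ -{2}(walk_mean_cst 1 n x) -walk_meanD.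
    by congr walk_mean; apply/funext => f; rewrite mulN1r.
  have h1 : 1 - wh <= 2 * (e / 8 / (M + 1)).
    by move: hwh; rewrite ler_norml => /andP[]; lra.
  have : M * (1 - wh) <= (M + 1) * (2 * (e / 8 / (M + 1))).
    apply: (@le_trans _ _ (M * (2 * (e / 8 / (M + 1))))); first by rewrite ler_wpM2l.
    by rewrite ler_wpM2r ?lerDl // mulr_ge0 // ltW.
  by rewrite [(M + 1) * _]mulrCA EM; lra.
have w1 := le_walk_mean n x up; have w2 := le_walk_mean n x dn.
rewrite (walk_meanD G) in w1; rewrite (walk_meanD F) in w2.
pose E (f : C) : R := e / 8 + M * (1 - hat q J f).
have l1 : limit_mean F <= limit_mean G + limit_mean E.
  rewrite -[leRHS](ErD PW (bcont_bmeas bG) (bcont_bmeas bE)).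
  exact: (le_Er PW (bcont_bmeas bF) (bcont_bmeas (bcontD bG bE)) (fun a => up (W a))).
have l2 : limit_mean G <= limit_mean F + limit_mean E.
  rewrite -[leRHS](ErD PW (bcont_bmeas bF) (bcont_bmeas bE)).
  exact: (le_Er PW (bcont_bmeas bG) (bcont_bmeas (bcontD bF bE)) (fun a => dn (W a))).
rewrite -/E in w1 w2 wE limE; rewrite -/wG in w1 w2.
move: hwG; rewrite !ler_norml -/wG => /andP[? ?].
by apply/andP; split; lra.
Qed.

End fixed_environment.
End limit_law.

(** * Almost sure uniform convergence for uniformly continuous functions *)

Section uniform_invariance.
Variables (R : realType) (d : nat).
Hypothesis d_gt0 : (0 < d)%N.
Local Notation C := (C01 R d).
Local Notation V := 'rV[int]_d.
Local Notation shift := Defs.shift.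
Variable P : probability (env R d) R.
Hypothesis P_stationary : stationary P.
Hypothesis P_UE : condition_UE P.
Variables (dX : measure_display) (TX : measurableType dX).
Variables (X : nat -> TX -> V) (Pq : env R d -> probability TX R).
Hypothesis X_walk : is_quenched_walk X Pq.
Variables (dW : measure_display) (TW : measurableType dW).
Variables (PW : probability TW R) (W : TW -> C).
Hypothesis mW : measurable_fun setT W.
Hypothesis CLT : quenched_CLT P X Pq PW W.

Lemma bounded_funP (F : C -> R) M : (forall f, `|F f| <= M) -> bounded_fun F.
Proof.
move=> FM; exists M; split; first by rewrite num_real.
by move=> M' MM' f _; exact: le_trans (FM f) (ltW MM').
Qed.

(** The quenched CLT is applied at the origin, to [F] and to one modulus for each tolerance [e k],
    and shows that the origin is eventually good. By [walk_mean_shift] the visits of the orbit to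
    [A k N] are the bad sites of the environment, so [dense_density] feeds
    [uniform_from_density]. *)
Lemma ae_uniform_lipschitz (F : C -> R) (K M : R) : 0 <= K -> lipschitzC K F ->
  (forall f, `|F f| <= M) -> {ae P, forall w, uniform_cvg PW W w F}.
Proof.
move=> K0 lF FM.
have cF : continuous F by exact: lipschitz_continuous lF.
have [kappa k0 ell] := ae_elliptic P_stationary P_UE.
pose e (k : nat) : R := k.+1%:R^-1.
have e0 k : 0 < e k by rewrite invr_gt0 ltr0n.
have /choice[q Hq] k : exists q, limit_mean PW W (modulus q) < e k.
  exact: modulus_limit.
pose mu := limit_mean PW W F.
have mu_bnd : `|mu| <= M by exact: limit_mean_bnd.
pose A k N : set (env R d) := [set w | bad_site F mu (e k) (q k) w N 0].
have cm j : continuous (@modulus R d j).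
  by apply: lipschitz_continuous (modulus_lip j).
have bm j f := norm01 (@modulus_bnd R d j) f.
have mA k N : measurable (A k N).
  have -> : A k N = \bigcup_(n in [set n | (N <= n)%N])
      ([set w | e k < `|walk_mean w F n 0 - mu|] `|`
       [set w | e k < walk_mean w (modulus (q k)) n 0]).
    by apply/seteqP; split => w [n Nn H]; exists n.
  apply: bigcup_measurable => n _; apply: measurableU.
    rewrite -[X in measurable X]setTI; apply: measurable_fun_ltr => //.
    apply: measurableT_comp => //; apply: measurable_funB => //.
    exact: measurable_pexp.
  rewrite -[X in measurable X]setTI; apply: measurable_fun_ltr => //.
  exact: measurable_pexp.
have nA k : nonincreasing_seq (A k).
  by move=> N N' NN'; apply/subsetPset => w [n N'n H]; exists n => //; exact: leq_trans N'n.
have ae0 : {ae P, forall w, forall k, exists N, ~ A k N w}.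
  apply: (@filterS2 _ _ (ae_filter_ringOfSetsType P) _ _ _ _ ell CLT) => w w_bnd Hw k.
  have key G M' : continuous G -> (forall f, `|G f| <= M') ->
      walk_mean w G n 0 @[n --> \oo] --> limit_mean PW W G.
    move=> cG GM; have := Hw G (bounded_funP GM) cG.
    rewrite (ErE PW (bmeas_limit mW cG GM)) => /fine_cvg.
    have -> // : fine \o (fun n => 'E_(Pq w)[G \o Z R X n])%E = walk_mean w G ^~ 0.
    apply/funext => n /=.
    have := expectation_quenched d_gt0 X_walk k0 w_bnd n 0 GM.
    have -> : shift 0 w = w by apply/funext => b; rewrite /shift add0r -surjective_pairing.
    by move=> ->.
  have c1 := key _ _ cF FM; have c2 := key _ _ (cm (q k)) (bm (q k)).
  have /cvgrPdist_lt /(_ _ (e0 k)) [N1 _ HN1] := c1.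
  have /cvgr_lt /(_ _ (Hq k)) [N2 _ HN2] := c2.
  exists (maxn N1 N2) => -[n]; rewrite geq_max => /andP[n1 n2] [|].
    by apply/negP; rewrite -leNgt distrC ltW //; exact: HN1.
  by apply/negP; rewrite -leNgt ltW //; exact: HN2.
have PA0 k : P (\bigcap_N A k N) = 0%E.
  case: ae0 => N [mN PN NH]; apply/eqP; rewrite eq_le measure_ge0 andbT -PN.
  apply: le_measure; rewrite ?inE //; first exact: bigcapT_measurable.
  move=> w /= Aw; apply: NH => /= H; have [n] := H k; apply; exact: Aw.
have dens : {ae P, forall w, forall k, forall alpha : R, 0 < alpha -> exists N, forall L,
    visits (A k N) L w <= alpha * (L.*2.+1 ^ d)%:R}.
  by apply: ae_foralln => k; exact: dense_density.
apply: (@filterS2 _ _ (ae_filter_ringOfSetsType P) _ _ _ _ ell dens) => w w_bnd Hw H eps H0 eps0.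
have M0 : 0 <= M by exact: le_trans mu_bnd.
have K1 : 0 < K + 1 by rewrite ltr_wpDl.
have M1 : 0 < M + 1 by rewrite ltr_wpDl.
(* Together with [e k <= rho], these choices keep the total error below 5/8 of [eps]; the added 1
   excludes division by 0. *)
pose rho := eps / 8 / (K + 1); pose delta := eps / 8 / (M + 1).
have rho0 : 0 < rho by rewrite !divr_gt0.
have delta0 : 0 < delta by rewrite !divr_gt0.
have [k hk] : exists k, e k <= rho.
  exists (Num.truncn rho^-1); rewrite -[leRHS]invrK lef_pV2 ?posrE ?invr_gt0 ?ltr0n //.
  by rewrite ltW // truncnS_gt.
have Hd (alpha : R) : 0 < alpha -> exists N, forall L,
    #|` [fset y in box d L | `[< bad_site F mu (e k) (q k) w N y >]]%fset|%:R <=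
      alpha * (L.*2.+1 ^ d)%:R.
  move=> a0; have [N HN] := Hw k alpha a0; exists N => L.
  apply: le_trans (HN L).
  have -> : visits (A k N) L w = visits (A k N) L (shift 0 w).
    by congr visits; apply/funext => b; rewrite /shift add0r -surjective_pairing.
  rewrite visitsE ler_nat; apply: card_filter_le => y /asboolP[n Nn Hb].
  apply/asboolP; exists n; first exact: Nn.
  rewrite add0r (walk_mean_shift w F n y) (walk_mean_shift w (modulus (q k)) n y).
  exact: Hb.
have [N0 HN0] := uniform_from_density k0 w_bnd d_gt0 lF FM mu_bnd K0 (ltW (e0 k)) Hd
  H0 rho0 delta0.
exists N0 => n Nn x xH; apply: (le_trans (HN0 n Nn x xH)).
have h1 : (K + 1) * rho = eps / 8 by rewrite /rho mulrC divfK ?lt0r_neq0.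
have h2 : (M + 1) * delta = eps / 8 by rewrite /delta mulrC divfK ?lt0r_neq0.
have h3 : K * e k <= K * rho by rewrite ler_wpM2l.
have h4 : 0 < e k by [].
nra.
Qed.

Lemma ae_uniform : {ae P, forall w, forall F : C -> R, unif_continuous F ->
  bounded_fun F -> uniform_cvg PW W w F}.
Proof.
have [kappa k0 ell] := ae_elliptic P_stationary P_UE.
have hats : {ae P, forall w, forall q J, uniform_cvg PW W w (hat q J)}.
  apply: ae_foralln => q; apply: ae_foralln => J.
  by apply: ae_uniform_lipschitz (@hat_lip R d q J) (norm01 (hat_bnd q J)).
apply: (@filterS2 _ _ (ae_filter_ringOfSetsType P) _ _ _ _ ell hats) => w w_bnd Hw F uF [M [_ FM]].
apply: (uniform_cvg_unif d_gt0 mW k0 w_bnd (M := M + 1) Hw uF) => f.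
by apply: FM => //; rewrite ltrDl.
Qed.

End uniform_invariance.

(** * Portmanteau arguments uniform in the starting point *)

Section portmanteau.
Variables (R : realType) (d : nat).
Hypothesis d_gt0 : (0 < d)%N.
Local Notation C := (C01 R d).
Local Notation V := 'rV[int]_d.
Variables (dW : measure_display) (TW : measurableType dW).
Variables (PW : probability TW R) (W : TW -> C).
Hypothesis mW : measurable_fun setT W.
Variables (w : env R d) (kappa : R).
Hypothesis kappa_gt0 : 0 < kappa.
Hypothesis w_bnd : forall b, kappa <= w b <= kappa^-1.
Hypothesis uniform : forall F : C -> R, unif_continuous F -> bounded_fun F ->
  uniform_cvg PW W w F.

Lemma measurable_limit_open (G : set C) : open G -> measurable (W @^-1` G).
Proof.
move=> oG; rewrite -[X in measurable X]setTI; apply: mW => //.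
exact: sub_sigma_algebra.
Qed.

Lemma measurable_limit_closed (B : set C) : closed B -> measurable (W @^-1` B).
Proof.
move=> cB; rewrite -[B]setCK -preimage_setC; apply: measurableC.
exact/measurable_limit_open/closed_openC.
Qed.

Lemma closed_upper (B : set C) (H e : R) : closed B -> 0 < H -> 0 < e ->
  exists N, forall n, (N <= n)%N -> forall x, cube H n x ->
    walk_mean w (\1_B) n x <= fine (PW (W @^-1` B)) + e.
Proof.
move=> cB H0 e0; have e2 : 0 < e / 2 by rewrite divr_gt0.
have [k Hk] := limit_set_cvg PW mW cB (measurable_limit_closed cB) e2.
have bnd f := norm01 (near_set_bnd B k) f.
have uB := lipschitz_unif (ler0n R k) (near_set_lip B k).
have [N HN] := uniform uB (bounded_funP bnd) H0 e2.
exists N => n Nn x xH.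
have le1 : walk_mean w (\1_B) n x <= walk_mean w (near_set B k) n x.
  apply: (le_walk_mean d_gt0 kappa_gt0 w_bnd) => f; rewrite indicE.
  have [/set_mem Bf|_] := boolP (f \in B); first by rewrite near_set_in.
  by have /andP[] := near_set_bnd B k f.
by have := HN n Nn x xH; rewrite ler_norml => /andP[_]; lra.
Qed.

Lemma sum_lt_ord k m : (m <= k)%N -> \sum_(i < k) ((i < m)%N : nat)%:R = m%:R :> R.
Proof.
move=> mk; rewrite -natr_sum; congr (_%:R); elim: k mk => [|k IH].
  by rewrite leqn0 big_ord0 => /eqP.
rewrite leq_eqVlt big_ord_recr /= => /predU1P[->|mk].
  rewrite (eq_bigr (fun=> 1%N)) => [|i _]; last by rewrite ltnW // ltnS ltn_ord.
  by rewrite sum_nat_const card_ord muln1 ltnSn addn1.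
by rewrite IH // ltnNge -ltnS mk addn0.
Qed.

(* Sandwich of a function with values in [0, 1] between two step functions built
   on its closed superlevel sets. *)
Lemma unit_upper (G : C -> R) (H e : R) : continuous G ->
  (forall f, 0 <= G f <= 1) -> 0 < H -> 0 < e ->
  exists N, forall n, (N <= n)%N -> forall x, cube H n x ->
    walk_mean w G n x <= limit_mean PW W G + e.
Proof.
move=> cG G01 H0 e0; have e2 : 0 < e / 2 by rewrite divr_gt0.
have [k hk] : exists k, k.+1%:R^-1 <= e / 2.
  exists (Num.truncn (e / 2)^-1); rewrite -[leRHS]invrK lef_pV2 ?posrE ?invr_gt0 ?ltr0n //.
  by rewrite ltW // truncnS_gt.
set K := k.+1 in hk; have K0 : 0 < K%:R :> R by rewrite ltr0n.
pose B i : set C := [set f | i.+1%:R <= K%:R * G f].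
have cB i : closed (B i).
  have -> : B i = (fun f => K%:R * G f) @^-1` [set y | i.+1%:R <= y] by [].
  have bG : bcont G by split => //; exists 1; exact: norm01.
  apply: (preimage_closed _ (@closed_ge _ _)) => f _; exact: (bcontZ K%:R bG).1.
(* The number of superlevel sets that contain [f] is an integer part, so the sum divided by [K] lies
   below [G] by at most 1 / K. *)
have step f : \sum_(i < K) \1_(B i) f = (Num.truncn (K%:R * G f))%:R :> R.
  have /andP[g0 g1] := G01 f; have Kg : 0 <= K%:R * G f by rewrite mulr_ge0.
  rewrite -(@sum_lt_ord K); last first.
    by rewrite -(ler_nat R) (@le_trans _ _ (K%:R * G f)) ?truncn_le // ler_piMr.
  apply: eq_bigr => i _; rewrite indicE truncn_ge_nat //; congr (nat_of_bool _)%:R.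
  by apply/idP/idP => [/set_mem|H']; [|exact: mem_set].
have mB i : measurable (W @^-1` B i) by exact: measurable_limit_closed.
have /choice[N HN] i : exists N, forall n, (N <= n)%N -> forall x, cube H n x ->
    walk_mean w (\1_(B i)) n x <= fine (PW (W @^-1` B i)) + e / 2.
  exact: closed_upper.
exists (\max_(i < K) N i)%N => n Nn x xH.
have w_gt0 b : 0 < w b by have /andP[/(lt_le_trans kappa_gt0)] := w_bnd b.
have sumE (m : nat) : walk_mean w (fun f => \sum_(i < m) \1_(B i) f) n x =
    \sum_(i < m) walk_mean w (\1_(B i)) n x.
  elim: m => [|m IH].
    under eq_fun do rewrite big_ord0; rewrite big_ord0.
    exact: (walk_mean_cst d_gt0 kappa_gt0 w_bnd).
  by under eq_fun do rewrite big_ord_recr /=; rewrite walk_meanD IH big_ord_recr.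
have h1 : walk_mean w G n x <= K%:R^-1 + K%:R^-1 *
    \sum_(i < K) (fine (PW (W @^-1` B i)) + e / 2).
  apply: (@le_trans _ _ (walk_mean w (fun f => K%:R^-1 + K%:R^-1 * \sum_(i < K) \1_(B i) f) n x)).
    apply: (le_walk_mean d_gt0 kappa_gt0 w_bnd) => f; rewrite step.
    have /andP[g0 _] := G01 f; have Kg : 0 <= K%:R * G f by rewrite mulr_ge0.
    have /andP[_ hs] := truncn_itv Kg; rewrite -natr1 in hs.
    rewrite -(ler_pM2l K0) mulrDr mulVKf ?lt0r_neq0 // mulfV ?lt0r_neq0 //.
    by rewrite addrC ltW.
  rewrite walk_meanD walk_meanZ (walk_mean_cst d_gt0 kappa_gt0 w_bnd) lerD2l.
  rewrite ler_wpM2l ?invr_ge0 ?(ltW K0) // sumE; apply: ler_sum => i _.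
  by apply: HN => //; apply: leq_trans Nn; exact: leq_bigmax.
have h2 : K%:R^-1 * \sum_(i < K) fine (PW (W @^-1` B i)) <= limit_mean PW W G.
  rewrite (eq_bigr (fun i : 'I_K => Er PW (\1_(W @^-1` B i)))); last first.
    by move=> i _; rewrite Er_indic.
  have bi i : bmeas (\1_(W @^-1` B i) : TW -> R) by exact: bmeas_indic.
  rewrite -(Er_sum PW _ (fun i : 'I_K => bi i)) -ErZ; last by apply: bmeas_sum => i; exact: bi.
  apply: le_Er.
  - by apply: bmeasZ; apply: bmeas_sum => i; exact: bi.
  - exact: bmeas_limit cG (norm01 G01).
  move=> a; have -> : \sum_(i < K) \1_(W @^-1` B i) a = \sum_(i < K) \1_(B i) (W a) :> R.
    by apply: eq_bigr => i _; rewrite !indicE.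
  have /andP[g0 _] := G01 (W a).
  by rewrite step mulrC ler_pdivrMr // mulrC truncn_le mulr_ge0.
apply: (le_trans h1); rewrite big_split /= sumr_const card_ord mulrDr.
have -> : K%:R^-1 * (e / 2 *+ K) = e / 2.
  by rewrite -[X in _ * X]mulr_natl mulKf // lt0r_neq0.
lra.
Qed.

Lemma bounded_uniform (F : C -> R) : continuous F -> bounded_fun F -> uniform_cvg PW W w F.
Proof.
move=> cF [M0 [_ FM0]].
pose M : R := `|M0| + 1; have M1 : 0 < M by rewrite ltr_wpDl.
have FM f : `|F f| <= M by apply: FM0 => //; rewrite (le_lt_trans (ler_norm _)) // ltrDl.
(* The signs 1 and -1 give the two sides of the estimate; [c * s * F + 1/2] has values in [0, 1], as
   [unit_upper] demands. *)
have half (s : R) : `|s| = 1 -> forall H e : R, 0 < H -> 0 < e ->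
    exists N, forall n, (N <= n)%N -> forall x, cube H n x ->
      s * walk_mean w F n x <= s * limit_mean PW W F + e.
  move=> s1 H e H0 e0; pose c : R := (2 * M)^-1.
  have c0 : 0 < c by rewrite invr_gt0 mulr_gt0.
  have bF : bcont F by split => //; exists M.
  have bsF := bcontZ (c * s) bF; have bh := bcont_cst d (2^-1 : R).
  have bG := bcontD bsF bh.
  have G01 f : 0 <= c * s * F f + 2^-1 <= 1.
    have : `|c * s * F f| <= 2^-1.
      rewrite !normrM s1 mulr1 gtr0_norm //.
      apply: (@le_trans _ _ (c * M)); first by rewrite ler_wpM2l // ltW.
      by rewrite /c invfM mulfVK ?lt0r_neq0.
    by rewrite ler_norml => /andP[? ?]; apply/andP; split; lra.
  have [N HN] := unit_upper bG.1 G01 H0 (mulr_gt0 c0 e0).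
  exists N => n Nn x xH; have := HN n Nn x xH.
  rewrite walk_meanD walk_meanZ (walk_mean_cst d_gt0 kappa_gt0 w_bnd).
  rewrite /limit_mean (ErD PW (bcont_bmeas mW bsF) (bcont_bmeas mW bh)).
  rewrite (ErZ PW (c * s) (bcont_bmeas mW bF)) Er_cst -/(limit_mean PW W F).
  rewrite addrAC lerD2r -!mulrA -mulrDr ler_pM2l //.
move=> H e H0 e0.
have [N1 HN1] := half 1 (normr1 _) H e H0 e0.
have [N2 HN2] := half (-1) (normrN1 _) H e H0 e0.
exists (maxn N1 N2) => n; rewrite geq_max => /andP[n1 n2] x xH.
have := HN1 n n1 x xH; have := HN2 n n2 x xH; rewrite !mulN1r !mul1r => ? ?.
by rewrite ler_norml; apply/andP; split; lra.
Qed.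

End portmanteau.

(** * Limits of extended-real suprema and infima *)

Section ereal_limits.
Variable R : realType.
Local Open Scope ereal_scope.

(** The first hypothesis excludes the empty set, whose supremum would be minus infinity; for the
    cubes the origin provides the element. *)
Lemma ereal_sup_cvg0 (S : nat -> set (\bar R)) :
  (forall n, exists2 y, S n y & 0 <= y) ->
  (forall e : R, (0 < e)%R -> exists N, forall n, (N <= n)%N ->
    forall y, S n y -> y <= e%:E) ->
  ereal_sup (S n) @[n --> \oo] --> 0.
Proof.
move=> S0 Se; have lo n : 0 <= ereal_sup (S n).
  by have [y Sy y0] := S0 n; apply: le_trans y0 _; exact: ereal_sup_ubound.
have hi (e : R) : (0 < e)%R -> exists N, forall n, (N <= n)%N -> ereal_sup (S n) <= e%:E.
  by move=> /Se[N HN]; exists N => n Nn; apply: ge_ereal_sup => y; exact: HN.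
have fin (n : nat) (e : R) : ereal_sup (S n) <= e%:E -> ereal_sup (S n) \is a fin_num.
  by move=> h; rewrite ge0_fin_numE // (le_lt_trans h) // ltry.
apply/fine_cvgP; split.
  by have [N HN] := hi 1%R ltr01; exists N => // n /= Nn; exact: fin (HN n Nn).
apply/cvgrPdist_le => e e0; have [N HN] := hi e e0.
exists N => // n /= Nn; rewrite sub0r normrN ger0_norm ?fine_ge0 //.
by rewrite -lee_fin fineK ?HN //; exact: fin (HN n Nn).
Qed.

Lemma limn_esup_le (u : nat -> \bar R) (a : \bar R) :
  (forall e : R, (0 < e)%R -> exists N, forall n, (N <= n)%N -> u n <= a + e%:E) ->
  limn_esup u <= a.
Proof.
move=> H; apply/lee_addgt0Pr => e /H[N HN].
rewrite /limn_esup /limf_esup; apply: (@le_trans _ _ (ereal_sup (u @` [set n | (N <= n)%N]))).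
  by apply: ereal_inf_lbound; exists [set n | (N <= n)%N] => //; exists N.
by apply: ge_ereal_sup => _ [n Nn <-]; exact: HN.
Qed.

Lemma le_limn_einf (u : nat -> \bar R) (a : \bar R) : a \is a fin_num ->
  (forall e : R, (0 < e)%R -> exists N, forall n, (N <= n)%N -> a <= u n + e%:E) ->
  a <= limn_einf u.
Proof.
move=> fa H; rewrite /limn_einf leeNr; apply: limn_esup_le => e /H[N HN].
exists N => n /HN; move: fa; case: a {H HN} => // a _; case: (u n) => [r| |] //=.
  by rewrite -!EFinD !lee_fin => ?; lra.
by rewrite leNye.
Qed.

End ereal_limits.

(** * The five forms of the uniform invariance principle *)

Section equivalent_statements.
Variables (R : realType) (d : nat).
Hypothesis d_gt0 : (0 < d)%N.
Local Notation C := (C01 R d).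
Local Notation V := 'rV[int]_d.
Local Notation shift := Defs.shift.
Variable P : probability (env R d) R.
Hypothesis P_stationary : stationary P.
Hypothesis P_UE : condition_UE P.
Variables (dX : measure_display) (TX : measurableType dX).
Variables (X : nat -> TX -> V) (Pq : env R d -> probability TX R).
Hypothesis X_walk : is_quenched_walk X Pq.
Variables (dW : measure_display) (TW : measurableType dW).
Variables (PW : probability TW R) (W : TW -> C).
Hypothesis mW : measurable_fun setT W.
Hypothesis CLT : quenched_CLT P X Pq PW W.

Let ae_good : exists2 kappa : R, 0 < kappa & {ae P, forall w,
  (forall b, kappa <= w b <= kappa^-1) /\
  (forall F : C -> R, unif_continuous F -> bounded_fun F -> uniform_cvg PW W w F)}.
Proof.
have [kappa k0 ell] := ae_elliptic P_stationary P_UE; exists kappa => //.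
by apply: (@filterS2 _ _ (ae_filter_ringOfSetsType P) _ _ _ _ ell
  (ae_uniform d_gt0 P_stationary P_UE X_walk mW CLT)) => w.
Qed.

Lemma cube0 H n : 0 <= H -> cube (d := d) (R := R) H n 0.
Proof. by move=> H0 i; rewrite mxE normr0 mulr_ge0 // sqrtr_ge0. Qed.

Let cvg_means (w : env R d) (kappa : R) (F : C -> R) (H : R) : 0 < kappa ->
  (forall b, kappa <= w b <= kappa^-1) -> 0 < H ->
  continuous F -> bounded_fun F -> uniform_cvg PW W w F ->
  (ereal_sup [set `|'E_(Pq (shift x w))[F \o Z R X n] - 'E_PW[F \o W]|
     | x in cube H n] @[n --> \oo] --> 0)%E.
Proof.
move=> k0 w_bnd H0 cF [M0 [_ FM0]] uF.
have FM f : `|F f| <= `|M0| + 1.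
  by apply: FM0 => //; rewrite (le_lt_trans (ler_norm _)) // ltrDl.
have E n x : (`|'E_(Pq (shift x w))[F \o Z R X n] - 'E_PW[F \o W]| =
    `|walk_mean w F n x - limit_mean PW W F|%:E)%E.
  by rewrite (expectation_quenched d_gt0 X_walk k0 w_bnd n x FM)
    (ErE PW (bmeas_limit mW cF FM)).
apply: ereal_sup_cvg0 => [n|e e0].
  exists (`|'E_(Pq (shift 0%R w))[F \o Z R X n] - 'E_PW[F \o W]|)%E.
    by exists 0 => //; exact/cube0/ltW.
  by rewrite abse_ge0.
have [N HN] := uF H e H0 e0; exists N => n Nn _ [x xH <-].
by rewrite E lee_fin; exact: HN.
Qed.

Lemma uniform_CLT_unif_continuous_holds : uniform_CLT_unif_continuous P X Pq PW W.
Proof.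
have [kappa k0 good] := ae_good.
apply: (@filterS _ _ (ae_filter_ringOfSetsType P) _ _ _ good) => w [w_bnd uw] H F H0 bF uF.
by apply: (cvg_means k0 w_bnd) => //; [exact: unif_continuous_continuous|exact: uw].
Qed.

Lemma uniform_CLT_continuous_holds : uniform_CLT_continuous P X Pq PW W.
Proof.
have [kappa k0 good] := ae_good.
apply: (@filterS _ _ (ae_filter_ringOfSetsType P) _ _ _ good) => w [w_bnd uw] H F H0 bF cF.
by apply: (cvg_means k0 w_bnd) => //; exact: (bounded_uniform d_gt0 mW k0 w_bnd uw).
Qed.

Let closed_le (w : env R d) (kappa : R) (B : set C) (H e : R) : 0 < kappa ->
  (forall b, kappa <= w b <= kappa^-1) ->
  (forall F : C -> R, unif_continuous F -> bounded_fun F -> uniform_cvg PW W w F) ->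
  closed B -> 0 < H -> 0 < e -> exists N, forall n, (N <= n)%N -> forall x, cube H n x ->
    (Pq (shift x w) (Z R X n @^-1` B) <= PW (W @^-1` B) + e%:E)%E.
Proof.
move=> k0 w_bnd uw cB H0 e0.
have [N HN] := closed_upper d_gt0 mW k0 w_bnd uw cB H0 e0.
exists N => n Nn x xH; rewrite (probability_quenched d_gt0 X_walk k0 w_bnd).
rewrite -(@fineK _ (PW (W @^-1` B))) ?fin_num_measure //.
  by rewrite -EFinD lee_fin; exact: HN.
exact: measurable_limit_closed.
Qed.

Lemma uniform_CLT_closed_holds : uniform_CLT_closed P X Pq PW W.
Proof.
have [kappa k0 good] := ae_good.
apply: (@filterS _ _ (ae_filter_ringOfSetsType P) _ _ _ good) => w [w_bnd uw] H B H0 cB.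
apply: limn_esup_le => e e0; have [N HN] := closed_le k0 w_bnd uw cB H0 e0.
by exists N => n Nn; apply: ge_ereal_sup => _ [x xH <-]; exact: HN.
Qed.

Let open_ge (w : env R d) (kappa : R) (G : set C) (H e : R) : 0 < kappa ->
  (forall b, kappa <= w b <= kappa^-1) ->
  (forall F : C -> R, unif_continuous F -> bounded_fun F -> uniform_cvg PW W w F) ->
  open G -> 0 < H -> 0 < e -> exists N, forall n, (N <= n)%N -> forall x, cube H n x ->
    (PW (W @^-1` G) <= Pq (shift x w) (Z R X n @^-1` G) + e%:E)%E.
Proof.
move=> k0 w_bnd uw oG H0 e0.
have [N HN] := closed_le k0 w_bnd uw (open_closedC oG) H0 e0.
exists N => n Nn x xH; have := HN n Nn x xH.
have mZ := measurable_Z d_gt0 X_walk k0 w_bnd n G.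
have mG := measurable_limit_open mW oG.
rewrite -!preimage_setC (probability_setC _ mZ) (probability_setC _ mG).
rewrite -(@fineK _ (PW (W @^-1` G))) ?fin_num_measure //.
rewrite -(@fineK _ (Pq (shift x w) (Z R X n @^-1` G))) ?fin_num_measure //.
by rewrite -!EFinB -!EFinD !lee_fin => ?; lra.
Qed.

Lemma uniform_CLT_open_holds : uniform_CLT_open P X Pq PW W.
Proof.
have [kappa k0 good] := ae_good.
apply: (@filterS _ _ (ae_filter_ringOfSetsType P) _ _ _ good) => w [w_bnd uw] H G H0 oG.
apply: le_limn_einf => [|e e0].
  by apply: fin_num_measure; exact: measurable_limit_open.
have [N HN] := open_ge k0 w_bnd uw oG H0 e0.
exists N => n Nn; rewrite -leeBlDr //; apply: le_ereal_inf_tmp => _ [x xH <-].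
by rewrite leeBlDr //; exact: HN.
Qed.

(** Interior, set and closure have equal mass under the limit law, so the closed-set bound for the
    closure and the open-set bound for the interior enclose the probability of [A]. *)
Lemma uniform_CLT_continuity_set_holds : uniform_CLT_continuity_set P X Pq PW W.
Proof.
have [kappa k0 good] := ae_good.
apply: (@filterS _ _ (ae_filter_ringOfSetsType P) _ _ _ good) => w [w_bnd uw] H A H0 mA bA.
have mc := measurable_limit_closed mW (@closed_closure _ A).
have mi := measurable_limit_open mW (@open_interior _ A).
have mWA : measurable (W @^-1` A).
  by rewrite -[X in measurable X]setTI; exact: mW.
have iA : W @^-1` A° `<=` W @^-1` A by move=> a; exact: interior_subset.
have Ac : W @^-1` A `<=` W @^-1` (closure A) by move=> a; exact: subset_closure.
have mZ n B := measurable_Z d_gt0 X_walk k0 w_bnd n B.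
have eqd : PW (W @^-1` (closure A)) = PW (W @^-1` A°).
  rewrite -[W @^-1` closure A](setDUK (subset_trans iA Ac)) measureU //; last 2 first.
  - exact: measurableD.
  - by rewrite setDIK.
  by rewrite [X in (_ + X)%E]bA adde0.
have ci : PW (W @^-1` A°) = PW (W @^-1` A).
  apply/eqP; rewrite eq_le -{2}eqd.
  by rewrite !le_measure ?inE.
apply: ereal_sup_cvg0 => [n|e e0].
  exists (`|Pq (shift 0%R w) (Z R X n @^-1` A) - PW (W @^-1` A)|)%E.
    by exists 0 => //; exact/cube0/ltW.
  by rewrite abse_ge0.
have [N1 HN1] := closed_le k0 w_bnd uw (@closed_closure _ A) H0 e0.
have [N2 HN2] := open_ge k0 w_bnd uw (@open_interior _ A) H0 e0.
exists (maxn N1 N2) => n; rewrite geq_max => /andP[n1 n2] _ [x xH <-].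
have up : (Pq (shift x w) (Z R X n @^-1` A) <= PW (W @^-1` A) + e%:E)%E.
  rewrite -ci -eqd; apply: le_trans (HN1 n n1 x xH).
  by apply: le_measure; rewrite ?inE //; move=> a; exact: subset_closure.
have dn : (PW (W @^-1` A) <= Pq (shift x w) (Z R X n @^-1` A) + e%:E)%E.
  rewrite -ci; apply: (le_trans (HN2 n n2 x xH)); rewrite leeD2r //.
  by apply: le_measure; rewrite ?inE //; move=> a; exact: interior_subset.
move: up dn; rewrite -(@fineK _ (PW (W @^-1` A))) ?fin_num_measure //.
rewrite -(@fineK _ (Pq (shift x w) (Z R X n @^-1` A))) ?fin_num_measure //.
rewrite -!EFinD /= !lee_fin => ? ?.
by rewrite ler_norml; apply/andP; split; lra.
Qed.

End equivalent_statements.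
Theorem theorem1p2 (R : realType) (d : nat) (hd : (2 <= d)%N)
  (P : probability (env R d) R)
  (P_nonneg : nonnegative_law P)
  (P_stationary : stationary P)
  (P_ergodic : ergodic P)
  (P_UE : condition_UE P)
  (dX : measure_display) (TX : measurableType dX)
  (X : nat -> TX -> 'rV[int]_d) (Pq : env R d -> probability TX R)
  (X_walk : is_quenched_walk X Pq)
  (Sigma : 'M[R]_d) (Sigma_posdef : posdef Sigma)
  (dW : measure_display) (TW : measurableType dW)
  (PW : probability TW R) (W : TW -> C01 R d)
  (W_brownian : brownian_motion PW W Sigma)
  (Sigma_CLT : quenched_CLT P X Pq PW W) :
  let i := uniform_CLT_continuous P X Pq PW W in
  let ii := uniform_CLT_unif_continuous P X Pq PW W in
  let iii := uniform_CLT_closed P X Pq PW W in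
  let iv := uniform_CLT_open P X Pq PW W in
  let v := uniform_CLT_continuity_set P X Pq PW W in
  [/\ i, ii, iii, iv & v] /\
  [/\ i <-> ii, i <-> iii, i <-> iv & i <-> v].
Proof.
have [mW _ _ _] := W_brownian.
have d0 : (0 < d)%N by exact: ltnW.
move=> i ii iii iv v.
have hi : i by exact: (uniform_CLT_continuous_holds d0 P_stationary P_UE X_walk mW Sigma_CLT).
have hii : ii by exact: (uniform_CLT_unif_continuous_holds d0 P_stationary P_UE X_walk mW Sigma_CLT).
have hiii : iii by exact: (uniform_CLT_closed_holds d0 P_stationary P_UE X_walk mW Sigma_CLT).
have hiv : iv by exact: (uniform_CLT_open_holds d0 P_stationary P_UE X_walk mW Sigma_CLT).
have hv : v by exact: (uniform_CLT_continuity_set_holds d0 P_stationary P_UE X_walk mW Sigma_CLT).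
by split; [split|split; split].
Qed.
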